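(* Let $\mathbb K$ be a ring, $S$ a $\mathbb K$-ring that is flat as a left $\mathbb K$-module, $(V,\mathfrak t_V)$ a $\mathbb K$-bimodule with a twisting $\mathfrak t_V:S\otimes_{\mathbb K}V\to V\otimes_{\mathbb K}S$ as in the context, $T=T_{\mathbb K}(V)$, $n\ge2$, $R\subseteq T^n$ a $\mathfrak t^*$-invariant $\mathbb K$-subbimodule and $A=T/\langle R\rangle$ (so that $R$ is an $n$-pure bimodule of relations for $A$). Assume that $A^1=V$ and $R$ are projective as right $\mathbb K$-modules and that $\operatorname{Tor}_3^A(\mathbb K,\mathbb K)$ is $(n+1)$-pure. Let $\mathscr A=A\otimes_{\mathfrak t}S$, $\mathscr V=V\otimes_{\mathbb K}S$, $\mathscr T=T_S(\mathscr V)$, $\mathscr R=\psi_T(R\otimes_{\mathbb K}S)$, so that $\mathscr A\cong\mathscr T/\langle\mathscr R\rangle$; let $\mathscr P$ be an $S$-subbimodule of $\mathscr T^{\le n}$ with $p^n_{\mathscr T}(\mathscr P)=\mathscr R$, and let $P:=\psi_T^{-1}(\mathscr P)\subseteq T\otimes_{\mathbb K}S$. The $S$-ring $\mathscr U=\mathscr T/\langle\mathscr P\rangle$ is a PBW-deformation of $\mathscr A$ if and only if there exists a morphism of filtered $\mathbb K$-bimodules $\alpha_R:R\to T\otimes_{\mathbb K}S$ such that $\alpha_R(R)S=P$ and either $\operatorname{Tor}_3^A(\mathbb K,\mathbb K)=0$ or the following conditions hold, for functions defined on $X:=(R\otimes_{\mathbb K}V)\cap(V\otimes_{\mathbb K}R)$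 and all $0<i<n$ (all tensor products over $\mathbb K$): $(\mathcal J_0'')$ $\big[V\otimes\alpha_{R,1}-(T^{n-1}\otimes\mathfrak t_V)(\alpha_{R,1}\otimes V)\big](X)\subseteq R\otimes S$; $(\mathcal J_i'')$ $(T\otimes m_S)(\alpha_{R,i}\otimes S)\big[V\otimes\alpha_{R,1}-(T^{n-1}\otimes\mathfrak t_V)(\alpha_{R,1}\otimes V)\big]=V\otimes\alpha_{R,i+1}-(T^{n-i-1}\otimes\mathfrak t_V)(\alpha_{R,i+1}\otimes V)$; $(\mathcal J_n'')$ $(T\otimes m_S)(\alpha_{R,n}\otimes S)\big[V\otimes\alpha_{R,1}-(T^{n-1}\otimes\mathfrak t_V)(\alpha_{R,1}\otimes V)\big]=0$.
   Context: Twisting: $\mathfrak t_V:S\otimes_{\mathbb K}V\to V\otimes_{\mathbb K}S$ is $\mathbb K$-bilinear with $\mathfrak t_V(m_S\otimes V)=(V\otimes m_S)(\mathfrak t_V\otimes S)(S\otimes\mathfrak t_V)$ and $\mathfrak t_V(1\otimes v)=v\otimes1$, where $m_S$ is the multiplication of $S$. Let $T=T_{\mathbb K}(V)$ with $T^m=V^{\otimes_{\mathbb K}m}$. The lifting $\mathfrak t^*:S\otimes_{\mathbb K}T\to T\otimes_{\mathbb K}S$ has components $\mathfrak t^m:S\otimes_{\mathbb K}T^m\to T^m\otimes_{\mathbb K}S$, with $\mathfrak t^0$ the canonical isomorphism, $\mathfrak t^1=\mathfrak t_V$, $\mathfrak t^{m+1}=(T^m\otimes\mathfrak t_V)(\mathfrak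 t^m\otimes V)$. $R\subseteq T^n$ is $\mathfrak t^*$-invariant if $\mathfrak t^n(S\otimes_{\mathbb K}R)=R\otimes_{\mathbb K}S$. Then $\mathfrak t^*$ induces $\mathfrak t:S\otimes_{\mathbb K}A\to A\otimes_{\mathbb K}S$. Twisted tensor product: for $B=T$ or $A$ with twisting $\mathfrak t$ (write $\mathfrak t(s\otimes b)=\sum b_{\mathfrak t}\otimes s_{\mathfrak t}$), $B\otimes_{\mathfrak t}S$ is $B\otimes_{\mathbb K}S$ with multiplication $(b\otimes s)(b'\otimes s')=\sum bb'_{\mathfrak t}\otimes s_{\mathfrak t}s'$ and unit map $s\mapsto1\otimes s$, graded by $B^m\otimes_{\mathbb K}S$; it is a connected graded $S$-ring. In particular $\mathscr V=V\otimes_{\mathbb K}S$ is an $S$-bimodule with right regular action and left action $s\cdot(v\otimes s')=\sum v_{\mathfrak t_V}\otimes s_{\mathfrak t_V}s'$. The map $\psi_T:T\otimes_{\mathfrak t^*}S\to\mathscr T=T_S(\mathscr V)$, $v_1\otimes\cdots\otimes v_m\otimes s\mapsto(v_1\otimes1)\otimes_S\cdots\otimes_S(v_{m-1}\otimes1)\otimes_S(v_m\otimes s)$, is an isomorphism of graded $S$-rings and induces $\mathscr A\cong\mathscr T/\langle\mathscr R\rangle$. A graded module $M$ is $m$-pure if $M=M^m$ (zero allowed); $\operatorname{Tor}$ carries the internal grading. $\mathscr T^{\le m}=\bigoplus_{q\le m}\mathscr T^q$; $p_{\mathscr T}^m:\mathscr T\to\mathscr T^m$ is the projection. $\mathscr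 U$ is filtered by the images $\mathscr U^{\le m}$ of $\mathscr T^{\le m}$; it is a PBW-deformation of $\mathscr A=\mathscr T/\langle\mathscr R\rangle$ if the graded $S$-ring map $\mathscr T/\langle\mathscr R\rangle\to\operatorname{gr}\mathscr U$, $x+\langle\mathscr R\rangle\mapsto(x+\langle\mathscr P\rangle)+\mathscr U^{\le m-1}$ ($x\in\mathscr T^m$), is an isomorphism. $T\otimes_{\mathbb K}S$ is filtered by $T^{\le m}\otimes_{\mathbb K}S$. A morphism of filtered $\mathbb K$-bimodules $\alpha_R:R\to T\otimes_{\mathbb K}S$ is a $\mathbb K$-bimodule map $R\to T^{\le n}\otimes_{\mathbb K}S$; $\alpha_{R,i}:R\to T^{n-i}\otimes_{\mathbb K}S$ ($0\le i\le n$) are its components, and by convention $\alpha_{R,0}(r)=r\otimes1$. $\alpha_R(R)S$ is the right $S$-submodule generated by $\alpha_R(R)$. In the formulas, a module stands for its identity map, $T^m\otimes V=T^{m+1}=V\otimes T^m$, and $(\alpha_{R,i}\otimes S)$ is applied to elements of $R\otimes S$ (after $(\mathcal J_0'')$). The intersection $X$ is formed over $T^{n+1}$: an element is a pair $(u,w)\in(V\otimes_{\mathbb K}R)\times(R\otimes_{\mathbb K}V)$ with the same image in $T^{n+1}$; maps of the form $V\otimes\alpha_{R,i}$ are evaluated on $u$ and maps involving $\alpha_{R,i}\otimes V$ on $w$; when the canonical maps are injective this is literally the intersection. *)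

(* Defs.v *)
From HB Require Import structures.
From mathcomp Require Import all_boot all_algebra.
From mathcomp Require Import freeg.
From mathcomp Require Import boolp classical_sets functions.

Set Implicit Arguments.
Unset Strict Implicit.
Unset Printing Implicit Defensive.

Import GRing.Theory.
Local Open Scope ring_scope.
Local Open Scope classical_set_scope.

Record subgrp (G : zmodType) := Subgrp {
  smem :> G -> Prop;
  smem0 : smem 0;
  smemB : forall x y, smem x -> smem y -> smem (x - y) }.

Section Subgroup.
Variables (G : zmodType) (H : subgrp G).

Lemma smemN x : H x -> H (- x).
Proof. by move=> Hx; rewrite -sub0r; apply: smemB => //; apply: smem0. Qed.

Lemma smemD x y : H x -> H y -> H (x + y).
Proof. by move=> Hx Hy; rewrite -[y]opprK; apply: smemB => //; apply: smemN. Qed.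

Definition sgpred : {pred G} := fun x => `[< H x >].

Fact sgpred_closed : zmod_closed sgpred.
Proof.
split=> [|x y]; first by apply/asboolP; apply: smem0.
by move=> /asboolP Hx /asboolP Hy; apply/asboolP; apply: smemB.
Qed.

HB.instance Definition _ := GRing.isZmodClosed.Build G sgpred sgpred_closed.

Definition qgrp : zmodType := Quotient.quot sgpred.
Definition qpi (x : G) : qgrp := \pi_(Quotient.quot sgpred)%qT x.

Lemma qpiB x y : qpi (x - y) = qpi x - qpi y.
Proof. exact: (raddfB \pi_(Quotient.quot sgpred)%qT). Qed.
Lemma qpi0 : qpi 0 = 0.
Proof. exact: (raddf0 \pi_(Quotient.quot sgpred)%qT). Qed.
Lemma qpiD x y : qpi (x + y) = qpi x + qpi y.
Proof. exact: (raddfD \pi_(Quotient.quot sgpred)%qT). Qed.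
Lemma qpi_eq x y : qpi x = qpi y <-> H (x - y).
Proof.
have E : ((x - y) \in sgpred) = (qpi x == qpi y) by exact: Quotient.idealrBE.
split=> h; first by apply/asboolP; rewrite -[`[< _ >]]/((x - y) \in sgpred) E; apply/eqP.
by apply/eqP; rewrite -E; apply/asboolP.
Qed.
Lemma qpi_surj q : exists x, q = qpi x.
Proof. by exists (repr (q : Quotient.quot sgpred)); rewrite /qpi reprK. Qed.

Definition qlift (Z : Type) (f : G -> Z) (q : qgrp) : Z :=
  f (repr (q : Quotient.quot sgpred)).

Lemma qliftE (Z : Type) (f : G -> Z) x :
  (forall x y, H (x - y) -> f x = f y) -> qlift f (qpi x) = f x.
Proof. by move=> Hf; apply: Hf; apply/qpi_eq; rewrite /qpi reprK. Qed.

End Subgroup.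

Section Span.
Variables (G : zmodType) (X : set G).

Inductive span_set : set G :=
| span_gen x : X x -> span_set x
| span_zero : span_set 0
| span_sub x y : span_set x -> span_set y -> span_set (x - y).

Definition span : subgrp G := Subgrp span_zero span_sub.
End Span.

Section TensorGroup.
Variables (K : pzRingType) (M N : zmodType) (ra : M -> K -> M) (la : K -> N -> N).

Inductive tens_rel : {freeg (M * N)%type} -> Prop :=
| tens_relDl m m' n : tens_rel (<< (m + m', n) >> - << (m, n) >> - << (m', n) >>)
| tens_relDr m n n' : tens_rel (<< (m, n + n') >> - << (m, n) >> - << (m, n') >>)
| tens_relM m k n : tens_rel (<< (ra m k, n) >> - << (m, la k n) >>).

Definition tens_grp : zmodType := qgrp (span tens_rel).

Definition pure (m : M) (n : N) : tens_grp := qpi (span tens_rel) << (m, n) >>.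

Lemma pureDl m m' n : pure (m + m') n = pure m n + pure m' n.
Proof.
rewrite /pure -qpiD; apply/qpi_eq; apply: span_gen.
by rewrite opprD addrA; apply: tens_relDl.
Qed.
Lemma pureDr m n n' : pure m (n + n') = pure m n + pure m n'.
Proof.
rewrite /pure -qpiD; apply/qpi_eq; apply: span_gen.
by rewrite opprD addrA; apply: tens_relDr.
Qed.
Lemma pureM m k n : pure (ra m k) n = pure m (la k n).
Proof. by apply/qpi_eq; apply: span_gen; apply: tens_relM. Qed.
Lemma pure0l n : pure 0 n = 0.
Proof. by apply: (addrI (pure 0 n)); rewrite addr0 -pureDl addr0. Qed.
Lemma pure0r m : pure m 0 = 0.
Proof. by apply: (addrI (pure m 0)); rewrite addr0 -pureDr addr0. Qed.
Lemma pureNl m n : pure (- m) n = - pure m n.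
Proof. by apply: (addrI (pure m n)); rewrite -pureDl !subrr pure0l. Qed.

Lemma tens_ind (P : tens_grp -> Prop) :
  (forall m n, P (pure m n)) -> (forall x y, P x -> P y -> P (x + y)) ->
  forall x, P x.
Proof.
move=> Pp PD x; have P0 : P 0 by rewrite -(pure0l 0).
have [D ->] := qpi_surj x; rewrite -[D]freeg_sumE.
elim: (dom D) => [|z s IHs]; first by rewrite big_nil qpi0.
rewrite big_cons qpiD; apply: (PD) => //; case: z => m n.
have PM m' k : P (pure m' n *+ k).
  by elim: k => [|k IHk]; rewrite ?mulrS //; apply: (PD).
have PMN k : P (pure m n *- k) by rewrite -mulNrn -pureNl.
have qpiM k : qpi (span tens_rel) (<< (m, n) >> *+ k) = pure m n *+ k.
  by elim: k => [|k IHk]; rewrite ?qpi0 // !mulrS qpiD IHk.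
case: (coeff _ _) => k; first by rewrite -[Posz k]natz -freegU_muln qpiM.
by rewrite NegzE -freegUN -sub0r qpiB qpi0 sub0r -natz -freegU_muln qpiM.
Qed.

Section Lift.
Variables (Z : zmodType) (f : M -> N -> Z).

Definition balanced :=
  [/\ forall m m' n, f (m + m') n = f m n + f m' n,
      forall m n n', f m (n + n') = f m n + f m n'
    & forall m k n, f (ra m k) n = f m (la k n)].

Definition tlift : tens_grp -> Z :=
  @qlift _ (span tens_rel) Z (fglift (fun p => f p.1 p.2 : (zmodule Z))).

Hypothesis Hf : balanced.

Let fl := fglift (fun p => f p.1 p.2 : (zmodule Z)).
Let flB x y : fl (x - y) = fl x - fl y. Proof. exact: lift_is_additive. Qed.
Let fl0 : fl 0 = 0. Proof. by rewrite -(subrr 0) flB subrr. Qed.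
Let flD x y : fl (x + y) = fl x + fl y.
Proof. by rewrite -{1}[y]opprK flB -(sub0r y) flB fl0 sub0r opprK. Qed.
Let flU p : fl << p >> = f p.1 p.2. Proof. by rewrite /fl liftU scale1r. Qed.

Let fl_eq x y : span tens_rel (x - y) -> fl x = fl y.
Proof.
move=> h; apply/eqP; rewrite -subr_eq0 -flB; apply/eqP.
elim: h => {x y} [x [m m' n|m n n'|m k n]||x y _ IHx _ IHy].
- by case: Hf => h _ _; rewrite !flB !flU h addrAC addrK subrr.
- by case: Hf => _ h _; rewrite !flB !flU h addrAC addrK subrr.
- by case: Hf => _ _ h; rewrite !flB !flU h subrr.
- exact: fl0.
- by rewrite flB IHx IHy subr0.
Qed.

Lemma tliftE m n : tlift (pure m n) = f m n.
Proof. by rewrite /tlift /pure qliftE ?flU. Qed.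

Lemma tliftD x y : tlift (x + y) = tlift x + tlift y.
Proof.
have [x' ->] := qpi_surj x; have [y' ->] := qpi_surj y.
by rewrite -qpiD /tlift !qliftE // -/fl flD.
Qed.

End Lift.
End TensorGroup.

Record is_bimod (L K : pzRingType) (M : zmodType)
    (la : L -> M -> M) (ra : M -> K -> M) : Prop := IsBimod {
  bm_lDr : forall l x y, la l (x + y) = la l x + la l y;
  bm_lDl : forall l l' x, la (l + l') x = la l x + la l' x;
  bm_lA : forall l l' x, la (l * l') x = la l (la l' x);
  bm_l1 : forall x, la 1 x = x;
  bm_rDl : forall x y k, ra (x + y) k = ra x k + ra y k;
  bm_rDr : forall x k k', ra x (k + k') = ra x k + ra x k';
  bm_rA : forall x k k', ra x (k * k') = ra (ra x k) k';
  bm_r1 : forall x, ra x 1 = x;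
  bm_lr : forall l x k, ra (la l x) k = la l (ra x k) }.

Record bimod (L K : pzRingType) := Bimod {
  bcar :> zmodType;
  lact : L -> bcar -> bcar;
  ract : bcar -> K -> bcar;
  bimodP : is_bimod lact ract }.

(* One-sided modules are bimodules whose other side is the ring of integers:
   the integer action is determined by the group structure. *)
Notation rmod A := (bimod int A).
Notation lmod A := (bimod A int).

Section BimodTheory.
Variables (L K : pzRingType) (M : bimod L K).
Implicit Types (x y : M) (l : L) (k : K).

Lemma lactDr l x y : lact l (x + y) = lact l x + lact l y.
Proof. exact: bm_lDr (bimodP M) _ _ _. Qed.
Lemma lactDl l l' x : lact (l + l') x = lact l x + lact l' x.
Proof. exact: bm_lDl (bimodP M) _ _ _. Qed.
Lemma lactA l l' x : lact (l * l') x = lact l (lact l' x).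
Proof. exact: bm_lA (bimodP M) _ _ _. Qed.
Lemma lact1 x : lact 1 x = x.
Proof. exact: bm_l1 (bimodP M) _. Qed.
Lemma ractDl x y k : ract (x + y) k = ract x k + ract y k.
Proof. exact: bm_rDl (bimodP M) _ _ _. Qed.
Lemma ractDr x k k' : ract x (k + k') = ract x k + ract x k'.
Proof. exact: bm_rDr (bimodP M) _ _ _. Qed.
Lemma ractA x k k' : ract x (k * k') = ract (ract x k) k'.
Proof. exact: bm_rA (bimodP M) _ _ _. Qed.
Lemma ract1 x : ract x 1 = x.
Proof. exact: bm_r1 (bimodP M) _. Qed.
Lemma lract l x k : ract (lact l x) k = lact l (ract x k).
Proof. exact: bm_lr (bimodP M) _ _ _. Qed.
Lemma lact0 l : lact l (0 : M) = 0.
Proof. by apply: (addrI (lact l 0)); rewrite -lactDr !addr0. Qed.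
Lemma ract0 k : ract (0 : M) k = 0.
Proof. by apply: (addrI (ract 0 k)); rewrite -ractDl !addr0. Qed.
End BimodTheory.

Record is_bihom (L K : pzRingType) (M N : bimod L K) (f : M -> N) : Prop :=
  IsBihom {
  bh_D : forall x y, f (x + y) = f x + f y;
  bh_l : forall l x, f (lact l x) = lact l (f x);
  bh_r : forall x k, f (ract x k) = ract (f x) k }.

Record bihom (L K : pzRingType) (M N : bimod L K) := Bihom {
  bfun :> M -> N;
  bihomP : is_bihom bfun }.

Section BihomTheory.
Variables (L K : pzRingType).

Section One.
Variables (M N : bimod L K) (f : bihom M N).
Lemma bhD x y : f (x + y) = f x + f y. Proof. exact: bh_D (bihomP f) _ _. Qed.
Lemma bhl l x : f (lact l x) = lact l (f x).
Proof. exact: bh_l (bihomP f) _ _. Qed.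
Lemma bhr x k : f (ract x k) = ract (f x) k.
Proof. exact: bh_r (bihomP f) _ _. Qed.
Lemma bh0 : f 0 = 0.
Proof. by apply: (addrI (f 0)); rewrite -bhD !addr0. Qed.
Lemma bhB x y : f (x - y) = f x - f y.
Proof. by apply: (addIr (f y)); rewrite -bhD !subrK. Qed.
End One.

Definition bid (M : bimod L K) : bihom M M :=
  @Bihom L K M M id (IsBihom (fun _ _ => erefl) (fun _ _ => erefl) (fun _ _ => erefl)).

Lemma bcomp_subproof (M N P : bimod L K) (g : bihom N P) (f : bihom M N) :
  is_bihom (g \o f).
Proof. by split=> *; rewrite /= ?(bhD, bhl, bhr). Qed.

Definition bcomp (M N P : bimod L K) (g : bihom N P) (f : bihom M N) : bihom M P :=
  Bihom (bcomp_subproof g f).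

End BihomTheory.

Notation "g ∘ f" := (bcomp g f) (at level 40, left associativity).

Section Regular.
Variable K : pzRingType.
Lemma reg_subproof : @is_bimod K K K *%R *%R.
Proof.
by split=> *; rewrite ?(mulrDl, mulrDr, mulrA, mul1r, mulr1).
Qed.
Definition reg : bimod K K := Bimod reg_subproof.
End Regular.

Section Restriction.
Variables (L L' K K' : pzRingType).

Lemma lres_subproof (f : {rmorphism L' -> L}) (M : bimod L K) :
  @is_bimod L' K M (fun l => lact (f l)) (@ract _ _ M).
Proof.
split=> *; rewrite ?(rmorphD, rmorphM, rmorph1).
- exact: lactDr. - exact: lactDl. - exact: lactA. - exact: lact1.
- exact: ractDl. - exact: ractDr. - exact: ractA. - exact: ract1.
- exact: lract.
Qed.
Definition lres (f : {rmorphism L' -> L}) (M : bimod L K) : bimod L' K :=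
  Bimod (lres_subproof f M).

Lemma rres_subproof (f : {rmorphism K' -> K}) (M : bimod L K) :
  @is_bimod L K' M (@lact _ _ M) (fun x k => ract x (f k)).
Proof.
split=> *; rewrite ?(rmorphD, rmorphM, rmorph1).
- exact: lactDr. - exact: lactDl. - exact: lactA. - exact: lact1.
- exact: ractDl. - exact: ractDr. - exact: ractA. - exact: ract1.
- exact: lract.
Qed.
Definition rres (f : {rmorphism K' -> K}) (M : bimod L K) : bimod L K' :=
  Bimod (rres_subproof f M).
End Restriction.

Definition intr_mor (K : pzRingType) : {rmorphism int -> K} := intmul 1.

Definition as_rmod (L K : pzRingType) (M : bimod L K) : rmod K :=
  lres (intr_mor L) M.
Definition as_lmod (L K : pzRingType) (M : bimod L K) : lmod L :=
  rres (intr_mor K) M.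

Record subbimod (L K : pzRingType) (M : bimod L K) := Subbimod {
  sbm :> subgrp M;
  sbm_l : forall l x, sbm x -> sbm (lact l x);
  sbm_r : forall x k, sbm x -> sbm (ract x k) }.

Section SubBimod.
Variables (L K : pzRingType) (M : bimod L K) (H : subbimod M).

Record subcar := Subcar { subval : M; subvalP : sgpred H subval }.

HB.instance Definition _ := [isSub for subval].
HB.instance Definition _ := [Choice of subcar by <:].
HB.instance Definition _ := [SubChoice_isSubZmodule of subcar by <:].

Lemma subcarP (x : subcar) : H (subval x).
Proof. by apply/asboolP; apply: subvalP. Qed.

Definition sublact l (x : subcar) : subcar :=
  Subcar (introT (asboolP _) (sbm_l l (subcarP x))).
Definition subract (x : subcar) k : subcar :=
  Subcar (introT (asboolP _) (sbm_r k (subcarP x))).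

Lemma sub_subproof : is_bimod sublact subract.
Proof.
split=> *; apply: val_inj => /=.
- exact: lactDr. - exact: lactDl. - exact: lactA. - exact: lact1.
- exact: ractDl. - exact: ractDr. - exact: ractA. - exact: ract1.
- exact: lract.
Qed.
Definition sub_bimod : bimod L K := Bimod sub_subproof.

Lemma sub_incl_subproof : @is_bihom L K sub_bimod M subval.
Proof. by []. Qed.
Definition sub_incl : bihom sub_bimod M := Bihom sub_incl_subproof.
End SubBimod.

Section Tensor.
Variables (L K L' : pzRingType).

Section Bimod.
Variables (M : bimod L K) (N : bimod K L').
Local Notation MN := (tens_grp (@ract _ _ M) (@lact _ _ N)).
Local Notation pu := (pure (@ract _ _ M) (@lact _ _ N)).

Lemma tens_lact_bal l : balanced (@ract _ _ M) (@lact _ _ N)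
  (fun m n => pu (lact l m) n).
Proof.
split=> *; first by rewrite lactDr pureDl.
  by rewrite pureDr.
by rewrite -lract pureM.
Qed.
Lemma tens_ract_bal l : balanced (@ract _ _ M) (@lact _ _ N)
  (fun m n => pu m (ract n l)).
Proof.
split=> *; first by rewrite pureDl.
  by rewrite ractDl pureDr.
by rewrite pureM lract.
Qed.

Definition tens_lact (l : L) : MN -> MN := tlift (fun m n => pu (lact l m) n).
Definition tens_ract (x : MN) (l : L') : MN := tlift (fun m n => pu m (ract n l)) x.

Lemma tens_subproof : is_bimod tens_lact tens_ract.
Proof.
have lE l m n : tens_lact l (pu m n) = pu (lact l m) n.
  by rewrite /tens_lact tliftE //; apply: tens_lact_bal.
have rE l m n : tens_ract (pu m n) l = pu m (ract n l).
  by rewrite /tens_ract tliftE //; apply: tens_ract_bal.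
have lD l x y : tens_lact l (x + y) = tens_lact l x + tens_lact l y.
  by rewrite /tens_lact tliftD //; apply: tens_lact_bal.
have rD l x y : tens_ract (x + y) l = tens_ract x l + tens_ract y l.
  by rewrite /tens_ract tliftD //; apply: tens_ract_bal.
split=> //.
- move=> l l'; elim/tens_ind => [m n|x y IHx IHy].
    by rewrite !lE lactDl pureDl.
  by rewrite !lD IHx IHy addrACA.
- move=> l l'; elim/tens_ind => [m n|x y IHx IHy]; first by rewrite !lE lactA.
  by rewrite !lD IHx IHy.
- elim/tens_ind => [m n|x y IHx IHy]; first by rewrite lE lact1.
  by rewrite lD IHx IHy.
- move=> x k k'; elim/tens_ind: x => [m n|x y IHx IHy].
    by rewrite !rE ractDr pureDr.
  by rewrite !rD IHx IHy addrACA.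
- move=> x k k'; elim/tens_ind: x => [m n|x y IHx IHy]; first by rewrite !rE ractA.
  by rewrite !rD IHx IHy.
- elim/tens_ind => [m n|x y IHx IHy]; first by rewrite rE ract1.
  by rewrite rD IHx IHy.
- move=> l x k; elim/tens_ind: x => [m n|x y IHx IHy]; first by rewrite lE !rE lE.
  by rewrite rD !lD rD IHx IHy.
Qed.

Definition tens : bimod L L' := Bimod tens_subproof.
Definition tpure (m : M) (n : N) : tens := pu m n.

Lemma tlactE l m n : lact l (tpure m n) = tpure (lact l m) n.
Proof. by rewrite /= /tens_lact tliftE //; apply: tens_lact_bal. Qed.
Lemma tractE l m n : ract (tpure m n) l = tpure m (ract n l).
Proof. by rewrite /= /tens_ract tliftE //; apply: tens_ract_bal. Qed.
Lemma tpureDl m m' n : tpure (m + m') n = tpure m n + tpure m' n.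
Proof. exact: pureDl. Qed.
Lemma tpureDr m n n' : tpure m (n + n') = tpure m n + tpure m n'.
Proof. exact: pureDr. Qed.
Lemma tpureM m k n : tpure (ract m k) n = tpure m (lact k n).
Proof. exact: pureM. Qed.
Lemma tpure0l n : tpure 0 n = 0. Proof. exact: pure0l. Qed.
Lemma tpure_ind (P : tens -> Prop) :
  (forall m n, P (tpure m n)) -> (forall x y, P x -> P y -> P (x + y)) ->
  forall x, P x.
Proof. exact: tens_ind. Qed.

Record is_bimul (Z : bimod L L') (f : M -> N -> Z) : Prop := IsBimul {
  bmul_Dl : forall m m' n, f (m + m') n = f m n + f m' n;
  bmul_Dr : forall m n n', f m (n + n') = f m n + f m n';
  bmul_M : forall m k n, f (ract m k) n = f m (lact k n);
  bmul_l : forall l m n, f (lact l m) n = lact l (f m n);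
  bmul_r : forall m n l, f m (ract n l) = ract (f m n) l }.

Lemma is_bimul_bal (Z : bimod L L') (f : M -> N -> Z) :
  is_bimul f -> balanced (@ract _ _ M) (@lact _ _ N) f.
Proof. by case=> *; split. Qed.

Lemma tens_hom_subproof (Z : bimod L L') (f : M -> N -> Z) :
  is_bimul f -> @is_bihom _ _ tens Z (tlift f).
Proof.
move=> Hf; have Hb := is_bimul_bal Hf.
have fD x y : tlift f (x + y) = tlift f x + tlift f y := tliftD Hb x y.
have fE m n : tlift f (tpure m n) = f m n := tliftE Hb m n.
split=> // [l x|x l]; elim/tpure_ind: x => [m n|x y IHx IHy].
- by rewrite tlactE !fE; case: Hf.
- by rewrite lactDr !fD IHx IHy lactDr.
- by rewrite tractE !fE; case: Hf.
- by rewrite ractDl !fD IHx IHy ractDl.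
Qed.

Definition tens_hom (Z : bimod L L') (f : M -> N -> Z) (Hf : is_bimul f) :
  bihom tens Z := Bihom (tens_hom_subproof Hf).

Lemma tens_homE (Z : bimod L L') (f : M -> N -> Z) (Hf : is_bimul f) m n :
  tens_hom Hf (tpure m n) = f m n.
Proof. exact: tliftE (is_bimul_bal Hf) _ _. Qed.

End Bimod.
End Tensor.

Arguments tens_hom {L K L' M N Z f} Hf.

Section TensorMaps.
Variables (L K L' : pzRingType).

Section Map.
Variables (M M' : bimod L K) (N N' : bimod K L') (f : bihom M M') (g : bihom N N').
Lemma tmap_subproof : @is_bimul _ _ _ M N (tens M' N') (fun m n => tpure (f m) (g n)).
Proof.
split=> *; rewrite ?(bhD, bhl, bhr).
- exact: tpureDl. - exact: tpureDr. - exact: tpureM.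
- by rewrite tlactE. - by rewrite tractE.
Qed.
Definition tmap : bihom (tens M N) (tens M' N') := tens_hom tmap_subproof.
Lemma tmapE m n : tmap (tpure m n) = tpure (f m) (g n).
Proof. exact: tens_homE. Qed.
End Map.

Variables (K' : pzRingType) (M : bimod L K) (N : bimod K K') (P : bimod K' L').

Lemma tassoc_bal p : balanced (@ract _ _ M) (@lact _ _ N)
  (fun m n => tpure m (tpure n p) : tens M (tens N P)).
Proof.
split=> *; first exact: tpureDl.
  by rewrite tpureDl tpureDr.
by rewrite tpureM tlactE.
Qed.
Definition tassoc_fun (x : tens M N) (p : P) : tens M (tens N P) :=
  tlift (fun m n => tpure m (tpure n p) : tens M (tens N P)) x.
Lemma tassoc_subproof : is_bimul tassoc_fun.
Proof.
have fD x y p : tassoc_fun (x + y) p = tassoc_fun x p + tassoc_fun y p.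
  exact: tliftD (tassoc_bal p) _ _.
have fE m n p : tassoc_fun (tpure m n) p = tpure m (tpure n p).
  exact: tliftE (tassoc_bal p) _ _.
split=> //.
- move=> x p p'; elim/tpure_ind: x => [m n|x y IHx IHy].
    by rewrite !fE !tpureDr.
  by rewrite !fD IHx IHy addrACA.
- move=> x k p; elim/tpure_ind: x => [m n|x y IHx IHy].
    by rewrite tractE !fE tpureM.
  by rewrite ractDl !fD IHx IHy.
- move=> l x p; elim/tpure_ind: x => [m n|x y IHx IHy].
    by rewrite tlactE !fE tlactE.
  by rewrite lactDr !fD IHx IHy lactDr.
- move=> x p l; elim/tpure_ind: x => [m n|x y IHx IHy].
    by rewrite !fE !tractE.
  by rewrite !fD IHx IHy ractDl.
Qed.
Definition tassoc : bihom (tens (tens M N) P) (tens M (tens N P)) :=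
  tens_hom tassoc_subproof.
Lemma tassocE m n p : tassoc (tpure (tpure m n) p) = tpure m (tpure n p).
Proof. by rewrite /tassoc tens_homE; apply: tliftE (tassoc_bal p) _ _. Qed.

Lemma tassocV_bal m : balanced (@ract _ _ N) (@lact _ _ P)
  (fun n p => tpure (tpure m n) p : tens (tens M N) P).
Proof.
split=> *; first by rewrite tpureDr tpureDl.
  exact: tpureDr.
by rewrite -tractE tpureM.
Qed.
Definition tassocV_fun (m : M) (x : tens N P) : tens (tens M N) P :=
  tlift (fun n p => tpure (tpure m n) p : tens (tens M N) P) x.
Lemma tassocV_subproof : is_bimul tassocV_fun.
Proof.
have fD m x y : tassocV_fun m (x + y) = tassocV_fun m x + tassocV_fun m y.
  exact: tliftD (tassocV_bal m) _ _.
have fE m n p : tassocV_fun m (tpure n p) = tpure (tpure m n) p.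
  exact: tliftE (tassocV_bal m) _ _.
split=> //.
- move=> m m' x; elim/tpure_ind: x => [n p|x y IHx IHy].
    by rewrite !fE !tpureDl.
  by rewrite !fD IHx IHy addrACA.
- move=> m k x; elim/tpure_ind: x => [n p|x y IHx IHy].
    by rewrite tlactE !fE tpureM.
  by rewrite lactDr !fD IHx IHy.
- move=> l m x; elim/tpure_ind: x => [n p|x y IHx IHy].
    by rewrite !fE !tlactE.
  by rewrite !fD IHx IHy lactDr.
- move=> m x l; elim/tpure_ind: x => [n p|x y IHx IHy].
    by rewrite tractE !fE tractE.
  by rewrite ractDl !fD IHx IHy ractDl.
Qed.
Definition tassocV : bihom (tens M (tens N P)) (tens (tens M N) P) :=
  tens_hom tassocV_subproof.
Lemma tassocVE m n p : tassocV (tpure m (tpure n p)) = tpure (tpure m n) p.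
Proof. by rewrite /tassocV tens_homE; apply: tliftE (tassocV_bal m) _ _. Qed.

End TensorMaps.

Arguments tassoc {L K L' K'} M N P.
Arguments tassocV {L K L' K'} M N P.

Section DirectSum.
Variables (L K : pzRingType) (M : nat -> bimod L K).

Record dsum := Dsum {
  dval :> forall m, M m;
  dfin : exists N, forall m, (N <= m)%N -> dval m = 0 }.

HB.instance Definition _ := gen_eqMixin dsum.
HB.instance Definition _ := gen_choiceMixin dsum.

Lemma dsum_ext (x y : dsum) : (forall m, x m = y m) -> x = y.
Proof.
case: x => x hx; case: y => y hy /= e.
have {}e : x = y by apply: functional_extensionality_dep.
by subst y; congr Dsum; apply: Prop_irrelevance.
Qed.

Lemma dzero_subproof : exists N, forall m, (N <= m)%N -> (0 : M m) = 0.
Proof. by exists 0%N. Qed.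
Definition dzero : dsum := Dsum dzero_subproof.

Lemma dadd_subproof (x y : dsum) :
  exists N, forall m, (N <= m)%N -> x m + y m = 0.
Proof.
have [N hN] := dfin x; have [N' hN'] := dfin y.
by exists (maxn N N') => m; rewrite geq_max => /andP[h h']; rewrite hN ?hN' ?addr0.
Qed.
Definition dadd (x y : dsum) : dsum := Dsum (dadd_subproof x y).

Lemma dopp_subproof (x : dsum) : exists N, forall m, (N <= m)%N -> - x m = 0.
Proof. by have [N hN] := dfin x; exists N => m h; rewrite hN ?oppr0. Qed.
Definition dopp (x : dsum) : dsum := Dsum (dopp_subproof x).

Fact daddA : associative dadd.
Proof. by move=> x y z; apply: dsum_ext => m; apply: addrA. Qed.
Fact daddC : commutative dadd.
Proof. by move=> x y; apply: dsum_ext => m; apply: addrC. Qed.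
Fact dadd0 : left_id dzero dadd.
Proof. by move=> x; apply: dsum_ext => m; apply: add0r. Qed.
Fact daddN : left_inverse dzero dopp dadd.
Proof. by move=> x; apply: dsum_ext => m; apply: addNr. Qed.

HB.instance Definition _ := GRing.isZmodule.Build dsum daddA daddC dadd0 daddN.

Lemma dsum0E m : (0 : dsum) m = 0. Proof. by []. Qed.
Lemma dsumDE (x y : dsum) m : (x + y) m = x m + y m. Proof. by []. Qed.
Lemma dsumNE (x : dsum) m : (- x) m = - x m. Proof. by []. Qed.
Lemma dsum_sumE N (F : nat -> dsum) m :
  (\sum_(i < N) F i) m = \sum_(i < N) F i m.
Proof. by elim: N => [|N IHN]; rewrite ?big_ord0 // !big_ord_recr /= -IHN. Qed.

Lemma dlact_subproof l (x : dsum) :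
  exists N, forall m, (N <= m)%N -> lact l (x m) = 0.
Proof. by have [N hN] := dfin x; exists N => m h; rewrite hN ?lact0. Qed.
Lemma dract_subproof (x : dsum) k :
  exists N, forall m, (N <= m)%N -> ract (x m) k = 0.
Proof. by have [N hN] := dfin x; exists N => m h; rewrite hN ?ract0. Qed.

Definition dlact l (x : dsum) : dsum := Dsum (dlact_subproof l x).
Definition dract (x : dsum) k : dsum := Dsum (dract_subproof x k).

Lemma dsum_subproof : is_bimod dlact dract.
Proof.
split=> *; apply: dsum_ext => m /=.
- exact: lactDr. - exact: lactDl. - exact: lactA. - exact: lact1.
- exact: ractDl. - exact: ractDr. - exact: ractA. - exact: ract1.
- exact: lract.
Qed.
Definition dsum_bimod : bimod L K := Bimod dsum_subproof.

Lemma dproj_subproof m : @is_bihom L K dsum_bimod (M m) (fun x => x m).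
Proof. by []. Qed.
Definition dproj m : bihom dsum_bimod (M m) := Bihom (dproj_subproof m).

Definition dinj_val m (x : M m) j : M j :=
  if m =P j is ReflectT e then ecast i (M i) e x else 0.
Lemma dinj_valE m (x : M m) : dinj_val x m = x.
Proof.
by rewrite /dinj_val; case: eqP => // e; rewrite (eq_irrelevance e (erefl m)).
Qed.
Lemma dinj_valN m (x : M m) j : m <> j -> dinj_val x j = 0.
Proof. by rewrite /dinj_val; case: eqP. Qed.
Lemma dinj_fin m (x : M m) : exists N, forall j, (N <= j)%N -> dinj_val x j = 0.
Proof.
by exists m.+1 => j h; apply: dinj_valN => e; rewrite e ltnn in h.
Qed.
Definition dinj_fun m (x : M m) : dsum := Dsum (dinj_fin x).
Lemma dinj_subproof m : @is_bihom L K (M m) dsum_bimod (@dinj_fun m).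
Proof.
split=> [x y|l x|x k]; apply: dsum_ext => j /=; rewrite /dinj_val;
  by case: eqP => [e|_]; [case: j / e | rewrite ?addr0 ?lact0 ?ract0].
Qed.
Definition dinj m : bihom (M m) dsum_bimod := Bihom (dinj_subproof m).

Lemma dinjE m (x : M m) : (dinj m x : dsum) m = x.
Proof. exact: dinj_valE. Qed.
Lemma dinjN m (x : M m) j : m <> j -> (dinj m x : dsum) j = 0.
Proof. exact: dinj_valN. Qed.

Lemma dsum_decomp (x : dsum) N : (forall m, (N <= m)%N -> x m = 0) ->
  x = \sum_(m < N) dinj m (x m) :> dsum.
Proof.
move=> hN; apply: dsum_ext => j; rewrite (dsum_sumE N (fun m => dinj m (x m))).
have [h|h] := ltnP j N.
  rewrite (bigD1 (Ordinal h)) //= dinj_valE big1 ?addr0 // => i /eqP ne.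
  by apply: dinj_valN => e; apply: ne; apply: val_inj.
rewrite hN // big1 // => i _; apply: dinj_valN => e.
by have := ltn_ord i; rewrite e ltnNge h.
Qed.

Lemma dsum_ind (P : dsum -> Prop) :
  (forall m (x : M m), P (dinj m x)) -> (forall x y, P x -> P y -> P (x + y)) ->
  forall x, P x.
Proof.
move=> Pi PD x; have [N hN] := dfin x; rewrite (dsum_decomp hN).
by apply: big_ind => //; rewrite -(bh0 (dinj 0)).
Qed.

Definition dbound (x : dsum) : nat := sval (cid (dfin x)).

Section Lift.
Variables (Z : zmodType) (f : forall m, M m -> Z).
Arguments f {m}.

Definition dlift (x : dsum) : Z := \sum_(m < dbound x) f (x m).

Hypothesis fD : forall m (x y : M m), f (x + y) = f x + f y.
Let f0 m : f (0 : M m) = 0.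
Proof. by apply: (addrI (f (0 : M m))); rewrite -fD !addr0. Qed.

Lemma dliftE (x : dsum) N : (forall m, (N <= m)%N -> x m = 0) ->
  dlift x = \sum_(m < N) f (x m).
Proof.
rewrite /dlift /dbound; case: cid => B /= hB hN.
have ext A C : (forall m, (A <= m)%N -> x m = 0) -> (A <= C)%N ->
    \sum_(m < A) f (x m) = \sum_(m < C) f (x m).
  move=> hA le; rewrite (big_ord_widen C (fun m => f (x m)) le) big_mkcond /=.
  apply: eq_bigr => i _; case: ltnP => // h.
  by rewrite hA ?f0.
by have [le|/ltnW le] := leqP B N; [apply: ext | rewrite -(ext N B)].
Qed.

Lemma dliftD x y : dlift (x + y) = dlift x + dlift y.
Proof.
have [N hN] := dfin x; have [N' hN'] := dfin y.
have h1 m : (maxn N N' <= m)%N -> x m = 0 by rewrite geq_max => /andP[/hN].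
have h2 m : (maxn N N' <= m)%N -> y m = 0 by rewrite geq_max => /andP[_ /hN'].
rewrite (dliftE h1) (dliftE h2) (@dliftE (x + y) (maxn N N')); last first.
  by move=> m h; rewrite dsumDE h1 // h2 // addr0.
by rewrite -big_split; apply: eq_bigr => i _; rewrite dsumDE fD.
Qed.

Lemma dlift_inj m (x : M m) : dlift (dinj m x) = f x.
Proof.
rewrite (@dliftE _ m.+1); last first.
  by move=> j h; apply: dinj_valN => e; rewrite e ltnn in h.
rewrite big_ord_recr /= dinj_valE big1 ?add0r // => i _.
by rewrite dinj_valN ?f0 // => e; have := ltn_ord i; rewrite -e ltnn.
Qed.

End Lift.
End DirectSum.

Section TensorRing.
Variables (K : pzRingType) (V : bimod K K).

Fixpoint tpow m : bimod K K :=
  if m is m'.+1 then tens (tpow m') V else reg K.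

Definition tring := dsum tpow.
HB.instance Definition _ := GRing.Zmodule.on tring.

Definition tring_bimod : bimod K K := dsum_bimod tpow.

Lemma dshift_subproof (y : tring) (v : V) : exists N, forall m, (N <= m)%N ->
  (if m is m'.+1 return tpow m then tpure (y m') v else 0) = 0.
Proof.
have [N hN] := dfin y; exists N.+1 => -[|m] // h.
by rewrite hN // tpure0l.
Qed.
Definition dshift (y : tring) (v : V) : tring := Dsum (dshift_subproof y v).

(* Right multiplication by a homogeneous element, by recursion on its degree:
   y * k = y k and y * (x (x) v) = (y * x) (x) v. *)
Fixpoint rmulp (y : tring) m : tpow m -> tring :=
  match m return tpow m -> tring with
  | 0 => fun k => dract y k
  | m'.+1 => tlift (fun x v => dshift (rmulp y x) v)
  end.

Definition tmul (x y : tring) : tring := dlift (rmulp x) y.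
Definition tone : tring := dinj tpow 0 (1 : K).

Lemma dshiftDl x y v : dshift (x + y) v = dshift x v + dshift y v.
Proof.
by apply: dsum_ext => -[|m]; rewrite dsumDE /= ?addr0 // tpureDl.
Qed.
Lemma dshiftDr x v w : dshift x (v + w) = dshift x v + dshift x w.
Proof.
by apply: dsum_ext => -[|m]; rewrite dsumDE /= ?addr0 // tpureDr.
Qed.
Lemma dshiftM x k v : dshift (dract x k) v = dshift x (lact k v).
Proof. by apply: dsum_ext => -[|m] //=; rewrite -[LHS]/(tpure (ract _ _) _) tpureM. Qed.
Lemma dshift_r x v k : dshift x (ract v k) = dract (dshift x v) k.
Proof.
apply: dsum_ext => -[|m] /=; first by rewrite mul0r.
by rewrite -tractE.
Qed.
Lemma dshift_l x v k : dshift (dlact k x) v = dlact k (dshift x v).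
Proof.
apply: dsum_ext => -[|m] /=; first by rewrite mulr0.
by rewrite -tlactE.
Qed.
Lemma dshift_inj m (x : tpow m) v : dshift (dinj tpow m x) v = dinj tpow m.+1 (tpure x v).
Proof.
apply: dsum_ext => -[|j] /=; first by rewrite dinj_valN.
have [<-|ne] := eqVneq m j; first by rewrite !dinj_valE.
by rewrite !dinj_valN ?tpure0l // => [[e]|e]; rewrite e eqxx in ne.
Qed.

Lemma dractD (x y : tring) k : dract (x + y) k = dract x k + dract y k.
Proof. exact: (@ractDl _ _ tring_bimod). Qed.
Lemma dractDr (x : tring) k k' : dract x (k + k') = dract x k + dract x k'.
Proof. exact: (@ractDr _ _ tring_bimod). Qed.
Lemma dractA (x : tring) k k' : dract x (k * k') = dract (dract x k) k'.
Proof. exact: (@ractA _ _ tring_bimod). Qed.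

Lemma rmulpP m : forall y : tring,
  (forall x x' : tpow m, rmulp y (x + x') = rmulp y x + rmulp y x') /\
  (forall (x : tpow m) k, rmulp y (ract x k) = dract (rmulp y x) k).
Proof.
elim: m => [|m IHm] y; first by split=> [x x'|x k]; rewrite /= ?dractDr ?dractA.
have [hD hr] := IHm y.
have hb : balanced (@ract _ _ (tpow m)) (@lact _ _ V) (fun x v => dshift (rmulp y x) v).
  by split=> *; rewrite ?hD ?hr ?dshiftDl ?dshiftDr ?dshiftM.
split; first exact: (tliftD hb).
have gD := tliftD hb; have gE : forall x v, _ = _ := tliftE hb.
move=> x k; elim/tpure_ind: x => [x v|x x' IHx IHx'].
  by rewrite tractE /= !gE dshift_r.
by rewrite ractDl /= !gD -!/(rmulp _ _) dractD; congr (_ + _).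
Qed.
Lemma rmulpD m y (x x' : tpow m) : rmulp y (x + x') = rmulp y x + rmulp y x'.
Proof. exact: (rmulpP m y).1. Qed.
Lemma rmulp_r m y (x : tpow m) k : rmulp y (ract x k) = dract (rmulp y x) k.
Proof. exact: (rmulpP m y).2. Qed.
Lemma rmulpS m y (x : tpow m) v : @rmulp y m.+1 (tpure x v) = dshift (rmulp y x) v.
Proof.
apply: (@tliftE _ _ _ _ _ _ (fun x v => dshift (rmulp y x) v)).
split=> [x' x'' v'|x' v' v''|x' k v'].
- by rewrite rmulpD dshiftDl.
- by rewrite dshiftDr.
- by rewrite rmulp_r dshiftM.
Qed.
Lemma rmulpDl m y y' (x : tpow m) : rmulp (y + y') x = rmulp y x + rmulp y' x.
Proof.
elim: m x => [|m IHm] x; first exact: dractD.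
elim/tpure_ind: x => [x v|x x' IHx IHx']; first by rewrite !rmulpS IHm dshiftDl.
by rewrite !rmulpD IHx IHx' addrACA.
Qed.

Lemma tmulDr x y z : tmul x (y + z) = tmul x y + tmul x z.
Proof. by apply: dliftD => *; apply: rmulpD. Qed.
Lemma tmulE x m (y : tpow m) : tmul x (dinj tpow m y) = rmulp x y.
Proof. by apply: dlift_inj => *; apply: rmulpD. Qed.
Lemma tmulDl x y z : tmul (x + y) z = tmul x z + tmul y z.
Proof.
elim/dsum_ind: z => [m z|z z' IHz IHz']; first by rewrite !tmulE rmulpDl.
by rewrite !tmulDr IHz IHz' addrACA.
Qed.
Lemma tmul_dract x y k : tmul x (dract y k) = dract (tmul x y) k.
Proof.
elim/dsum_ind: y => [m y|y y' IHy IHy'].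
  by rewrite -[dract _ _]/(ract (dinj tpow m y) k) -bhr !tmulE rmulp_r.
by rewrite dractD !tmulDr IHy IHy' dractD.
Qed.
Lemma tmul_dshift x y v : tmul x (dshift y v) = dshift (tmul x y) v.
Proof.
elim/dsum_ind: y => [m y|y y' IHy IHy'].
  by rewrite dshift_inj !tmulE rmulpS.
by rewrite dshiftDl !tmulDr IHy IHy' dshiftDl.
Qed.
Lemma tmulA : associative tmul.
Proof.
move=> x y z; elim/dsum_ind: z => [m z|z z' IHz IHz']; last first.
  by rewrite !tmulDr IHz IHz'.
rewrite !tmulE; elim: m z => [|m IHm] z; first exact: tmul_dract.
elim/tpure_ind: z => [z v|z z' IHz IHz'].
  by rewrite !rmulpS tmul_dshift IHm.
by rewrite !rmulpD tmulDr IHz IHz'.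
Qed.
Lemma tmul1 : right_id tone tmul.
Proof. by move=> x; rewrite tmulE; apply: (@ract1 _ _ tring_bimod). Qed.
Lemma tmul1l : left_id tone tmul.
Proof.
elim/dsum_ind => [m x|x y IHx IHy]; last by rewrite tmulDr IHx IHy.
rewrite tmulE; elim: m x => [|m IHm] x.
  rewrite -[LHS]/(ract (dinj tpow 0 (1 : K)) x) -bhr.
  by congr (dinj tpow 0 _); apply: mul1r.
elim/tpure_ind: x => [x v|x y IHx IHy].
  by rewrite rmulpS IHm dshift_inj.
by rewrite rmulpD IHx IHy; apply: esym; apply: (bhD (dinj tpow m.+1)).
Qed.

HB.instance Definition _ := GRing.Zmodule_isPzRing.Build tring
  tmulA tmul1l tmul1 tmulDl tmulDr.

Definition tgr m : set tring := [set x | exists y : tpow m, x = dinj tpow m y].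

(* tlt m is the sum of the components of degree < m, so that the m-th term of
   the degree filtration is tlt m.+1 and the one before it is tlt m. *)
Definition tlt_set m : set tring := [set x | forall q, (m <= q)%N -> x q = 0].
Lemma tlt_set0 m : tlt_set m 0. Proof. by []. Qed.
Lemma tlt_setB m x y : tlt_set m x -> tlt_set m y -> tlt_set m (x - y).
Proof. by move=> hx hy q hq; rewrite dsumDE dsumNE hx // hy // subr0. Qed.
Lemma tlt_set_l m k (x : tring_bimod) : tlt_set m x -> tlt_set m (lact k x).
Proof. by move=> hx q hq /=; rewrite hx // lact0. Qed.
Lemma tlt_set_r m (x : tring_bimod) k : tlt_set m x -> tlt_set m (ract x k).
Proof. by move=> hx q hq /=; rewrite hx // ract0. Qed.
Definition tlt m : subbimod tring_bimod :=
  @Subbimod _ _ tring_bimod (Subgrp (@tlt_set0 m) (@tlt_setB m))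
    (@tlt_set_l m) (@tlt_set_r m).

Lemma dlact_mul k (x : tring) : dlact k x = tmul (dinj tpow 0 k) x.
Proof.
elim/dsum_ind: x => [m x|x y IHx IHy]; last first.
  rewrite tmulDr -IHx -IHy; exact: (@lactDr _ _ tring_bimod).
rewrite tmulE -[LHS]/(lact k (dinj tpow m x)); elim: m x => [|m IHm] x.
  by rewrite -bhl; apply: (@bhr _ _ _ _ (dinj tpow 0) k x).
elim/tpure_ind: x => [x v|x y IHx IHy].
  by rewrite rmulpS -IHm -dshift_inj; apply: esym; apply: dshift_l.
by rewrite rmulpD -IHx -IHy (bhD (dinj tpow m.+1)); apply: (@lactDr _ _ tring_bimod).
Qed.
Lemma dract_mul k (x : tring) : dract x k = tmul x (dinj tpow 0 k).
Proof. by rewrite tmulE. Qed.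

Lemma tmult_subproof :
  @is_bimul K K K tring_bimod tring_bimod tring_bimod (fun x y => tmul x y).
Proof.
split=> [x y z|x y z|x k y|k x y|x y k].
- exact: tmulDl.
- exact: tmulDr.
- by rewrite /= dract_mul dlact_mul tmulA.
- by rewrite /= !dlact_mul tmulA.
- by rewrite /= !dract_mul tmulA.
Qed.
Definition tmult : bihom (tens tring_bimod tring_bimod) tring_bimod :=
  tens_hom tmult_subproof.

(* The identification of V with T^1 = K (x) V. *)
Lemma tgen_subproof : @is_bihom K K V (tpow 1) (fun v => @tpure _ _ _ (reg K) V 1 v).
Proof.
split=> [v w|k v|v k]; first exact: tpureDr.
  rewrite [RHS]tlactE; rewrite -[lact k (1 : reg K)]/(k * 1 : reg K) mulr1.
  by rewrite -(@tpureM _ _ _ (reg K)); congr tpure; apply: mul1r.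
by rewrite [RHS]tractE.
Qed.
Definition tgen : bihom V tring_bimod := dinj tpow 1 ∘ Bihom tgen_subproof.

Lemma taug_subproof (x y : tring) : (x * y) 0%N = (x 0%N : K) * (y 0%N : K) :> K.
Proof.
elim/dsum_ind: y => [m y|y z IHy IHz]; last first.
  by rewrite mulrDr !dsumDE IHy IHz -mulrDr.
rewrite -[x * _]/(tmul _ _) tmulE; case: m y => [|m] y; first by rewrite dinjE.
rewrite dinjN // mulr0; elim/tpure_ind: y => [y v|y z IHy IHz].
  by rewrite rmulpS.
by rewrite rmulpD dsumDE IHy IHz addr0.
Qed.

End TensorRing.

Arguments tgr {K} V m.

Section QuotientRing.
Variables (A : pzRingType) (X : set A).

Inductive ideal_set : set A :=
| ideal_gen x : X x -> ideal_set x
| ideal_zero : ideal_set 0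
| ideal_sub x y : ideal_set x -> ideal_set y -> ideal_set (x - y)
| ideal_l a x : ideal_set x -> ideal_set (a * x)
| ideal_r x a : ideal_set x -> ideal_set (x * a).

Definition ideal : subgrp A := Subgrp ideal_zero ideal_sub.

Definition qring : Type := qgrp ideal.
HB.instance Definition _ := GRing.Zmodule.on qring.

Definition qclass (x : A) : qring := qpi ideal x.

Definition qone : qring := qclass 1.
Definition qmul (a b : qring) : qring :=
  qlift (fun x => qlift (fun y => qclass (x * y)) b) a.

Lemma qmulE x y : qmul (qclass x) (qclass y) = qclass (x * y).
Proof.
have E u v : qlift (fun w => qclass (u * w)) (qclass v) = qclass (u * v).
  by apply: qliftE => w w' h; apply/qpi_eq; rewrite -mulrBr; apply: ideal_l.
rewrite /qmul; transitivity (qlift (fun w => qclass (w * y)) (qclass x)).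
  by congr qlift; apply/funext => w; apply: E.
by apply: qliftE => w w' h; apply/qpi_eq; rewrite -mulrBl; apply: ideal_r.
Qed.

Lemma qclass_surj (a : qring) : exists x, a = qclass x.
Proof. exact: qpi_surj. Qed.
Lemma qclassD x y : qclass (x + y) = qclass x + qclass y.
Proof. exact: qpiD. Qed.
Lemma qclassB x y : qclass (x - y) = qclass x - qclass y.
Proof. exact: qpiB. Qed.

Fact qmulA : associative qmul.
Proof.
move=> a b c; have [x ->] := qclass_surj a; have [y ->] := qclass_surj b.
by have [z ->] := qclass_surj c; rewrite !qmulE mulrA.
Qed.
Fact qmul1l : left_id qone qmul.
Proof. by move=> a; have [x ->] := qclass_surj a; rewrite qmulE mul1r. Qed.
Fact qmul1r : right_id qone qmul.
Proof. by move=> a; have [x ->] := qclass_surj a; rewrite qmulE mulr1. Qed.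
Fact qmulDl : left_distributive qmul +%R.
Proof.
move=> a b c; have [x ->] := qclass_surj a; have [y ->] := qclass_surj b.
by have [z ->] := qclass_surj c; rewrite -qclassD !qmulE mulrDl qclassD.
Qed.
Fact qmulDr : right_distributive qmul +%R.
Proof.
move=> a b c; have [x ->] := qclass_surj a; have [y ->] := qclass_surj b.
by have [z ->] := qclass_surj c; rewrite -qclassD !qmulE mulrDr qclassD.
Qed.

HB.instance Definition _ := GRing.Zmodule_isPzRing.Build qring
  qmulA qmul1l qmul1r qmulDl qmulDr.

End QuotientRing.

Section Image.
Variables (G G' : zmodType) (f : G -> G').
Hypothesis fB : forall x y, f (x - y) = f x - f y.
Variable H : subgrp G.

Lemma img0 : (f @` H) 0.
Proof. by exists 0; [exact: smem0 | rewrite -[X in f X](subrr 0) fB subrr]. Qed.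
Lemma imgB y z : (f @` H) y -> (f @` H) z -> (f @` H) (y - z).
Proof.
by move=> [x hx <-] [x' hx' <-]; exists (x - x'); [exact: smemB | exact: fB].
Qed.
Definition img_subgrp : subgrp G' := Subgrp img0 imgB.
End Image.

Definition full_subgrp (G : zmodType) : subgrp G :=
  @Subgrp G setT I (fun _ _ _ _ => I).

Section PBW.
Variables (K : pzRingType) (V : bimod K K).
Local Notation T := (tring V).

Section Quotient.
Variable P : set T.

Definition qgr m : set (qring P) := qclass P @` tgr V m.

(* Image in T/<P> of the sum of the components of degree < m. *)
Definition qlt m : subgrp (qring P) := img_subgrp (@qclassB _ P) (tlt V m).

(* The degree m component of gr (T/<P>), inside (T/<P>)/(T/<P>)^{<= m-1}. *)
Definition grquot m : set (qgrp (qlt m)) := qpi (qlt m) @` qlt m.+1.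

End Quotient.

Arguments qgr P m : clear implicits.
Arguments grquot P m : clear implicits.

(* A graded map is an isomorphism when its components are bijective; the
   compatibility of phi with products, which are induced by those of T on both
   sides, is automatic. *)
Definition is_PBW_deformation (R P : set T) : Prop :=
  forall m, exists phi : qring R -> qgrp (qlt P m),
    (forall x, tgr V m x -> phi (qclass R x) = qpi (qlt P m) (qclass P x)) /\
    set_bij (qgr R m) (grquot P m) phi.

End PBW.

Arguments qgr {K V} P m.

Definition projective (A : pzRingType) (P : rmod A) : Prop :=
  forall (M N : rmod A) (g : bihom M N) (f : bihom P N),
    (forall y, exists x, g x = y) ->
    exists h : bihom P M, forall x, g (h x) = f x.

Definition flat (A : pzRingType) (N : lmod A) : Prop :=
  forall (M M' : rmod A) (f : bihom M M'),
    injective f -> injective (tmap f (bid N)).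

(* Gradings are internal: a module is the direct sum of subgroups indexed by
   the degree.  Tor is computed from a graded projective resolution, given as
   an argument; its choice only affects Tor up to a graded isomorphism. *)

Record is_grading (M : zmodType) (Mgr : nat -> set M) : Prop := IsGrading {
  gr_0 : forall i, Mgr i 0;
  gr_B : forall i x y, Mgr i x -> Mgr i y -> Mgr i (x - y);
  gr_span : forall x, exists N (c : nat -> M),
    (forall i, Mgr i (c i)) /\ x = \sum_(i < N) c i;
  gr_indep : forall N (c : nat -> M), (forall i, Mgr i (c i)) ->
    \sum_(i < N) c i = 0 -> forall i, (i < N)%N -> c i = 0 }.

Section Tor.
Variables (A : pzRingType) (Agr : nat -> set A).

Definition is_graded_rmod (M : rmod A) (Mgr : nat -> set M) : Prop :=
  is_grading Mgr /\
  forall i j x a, Mgr i x -> Agr j a -> Mgr (i + j)%N (ract x a).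

Record gr_proj_resolution (N : rmod A) (Ngr : nat -> set N) := GrProjResolution {
  rs_mod :> nat -> rmod A;
  rs_gr : forall i, nat -> set (rs_mod i);
  rs_d : forall i, bihom (rs_mod i.+1) (rs_mod i);
  rs_aug : bihom (rs_mod 0) N;
  rs_projective : forall i, projective (rs_mod i);
  rs_graded : forall i, is_graded_rmod (@rs_gr i);
  rs_d_gr : forall i m x, rs_gr m x -> rs_gr m (rs_d i x);
  rs_aug_gr : forall m x, rs_gr m x -> Ngr m (rs_aug x);
  rs_aug_surj : forall y, exists x, rs_aug x = y;
  rs_exact0 : forall x, rs_aug x = 0 <-> exists y, rs_d 0 y = x;
  rs_exact : forall i x, rs_d i x = 0 <-> exists y, rs_d i.+1 y = x }.

Section Homology.
Variables (N : rmod A) (Ngr : nat -> set N) (Q : gr_proj_resolution Ngr).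
(* A left A-module concentrated in degree 0. *)
Variable (N' : lmod A).

Definition chain i := tens (Q i) N'.
Definition chain_d i : bihom (chain i.+1) (chain i) := tmap (rs_d Q i) (bid N').
Definition chain_gr i m : set (chain i) :=
  span [set z | exists x y, rs_gr m x /\ z = tpure x y].

Definition cycle i : set (chain i) :=
  if i is i'.+1 return set (chain i) then [set z | chain_d i' z = 0] else setT.
Arguments chain_gr i m : clear implicits.
Arguments cycle i : clear implicits.

Definition boundary i : subgrp (chain i) :=
  img_subgrp (bhB (chain_d i)) (full_subgrp _).

(* Tor_i(N, N') and its component of internal degree m, as subgroups of the
   quotient of the i-chains by the i-boundaries. *)
Definition Tor i : set (qgrp (boundary i)) := qpi (boundary i) @` cycle i.
Definition Tor_gr i m : set (qgrp (boundary i)) :=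
  qpi (boundary i) @` (cycle i `&` chain_gr i m).

End Homology.
End Tor.

Arguments Tor {A Agr N Ngr} Q N' i.
Arguments Tor_gr {A Agr N Ngr} Q N' i m.

Section TrivialModule.
Variables (K : pzRingType) (V : bimod K K) (X : set (tring V)).
Hypothesis X0 : forall x, X x -> x 0%N = 0.

Lemma ideal_X0 x : ideal X x -> x 0%N = 0.
Proof.
elim=> {x} [x /X0 //|//|x y _ hx _ hy|a x _ hx|x a _ hx].
- by rewrite dsumDE dsumNE hx hy subr0.
- by rewrite taug_subproof hx mulr0.
- by rewrite taug_subproof hx mul0r.
Qed.

(* The vacuous let makes X0 an argument, so that the morphism instances below
   apply to qaug X0. *)
Definition qaug (a : qring X) : K :=
  let _ := X0 in qlift (fun x : tring V => x 0%N : K) a.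

Lemma qaugE x : qaug (qclass X x) = x 0%N.
Proof.
apply: qliftE => u v /ideal_X0; rewrite dsumDE dsumNE => /eqP.
by rewrite subr_eq0 => /eqP.
Qed.

Fact qaug_zmod : zmod_morphism qaug.
Proof.
move=> a b; have [x ->] := qclass_surj a; have [y ->] := qclass_surj b.
by rewrite -qclassB !qaugE.
Qed.
Fact qaug_monoid : monoid_morphism qaug.
Proof.
split=> [|a b]; first by rewrite -[1]/(qclass X 1) qaugE; apply: (@dinj_valE _ _ (tpow V) 0).
have [x ->] := qclass_surj a; have [y ->] := qclass_surj b.
by rewrite -[_ * _]/(qmul _ _) qmulE !qaugE taug_subproof.
Qed.
HB.instance Definition _ := GRing.isZmodMorphism.Build _ _ qaug qaug_zmod.
HB.instance Definition _ := GRing.isMonoidMorphism.Build _ _ qaug qaug_monoid.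

Definition triv_bimod : bimod (qring X) (qring X) :=
  lres qaug (rres qaug (reg K)).

End TrivialModule.

Definition deg0_gr (M : zmodType) (m : nat) : set M :=
  if m is 0 then setT else [set 0].
Arguments deg0_gr M m : clear implicits.

Section Twisting.
Variables (K S : pzRingType) (eta : {rmorphism K -> S}).

(* The K-ring S, with unit map eta, as a bimodule; the two versions have the same
   carrier, and so have V (x) SKS and V (x) SKK. *)
Definition SKS : bimod K S := lres eta (reg S).
Definition SKK : bimod K K := lres eta (rres eta (reg S)).

Lemma mS_subproof : @is_bimul K K K SKK SKK SKK (fun s s' : S => s * s').
Proof. by split=> *; rewrite /= ?(mulrDl, mulrDr, mulrA). Qed.
Definition mS : bihom (tens SKK SKK) SKK := tens_hom mS_subproof.

Variable V : bimod K K.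

(* (x) is associative only up to tassoc and its inverse tassocV. *)
Record twisting := Twisting {
  tw :> bihom (tens SKK V) (tens V SKK);
  tw_mul : forall z : tens (tens SKK SKK) V,
    tw (tmap mS (bid V) z) =
    tmap (bid V) mS (tassoc V SKK SKK (tmap tw (bid SKK)
      (tassocV SKK V SKK (tmap (bid SKK) tw (tassoc SKK SKK V z)))));
  tw_one : forall v, tw (@tpure _ _ _ SKK V 1 v) = @tpure _ _ _ V SKK v 1 }.

Variable t : twisting.

(* The canonical isomorphism S (x) K -> K (x) S, s (x) k |-> 1 (x) s k. *)
Lemma tw0_subproof : @is_bimul K K K SKK (reg K) (tens (reg K) SKK)
  (fun s k => @tpure _ _ _ (reg K) SKK 1 (ract s k)).
Proof.
split=> [s s' k|s k k'|s k k'|l s k|s k l].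
- by rewrite ractDl tpureDr.
- by rewrite [ract s _](@ractDr _ _ SKK) tpureDr.
- by rewrite -[ract (ract s k) k'](@ractA _ _ SKK).
- rewrite tlactE lract -tpureM; congr tpure.
  by rewrite /= mulr1 mul1r.
- by rewrite tractE -[ract (ract s k) l](@ractA _ _ SKK).
Qed.

Fixpoint tw_pow m : bihom (tens SKK (tpow V m)) (tens (tpow V m) SKK) :=
  match m return bihom (tens SKK (tpow V m)) (tens (tpow V m) SKK) with
  | 0 => tens_hom tw0_subproof
  | m'.+1 =>
      tassocV (tpow V m') V SKK ∘ tmap (bid (tpow V m')) t ∘
      tassoc (tpow V m') SKK V ∘ tmap (tw_pow m') (bid V) ∘
      tassocV SKK (tpow V m') V
  end.

(* Both sides are images in T^n (x) S; since S is only assumed flat on the left,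
   S (x) R need not inject into S (x) T^n. *)
Definition tw_invariant n (R : subbimod (tpow V n)) : Prop :=
  [set tw_pow n (tmap (bid SKK) (sub_incl R) y) | y in [set: tens SKK (sub_bimod R)]]
  = [set tmap (sub_incl R) (bid SKK) y | y in [set: tens (sub_bimod R) SKK]].

Local Notation VS := (tens V SKS).

Definition twlact (s : S) : VS -> VS :=
  tlift (fun v s' => ract (t (@tpure _ _ _ SKK V s v) : VS) s').

Lemma twlact_bal s : balanced (@ract _ _ V) (@lact _ _ SKS)
  (fun v s' => ract (t (@tpure _ _ _ SKK V s v) : VS) s').
Proof.
split=> [v v' s'|v s' s''|v k s'].
- by rewrite tpureDr bhD -ractDl.
- exact: ractDr.
- rewrite -[@tpure _ _ _ SKK V s (ract v k)]tractE bhr.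
  by rewrite -[ract (t _) k]/(ract (t (@tpure _ _ _ SKK V s v) : VS) (eta k)) -ractA.
Qed.

Lemma twlactE s v s' :
  twlact s (tpure v s') = ract (t (@tpure _ _ _ SKK V s v) : VS) s'.
Proof. exact: tliftE (twlact_bal s) _ _. Qed.
Lemma twlactD s x y : twlact s (x + y) = twlact s x + twlact s y.
Proof. exact: tliftD (twlact_bal s) _ _. Qed.
Lemma twlact_r s x s' : ract (twlact s x) s' = twlact s (ract x s').
Proof.
elim/tpure_ind: x => [v s''|x y IHx IHy].
  by rewrite tractE !twlactE -ractA.
by rewrite ractDl !twlactD ractDl IHx IHy.
Qed.

Lemma twlact_tw s (x : VS) :
  tmap (bid V) mS (tassoc V SKK SKK (tmap t (bid SKK)
      (tassocV SKK V SKK (@tpure _ _ _ SKK (tens V SKK) s x)))) = twlact s x.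
Proof.
elim/tpure_ind: x => [v s'|x y IHx IHy]; last first.
  by rewrite twlactD -IHx -IHy tpureDr !bhD.
rewrite twlactE tassocVE tmapE.
elim/tpure_ind: (t _) => [v' s''|x y IHx IHy].
  by rewrite tassocE tmapE [mS _]tens_homE [RHS]tractE.
by rewrite tpureDl !bhD IHx IHy [RHS]ractDl.
Qed.

Lemma twV_subproof : @is_bimod S S VS twlact (@ract _ _ VS).
Proof.
split.
- exact: twlactD.
- move=> s s' x; elim/tpure_ind: x => [v s''|x y IHx IHy].
    by rewrite !twlactE tpureDl bhD -ractDl.
  by rewrite !twlactD IHx IHy addrACA.
- move=> s s' x; elim/tpure_ind: x => [v s''|x y IHx IHy]; last first.
    by rewrite !twlactD IHx IHy.
  rewrite !twlactE -twlact_r -twlact_tw; congr ract.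
  have := tw_mul t (@tpure _ _ _ (tens SKK SKK) V (@tpure _ _ _ SKK SKK s s') v).
  by rewrite tmapE [mS _]tens_homE tassocE tmapE => ->.
- elim/tpure_ind => [v s|x y IHx IHy].
    rewrite twlactE tw_one [LHS]tractE; congr tpure; exact: mul1r.
  by rewrite twlactD IHx IHy.
- exact: ractDl.
- exact: ractDr.
- exact: ractA.
- exact: ract1.
- by move=> s x s'; apply: twlact_r.
Qed.
Definition twV : bimod S S := Bimod twV_subproof.

(* psi sends (v_1 ... v_m) (x) s to
   ((v_1 (x) 1) (x)_S ... (x)_S (v_m (x) 1)) s, whose last factor is v_m (x) s. *)
Local Notation resKK M := (lres eta (rres eta M)).

Lemma psi0_subproof : @is_bihom K K (reg K) SKK eta.
Proof. by split=> *; rewrite /= ?(rmorphD, rmorphM). Qed.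

Lemma psiS_subproof m (f : bihom (tpow V m) (resKK (tpow twV m))) :
  @is_bimul K K K (tpow V m) V (resKK (tpow twV m.+1))
    (fun x v => @tpure _ _ _ (tpow twV m) twV (f x) (@tpure _ _ _ V SKS v 1)).
Proof.
split=> [x x' v|x v v'|x k v|k x v|x v k].
- by rewrite bhD; apply: tpureDl.
- by rewrite tpureDl; apply: tpureDr.
- rewrite bhr -[LHS]/(tpure (ract (f x : tpow twV m) (eta k)) _) tpureM.
  congr tpure; rewrite -[LHS]/(twlact _ _) twlactE [RHS]/=.
  have -> : @tpure _ _ _ SKK V (eta k) v = @tpure _ _ _ SKK V 1 (lact k v).
    by rewrite -tpureM; congr tpure; rewrite /= mul1r.
  by rewrite tw_one ract1.
- by rewrite bhl; apply: esym; apply: tlactE.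
- rewrite [RHS]/= -[RHS]/(ract (@tpure _ _ _ (tpow twV m) twV _ _) (eta k)).
  rewrite tractE; congr tpure; rewrite tpureM -[RHS]/(ract (@tpure _ _ _ V SKS v 1) (eta k)).
  by rewrite tractE; congr tpure; rewrite /= mulr1 mul1r.
Qed.

Fixpoint psi_pow m : bihom (tpow V m) (resKK (tpow twV m)) :=
  match m return bihom (tpow V m) (resKK (tpow twV m)) with
  | 0 => Bihom psi0_subproof
  | m'.+1 => tens_hom (psiS_subproof (psi_pow m'))
  end.

Lemma psi_fin (x : tring V) :
  exists N, forall m, (N <= m)%N -> (psi_pow m (x m) : tpow twV m) = 0.
Proof. by have [N hN] := dfin x; exists N => m h; rewrite hN // bh0. Qed.
Definition psi_tring (x : tring V) : tring twV := Dsum (psi_fin x).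

Lemma psi_subproof :
  @is_bimul K K S (tring_bimod V) SKS (lres eta (tring_bimod twV))
    (fun x s => ract (psi_tring x : tring_bimod twV) s).
Proof.
split=> [x y s|x s s'|x k s|k x s|x s s'].
- rewrite -[RHS]ractDl; congr ract; apply: dsum_ext => m.
  exact: (bhD (psi_pow m)).
- exact: ractDr.
- rewrite -[RHS]/(ract _ (eta k * s)) ractA; congr ract; apply: dsum_ext => m.
  exact: (bhr (psi_pow m)).
- rewrite -[RHS]/(lact (eta k) _) -lract; congr ract; apply: dsum_ext => m.
  exact: (bhl (psi_pow m)).
- exact: ractA.
Qed.
Definition psi : bihom (tens (tring_bimod V) SKS) (lres eta (tring_bimod twV)) :=
  tens_hom psi_subproof.

End Twisting.

Inductive rspan (L S : pzRingType) (M : bimod L S) (X : set M) : set M :=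
| rspan_gen x : X x -> rspan X x
| rspan_zero : rspan X 0
| rspan_sub x y : rspan X x -> rspan X y -> rspan X (x - y)
| rspan_r x s : rspan X x -> rspan X (ract x s).

Section Conditions.
Variables (K S : pzRingType) (eta : {rmorphism K -> S}) (V : bimod K K).
Variables (t : twisting eta V) (n : nat) (R : subbimod (tpow V n)).

Local Notation T := (tring_bimod V).
Local Notation Sk := (SKK eta).
Local Notation RM := (sub_bimod R).
Local Notation TS := (tens T Sk).

Definition rel_incl : bihom RM T := dinj (tpow V) n ∘ sub_incl R.
Definition rel_set : set (tring V) := range rel_incl.

Lemma rel_set0 : (1 < n)%N -> forall x, rel_set x -> x 0%N = 0.
Proof. by move=> n2 x [r _ <-]; apply: dinjN => e; rewrite e in n2. Qed.

(* A = T/<R>, its grading, and the ground ring as an A-bimodule. *)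
Definition alg : pzRingType := qring rel_set.
Definition alg_gr : nat -> set alg := qgr rel_set.
Definition ground (n2 : (1 < n)%N) : bimod alg alg := triv_bimod (rel_set0 n2).

Definition twisted_rel : set (tring (twV t)) :=
  [set psi t (tmap rel_incl (bid Sk) y) | y in [set: tens RM Sk]].

Definition TS_le m : set TS :=
  [set tmap (sub_incl (tlt V m.+1)) (bid Sk) y
    | y in [set: tens (sub_bimod (tlt V m.+1)) Sk]].

Definition TS_component m : bihom TS TS :=
  tmap (dinj (tpow V) m ∘ dproj (tpow V) m) (bid Sk).

(* V (x) b : V (x) R -> V (x) T (x) S = T (x) S, where V (x) T is identified with
   its image under the product of T. *)
Definition V_tens (b : bihom RM TS) : bihom (tens V RM) TS :=
  tmap (tmult V ∘ tmap (tgen V) (bid T)) (bid Sk) ∘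
  tassocV V T Sk ∘ tmap (bid V) b.

(* (T (x) t_V)(b (x) V) : R (x) V -> T (x) S (x) V -> T (x) V (x) S = T (x) S. *)
Definition tens_V (b : bihom RM TS) : bihom (tens RM V) TS :=
  tmap (tmult V ∘ tmap (bid T) (tgen V)) (bid Sk) ∘
  tassocV T V Sk ∘ tmap (bid T) t ∘ tassoc T Sk V ∘ tmap b (bid V).

(* The fibre product of V (x) R and R (x) V over T^{n+1}. *)
Definition in_X (u : tens V RM) (w : tens RM V) : Prop :=
  tmult V (tmap (tgen V) rel_incl u) = tmult V (tmap rel_incl (tgen V) w).

Variable alpha : bihom RM TS.

(* The component in T^{n-i} (x) S, seen in T (x) S. *)
Definition alpha_ i : bihom RM TS := TS_component (n - i) ∘ alpha.

Definition is_filtered : Prop := forall r, TS_le n (alpha r).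

(* The usual convention on the component of top degree, which is a condition on
   alpha. *)
Definition normalized : Prop :=
  forall r, alpha_ 0 r = @tpure _ _ _ T Sk (rel_incl r) 1.

Definition delta i (u : tens V RM) (w : tens RM V) : TS :=
  V_tens (alpha_ i) u - tens_V (alpha_ i) w.

(* (T (x) m_S)(alpha_i (x) S). *)
Definition alpha_S i : bihom (tens RM Sk) TS :=
  tmap (bid T) (mS eta) ∘ tassoc T Sk Sk ∘ tmap (alpha_ i) (bid Sk).

(* y is delta 1 u w seen in R (x) S; it is unique when S is left flat, because
   R (x) S -> T (x) S is then injective. *)
Definition delta1_lift u w (y : tens RM Sk) : Prop :=
  tmap rel_incl (bid Sk) y = delta 1 u w.

Definition J_0 : Prop :=
  forall u w, in_X u w -> exists y, delta1_lift u w y.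
Definition J_i i : Prop :=
  forall u w y, in_X u w -> delta1_lift u w y -> alpha_S i y = delta i.+1 u w.
Definition J_n : Prop :=
  forall u w y, in_X u w -> delta1_lift u w y -> alpha_S n y = 0.

End Conditions.

Arguments twisted_rel {K S eta V} t {n} R.
Arguments alg_gr {K V n} R m.

(* Main.v *)
(* Everything happens in the tensor ring W = T_S(V (x) S), which psi identifies
   with T (x) S.  U is a PBW-deformation iff the leading forms of the elements of
   <P> lie in the ideal <R>S of W.

   If so, P has no nonzero element of degree < n, so every r in R is the leading
   form of a unique alpha(r) in P, and
     Delta(u, w) = (V (x) alpha)(u) - (alpha (x) V)(w),   (u, w) in X,
   which belongs to <P> and has degree <= n, lies in P.  As an element of P is
   determined by its leading form, comparing the components of Delta(u, w) and of
   (alpha (x) S)(top component of Delta(u, w)) yields the conditions J.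

   Conversely, let I_m be the sum of the V^i P V^j with i + j + n <= m.  One shows
   that an element of I_{m+1} of degree <= m lies in I_m.  Write it as the image of
   y in R (x) T (x) S plus an element of V I_m + I_m; then y vanishes in
   V (x) A (x) S, and by left flatness of S we may suppose that y is in the kernel of
   R (x) T -> V (x) A.  Comparing the given resolution with
   R (x) A -> V (x) A -> A -> K shows that the kernel of R (x) A -> V (x) A is
   generated by its part of degree n + 1 if Tor_3 is (n+1)-pure, and vanishes if
   Tor_3 = 0.  That part consists of the w with (u, w) in X, for which
   Delta(u, w) in P moves (alpha (x) V)(w) into V P + P.  Hence the element is in
   V I_m + I_m, and a dual basis of V reduces it to the case m - 1. *)
From HB Require Import structures.
From mathcomp Require Import all_boot all_algebra.
From mathcomp Require Import freeg.
From mathcomp Require Import boolp classical_sets functions.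
Require Import Defs.

Set Implicit Arguments.
Unset Strict Implicit.
Unset Printing Implicit Defensive.

Import GRing.Theory.
Local Open Scope ring_scope.
Local Open Scope classical_set_scope.

(** * Subgroups, bimodules and tensor products *)

(** Over an arbitrary ring [K] minimal resolutions need not exist, so Tor_3 cannot be read off as a
    set of generators of the kernel. Instead the short complex is mapped into the given resolution
    and back: up to products with the augmentation ideal A_+, a kernel element is recovered from its
    image there, where the hypothesis on Tor_3 applies. An induction on the degree then plays the
    part of Nakayama's lemma. The kernel is needed inside R (x) T, because alpha lifts elements of R
    (x) T to W and not elements of R (x) A. The passage from A to T adds the generators r (x) b r'
    c. They are ambiguities between two disjoint relations and always resolve; only the overlaps in
    degree n + 1 impose conditions on alpha. The number n + 1 arises because the ideal L = <R> is
    zero below degree n and equal to R in degree n. Hence V L meets degree n in 0 and degree n + 1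
    in V R. As S is flat on one side only, each map tensored with S has S as its right factor, and V
    (x) T -> T is inverted by an explicit retraction. *)

Section SubgroupLemmas.
Variable G : zmodType.

Lemma smem_sum (H : subgrp G) I (s : seq I) (Q : pred I) (F : I -> G) :
  (forall i, Q i -> H (F i)) -> H (\sum_(i <- s | Q i) F i).
Proof. by move=> h; apply: big_ind => //; [exact: smem0|exact: smemD]. Qed.

Lemma span_least (X : set G) (H : subgrp G) :
  (forall x, X x -> H x) -> forall x, span X x -> H x.
Proof.
move=> h x; elim=> {x} [x /h //||x y _ hx _ hy]; first exact: smem0.
exact: smemB.
Qed.

Lemma span_mono (X Y : set G) : (forall x, X x -> Y x) ->
  forall x, span X x -> span Y x.
Proof. by move=> h; apply: span_least => x /h; apply: span_gen. Qed.

Lemma qpi_0 (H : subgrp G) x : qpi H x = 0 <-> H x.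
Proof. by rewrite -(qpi0 H) qpi_eq subr0. Qed.

End SubgroupLemmas.

Section AdditiveMaps.
Variables (G G' : zmodType) (f : G -> G').
Hypothesis fD : forall x y, f (x + y) = f x + f y.

Lemma additive0 : f 0 = 0.
Proof. by apply: (addrI (f 0)); rewrite -fD !addr0. Qed.
Lemma additiveN x : f (- x) = - f x.
Proof. by apply: (addrI (f x)); rewrite -fD !subrr additive0. Qed.
Lemma additiveB x y : f (x - y) = f x - f y.
Proof. by rewrite fD additiveN. Qed.
Lemma additive_sum I (s : seq I) (Q : pred I) (F : I -> G) :
  f (\sum_(i <- s | Q i) F i) = \sum_(i <- s | Q i) f (F i).
Proof. exact: (big_morph f fD additive0). Qed.
Lemma additive_mulrz x (l : int) : f (x *~ l) = f x *~ l.
Proof.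
have h k : f (x *+ k) = f x *+ k.
  by elim: k => [|k IH]; rewrite ?additive0 // !mulrS fD IH.
by case: l => k; rewrite -?pmulrn ?NegzE ?mulrNz -?pmulrn ?additiveN ?h.
Qed.

Definition preim_subgrp (H : subgrp G') : subgrp G.
Proof.
exists (fun x => H (f x)); first by rewrite additive0; apply: smem0.
by move=> x y hx hy; rewrite additiveB; apply: smemB.
Defined.

Lemma span_map (X : set G) (H : subgrp G') :
  (forall x, X x -> H (f x)) -> forall x, span X x -> H (f x).
Proof. by move=> h; apply: (@span_least _ _ (preim_subgrp H)). Qed.

End AdditiveMaps.

(** Packages an identity between additive maps as a subgroup, so that the induction principles
    stated for subgroups also prove equations. *)
Definition eq_subgrp (G G' : zmodType) (f g : G -> G')
  (fD : forall x y, f (x + y) = f x + f y) (gD : forall x y, g (x + y) = g x + g y) :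
  subgrp G.
Proof.
exists (fun x => f x = g x); first by rewrite (additive0 fD) (additive0 gD).
by move=> x y hx hy; rewrite (additiveB fD) (additiveB gD) hx hy.
Defined.

Section BimodLemmas.
Variables (L K : pzRingType).

Lemma lactN (M : bimod L K) l (x : M) : lact l (- x) = - lact l x.
Proof. exact: (additiveN (lactDr l)). Qed.
Lemma ractN (M : bimod L K) (x : M) k : ract (- x) k = - ract x k.
Proof. exact: (additiveN (fun y z => ractDl y z k)). Qed.
Lemma ractB (M : bimod L K) (x y : M) k : ract (x - y) k = ract x k - ract y k.
Proof. by rewrite ractDl ractN. Qed.
Lemma lactB (M : bimod L K) (x y : M) k : lact k (x - y) = lact k x - lact k y.
Proof. by rewrite lactDr lactN. Qed.
Lemma lactr0 (M : bimod L K) (x : M) : lact 0 x = 0.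
Proof. exact: (additive0 (fun a b => lactDl a b x)). Qed.

Lemma bh_sub_subproof (M N : bimod L K) (f g : bihom M N) :
  is_bihom (fun x => f x - g x).
Proof.
split=> [x y|l x|x k]; first by rewrite !bhD opprD addrACA.
  by rewrite !bhl lactB.
by rewrite !bhr ractB.
Qed.
Definition bh_sub (M N : bimod L K) (f g : bihom M N) := Bihom (bh_sub_subproof f g).

Lemma bh_sum (M N : bimod L K) (f : bihom M N) I (s : seq I) (Q : pred I) (F : I -> M) :
  f (\sum_(i <- s | Q i) F i) = \sum_(i <- s | Q i) f (F i).
Proof. exact: (additive_sum (bhD f)). Qed.

Lemma img_l (M N : bimod L K) (f : bihom M N) l y :
  img_subgrp (bhB f) (full_subgrp _) y -> img_subgrp (bhB f) (full_subgrp _) (lact l y).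
Proof. by move=> [x _ <-]; exists (lact l x); rewrite ?bhl. Qed.
Lemma img_r (M N : bimod L K) (f : bihom M N) y k :
  img_subgrp (bhB f) (full_subgrp _) y -> img_subgrp (bhB f) (full_subgrp _) (ract y k).
Proof. by move=> [x _ <-]; exists (ract x k); rewrite ?bhr. Qed.
Definition img_subbimod (M N : bimod L K) (f : bihom M N) : subbimod N :=
  Subbimod (@img_l M N f) (@img_r M N f).

Section Corestriction.
Variables (M N : bimod L K) (H : subbimod N) (f : bihom M N).
Hypothesis fH : forall x, H (f x).

Definition corestr_fun x : sub_bimod H := Subcar (introT (asboolP _) (fH x)).
Lemma corestr_subproof : is_bihom corestr_fun.
Proof.
by split=> *; apply: val_inj; rewrite /= ?bhD ?bhl ?bhr.
Qed.
Definition corestr : bihom M (sub_bimod H) := Bihom corestr_subproof.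
End Corestriction.

Lemma tensor_ext (L' : pzRingType) (M : bimod L K) (N : bimod K L') (Z : zmodType)
    (f g : tens M N -> Z) :
  (forall x y, f (x + y) = f x + f y) -> (forall x y, g (x + y) = g x + g y) ->
  (forall m n, f (tpure m n) = g (tpure m n)) -> forall x, f x = g x.
Proof.
move=> fD gD h x; elim/tpure_ind: x => [m n|x y IHx IHy]; first exact: h.
by rewrite fD gD IHx IHy.
Qed.


End BimodLemmas.

Section RightModules.
Variable A : pzRingType.

Lemma lact_int (M : rmod A) (l : int) (x : M) : lact l x = x *~ l.
Proof.
have h (k : nat) : lact (Posz k) x = x *+ k.
  elim: k => [|k IH]; first by rewrite lactr0.
  by rewrite -addn1 PoszD lactDl IH lact1 mulrnDr.
case: l => k; first by rewrite h -pmulrn.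
rewrite NegzE mulrNz -pmulrn -h; apply: (addIr (lact (Posz k.+1) x)).
by rewrite -lactDl !addNr lactr0.
Qed.

Lemma rhom_subproof (M N : rmod A) (f : M -> N) :
  (forall x y, f (x + y) = f x + f y) -> (forall x a, f (ract x a) = ract (f x) a) ->
  is_bihom f.
Proof. by move=> fD fr; split=> // l x; rewrite !lact_int (additive_mulrz fD). Qed.
Definition rhom (M N : rmod A) (f : M -> N) fD fr := Bihom (@rhom_subproof M N f fD fr).

(** Here [g] need not be onto: both maps are corestricted to the image of [g], where [projective]
    applies. *)
Lemma proj_lift (P M N : rmod A) (g : bihom M N) (f : bihom P N) :
  projective P -> (forall x, exists y, g y = f x) ->
  exists h : bihom P M, forall x, g (h x) = f x.
Proof.
move=> projP hfg.
pose H := img_subbimod g.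
have gH x : H (g x) by exists x.
have fH x : H (f x) by have [y <-] := hfg x.
have [|h hh] := projP _ _ (corestr gH) (corestr fH).
  by case=> y yH; have [x _ e] := asboolP _ yH; exists x; apply: val_inj.
by exists h => x; have := congr1 val (hh x).
Qed.

End RightModules.

Section TensorKernels.
Variables (L K L' : pzRingType).

(* Right exactness: a section of the surjection g gives a map from the target
   to the quotient of the source by the span of the obvious kernel elements. *)
Lemma tens_ker_r (M : bimod L K) (N N' : bimod K L') (g : bihom N N') :
  (forall y, exists x, g x = y) ->
  forall x, tmap (bid M) g x = 0 ->
  span [set z : tens M N | exists m n, g n = 0 /\ z = tpure m n] x.
Proof.
move=> gs x hx; set X := [set z | _].
pose sec y := sval (cid (gs y)); have secK y : g (sec y) = y := svalP (cid (gs y)).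
pose F (m : M) (y : N') := qpi (span X) (tpure m (sec y)).
have FE m a b : g a = g b -> qpi (span X) (tpure m a) = qpi (span X) (tpure m b).
  move=> e; apply/qpi_eq; apply: span_gen; exists m, (a - b).
  rewrite bhB e subrr; split=> //.
  by rewrite (additiveB (tpureDr m)).
have Fb : balanced (@ract _ _ M) (@lact _ _ N') F.
  split=> [m m' y|m y y'|m k y]; rewrite /F.
  - by rewrite -qpiD tpureDl.
  - by rewrite -qpiD -tpureDr; apply: FE; rewrite bhD !secK.
  - by rewrite tpureM; apply: FE; rewrite bhl !secK.
apply/qpi_0; rewrite -(additive0 (tliftD Fb)) -hx.
apply/esym; elim/tpure_ind: x {hx} => [m n|a b IHa IHb].
  by rewrite tmapE [LHS](tliftE Fb) /F /=; apply: FE; rewrite secK.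
by rewrite bhD (tliftD Fb) qpiD IHa IHb.
Qed.

Lemma tens_ker_l (M M' : bimod L K) (N : bimod K L') (g : bihom M M') :
  (forall y, exists x, g x = y) ->
  forall x, tmap g (bid N) x = 0 ->
  span [set z : tens M N | exists m n, g m = 0 /\ z = tpure m n] x.
Proof.
move=> gs x hx; set X := [set z | _].
pose sec y := sval (cid (gs y)); have secK y : g (sec y) = y := svalP (cid (gs y)).
pose F (y : M') (n : N) := qpi (span X) (tpure (sec y) n).
have FE n a b : g a = g b -> qpi (span X) (tpure a n) = qpi (span X) (tpure b n).
  move=> e; apply/qpi_eq; apply: span_gen; exists (a - b), n.
  rewrite bhB e subrr; split=> //.
  by rewrite (additiveB (fun u v => tpureDl u v n)).
have Fb : balanced (@ract _ _ M') (@lact _ _ N) F.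
  split=> [y y' n|y n n'|y k n]; rewrite /F.
  - by rewrite -qpiD -tpureDl; apply: FE; rewrite bhD !secK.
  - by rewrite -qpiD tpureDr.
  - by rewrite -tpureM; apply: FE; rewrite bhr !secK.
apply/qpi_0; rewrite -(additive0 (tliftD Fb)) -hx.
apply/esym; elim/tpure_ind: x {hx} => [m n|a b IHa IHb].
  by rewrite tmapE [LHS](tliftE Fb) /F /=; apply: FE; rewrite secK.
by rewrite bhD (tliftD Fb) qpiD IHa IHb.
Qed.

Lemma flat_inj (M M' : bimod L K) (N : bimod K L') (f : bihom M M') :
  flat (as_lmod N) -> injective f -> injective (tmap f (bid N)).
Proof.
move=> flatN f_inj.
have fh : is_bihom (f : as_rmod M -> as_rmod M').
  split=> [x y|l x|x k]; [exact: (bhD f)| |exact: (bhr f)].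
  exact: (bhl f (intr_mor L l)).
exact: (flatN _ _ (Bihom fh) f_inj).
Qed.

(** [f] is a surjection onto its image followed by an inclusion. Flatness keeps the inclusion
    injective, and right exactness gives the kernel of the surjection. *)
Lemma flat_ker (M M' : bimod L K) (N : bimod K L') (f : bihom M M') :
  flat (as_lmod N) -> forall x, tmap f (bid N) x = 0 ->
  span [set z : tens M N | exists m n, f m = 0 /\ z = tpure m n] x.
Proof.
move=> flatN x hx; pose H := img_subbimod f.
have fH y : H (f y) by exists y.
have e z : tmap f (bid N) z = tmap (sub_incl H) (bid N) (tmap (corestr fH) (bid N) z).
  by elim/tpure_ind: z => [m n|u v IHu IHv]; rewrite ?tmapE // !bhD IHu IHv.
have {}hx : tmap (corestr fH) (bid N) x = 0.
  apply: (@flat_inj _ _ _ (sub_incl H) flatN); first exact: val_inj.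
  by rewrite -e hx bh0.
have cs y : exists z, corestr fH z = y.
  by case: y => y yH; have [z _ ez] := asboolP _ yH; exists z; apply: val_inj.
apply: span_mono (tens_ker_l cs hx) => z [m [k [hm ->]]]; exists m, k; split=> //.
exact: (congr1 val hm).
Qed.

End TensorKernels.

(** * Dual bases of projective modules *)

Section DualBasis.
Variable K : pzRingType.

Section FreeModule.
Variable I : choiceType.

Lemma zbimod_subproof (Z : zmodType) :
  @is_bimod int int Z (fun l x => x *~ l) (fun x l => x *~ l).
Proof.
split=> *; rewrite ?mulrzDl ?mulrzDr //.
- by rewrite mulrC mulrzA.
- exact: mulrzA.
- exact: mulrzAC.
Qed.

Local Notation Zb := (Bimod (zbimod_subproof {freeg I})).
Local Notation Kr := (lres (intr_mor K) (reg K)).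

Definition free_mod : rmod K := tens Zb Kr.
Definition free_pure (D : {freeg I}) (k : K) : free_mod := @tpure _ _ _ Zb Kr D k.

Definition free_coord (i : I) : free_mod -> K := tlift (fun D k => k *~ coeff i D).

Lemma free_coord_bal i : balanced (@ract _ _ Zb) (@lact _ _ Kr)
  (fun D (k : K) => k *~ coeff i D).
Proof.
split=> [D D' k|D k k'|D l k]; rewrite ?coeffD ?mulrzDr ?mulrzDl //.
rewrite /= mulrzl -mulrzA; congr (k *~ _).
by rewrite raddfMz mulrzz mulrC.
Qed.

(** Stated for every duplicate-free list containing a support, so that several elements can be
    expanded over one common list. *)
Lemma free_expand (x : free_mod) :
  exists s0 : seq I, forall s, uniq s -> {subset s0 <= s} ->
  x = \sum_(i <- s) free_pure << i >> (free_coord i x).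
Proof.
elim/tpure_ind: x => [D k|x y [s1 IHx] [s2 IHy]]; last first.
  exists (s1 ++ s2) => s us h.
  rewrite [LHS](_ : _ = \sum_(i <- s) free_pure << i >> (free_coord i x) +
                        \sum_(i <- s) free_pure << i >> (free_coord i y)).
    rewrite -big_split; apply: eq_bigr => i _.
    by rewrite /free_coord (tliftD (free_coord_bal i)) [RHS]tpureDr.
  congr (_ + _); [apply: IHx|apply: IHy] => // i hi; apply: h.
    by rewrite mem_cat hi.
  by rewrite mem_cat hi orbT.
exists (dom D) => s us h.
have DE : D = \sum_(i <- s) << i >> *~ coeff i D.
  apply/eqP/freeg_eqP => j; rewrite raddf_sum /=.
  under eq_bigr do rewrite freegU_mulz coeffU.
  have [js|js] := boolP (j \in s).
    rewrite (bigD1_seq j) //= eqxx mulr1 big1 ?addr0; last first.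
      by move=> i /negbTE ->; rewrite mulr0.
    by rewrite intz.
  rewrite big1_seq; last first.
    move=> i /andP[_ hi]; case: eqVneq hi js => [->|_ _ _]; first by move=> ->.
    by rewrite mulr0.
  by rewrite coeff_outdom //; apply: contra js; apply: h.
rewrite {1}DE (additive_sum (fun u v => tpureDl u v k)); apply: eq_bigr => i _.
rewrite -[<< i >> *~ _]/(ract (<< i >> : Zb) _) tpureM.
congr tpure; rewrite /free_coord (tliftE (free_coord_bal i)) /=.
by rewrite mulrzl.
Qed.

Lemma free_coord_r i (x : free_mod) k : free_coord i (ract x k) = free_coord i x * k.
Proof.
elim/tpure_ind: x => [D l|x y IHx IHy].
  by rewrite tractE /free_coord !(tliftE (free_coord_bal i)) /= mulrzAl.
by rewrite ractDl /free_coord !(tliftD (free_coord_bal i)) mulrDl; congr (_ + _).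
Qed.

End FreeModule.

(** The basis vectors are all elements of [V], each its own index: the free module on the set [V]
    maps onto [V], and coordinates are taken after a section of this map. *)
Lemma dual_basis (V : rmod K) : projective V ->
  exists e : V -> V -> K,
    [/\ forall i x y, e i (x + y) = e i x + e i y,
        forall i x k, e i (ract x k) = e i x * k
      & forall x, exists s0 : seq V, forall s, uniq s -> {subset s0 <= s} ->
        x = \sum_(i <- s) ract i (e i x)].
Proof.
move=> projV.
pose Zb := Bimod (zbimod_subproof {freeg V}).
pose L (D : Zb) : V := fglift (fun v => v : zmodule V) D.
have LD x y : L (x + y) = L x + L y.
  have B u v : L (u - v) = L u - L v := @lift_is_additive _ _ (zmodule V) _ u v.
  have L0 : L 0 = 0 by rewrite -(subrr 0) B subrr.
  by rewrite -{1}[y]opprK B -(sub0r y) B L0 sub0r opprK.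
have LU v : L << v >> = v by rewrite /L liftU scale1r.
pose gf (D : Zb) (k : lres (intr_mor K) (reg K)) := ract (L D) k.
have gb : @is_bimul _ _ _ Zb (lres (intr_mor K) (reg K)) V gf.
  split=> [D D' k|D k k'|D l k|l D k|D k k']; rewrite /gf ?LD.
  - exact: ractDl.
  - exact: ractDr.
  - rewrite /= (additive_mulrz LD) mulrzl (additive_mulrz (fun u v => ractDl u v k)).
    by rewrite (additive_mulrz (ractDr (L D))).
  - by rewrite /= (additive_mulrz LD) lact_int (additive_mulrz (fun u v => ractDl u v k)).
  - exact: ractA.
pose g : bihom (free_mod V) V := tens_hom gb.
have gE v k : g (free_pure << v >> k) = ract v k.
  by rewrite [LHS]tens_homE /gf LU.
have gs (y : V) : exists x, g x = y by exists (free_pure << y >> 1); rewrite gE ract1.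
have [h hK] := projV _ _ g (bid V) gs.
exists (fun i x => free_coord i (h x)); split.
- by move=> i x y; rewrite bhD /free_coord (tliftD (free_coord_bal i)).
- by move=> i x k; rewrite bhr free_coord_r.
move=> x; have [s0 hs0] := free_expand (h x); exists s0 => s us hs.
rewrite [LHS](_ : x = g (h x)); last by rewrite hK.
rewrite {1}(hs0 s us hs) bh_sum; apply: eq_bigr => i _; exact: gE.
Qed.

End DualBasis.

(** * The tensor ring *)

Section TensorRing.
Variables (K : pzRingType) (V : bimod K K).
Local Notation T := (tring V).
Local Notation tin m u := (dinj (tpow V) m u : T).
Implicit Types (x y : T) (v : V).

Definition tconst (k : K) : T := dinj (tpow V) 0 k.
Definition tg (v : V) : T := tgen V v.
Definition tcomp m (x : T) : T := dinj (tpow V) m (x m).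

Lemma tconstD k k' : tconst (k + k') = tconst k + tconst k'.
Proof. exact: (bhD (dinj (tpow V) 0)). Qed.
Lemma tconst1 : tconst 1 = 1. Proof. by []. Qed.
Lemma tconst0E k : (tconst k 0%N : K) = k.
Proof. exact: (@dinjE _ _ (tpow V) 0 k). Qed.
Lemma tconstM k k' : tconst (k * k') = tconst k * tconst k'.
Proof.
rewrite -[RHS]/(tmul _ _) -dract_mul; exact: (bhr (dinj (tpow V) 0)).
Qed.
Lemma tgD v w : tg (v + w) = tg v + tg w.
Proof. exact: (bhD (tgen V)). Qed.
Lemma tg_l k v : tg (lact k v) = tconst k * tg v.
Proof. by rewrite /tg bhl -[RHS]/(tmul _ _) -dlact_mul. Qed.
Lemma tg_r v k : tg (ract v k) = tg v * tconst k.
Proof. by rewrite /tg bhr -[RHS]/(tmul _ _) -dract_mul. Qed.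
Lemma tlactM k x : lact k (x : tring_bimod V) = tconst k * x :> T.
Proof. exact: dlact_mul. Qed.
Lemma tractM x k : ract (x : tring_bimod V) k = x * tconst k :> T.
Proof. exact: dract_mul. Qed.

Lemma dshift_mul x v : dshift x v = x * tg v.
Proof.
rewrite -[RHS]/(tmul _ (dinj (tpow V) 1 _)) tmulE rmulpS.
by congr dshift; rewrite -[RHS]/(ract (x : tring_bimod V) 1) ract1.
Qed.
Lemma dinj_tpure m (u : tpow V m) v :
  dinj (tpow V) m.+1 (tpure u v) = tin m u * tg v :> T.
Proof. by rewrite -dshift_inj dshift_mul. Qed.

Lemma tcompD m x y : tcomp m (x + y) = tcomp m x + tcomp m y.
Proof. by rewrite /tcomp dsumDE (bhD (dinj (tpow V) m)). Qed.
Lemma tcomp_inj m (u : tpow V m) : tcomp m (dinj (tpow V) m u) = dinj (tpow V) m u.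
Proof. by rewrite /tcomp dinjE. Qed.
Lemma tcomp_injN m m' (u : tpow V m) : m <> m' -> tcomp m' (dinj (tpow V) m u) = 0.
Proof. by move=> h; rewrite /tcomp dinjN // bh0. Qed.

Lemma tgrP m x : tgr V m x <-> tcomp m x = x.
Proof.
split=> [[u ->]|<-]; first exact: tcomp_inj.
by exists (x m).
Qed.
Lemma tgr_zero m : tgr V m 0. Proof. by exists 0; rewrite bh0. Qed.
Lemma tgr_sub m x y : tgr V m x -> tgr V m y -> tgr V m (x - y).
Proof. by move=> [u ->] [u' ->]; exists (u - u'); rewrite bhB. Qed.
Definition tgr_subgrp m : subgrp T := Subgrp (@tgr_zero m) (@tgr_sub m).
Lemma tgr_comp m x : tgr V m (tcomp m x). Proof. by exists (x m). Qed.
Lemma tgr_compN m m' x : tgr V m x -> m <> m' -> tcomp m' x = 0.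
Proof. by move=> [u ->]; apply: tcomp_injN. Qed.
Lemma tgr_const k : tgr V 0 (tconst k). Proof. by exists k. Qed.
Lemma tgr_tg v : tgr V 1 (tg v). Proof. by eexists. Qed.

Lemma tring_gen (H : subgrp T) :
  (forall k, H (tconst k)) -> (forall x v, H x -> H (x * tg v)) -> forall x, H x.
Proof.
move=> h0 hS; elim/dsum_ind=> [m u|x y]; last exact: smemD.
elim: m u => [|m IH] u; first exact: h0.
elim/tpure_ind: u => [u v|u w hu hw]; last by rewrite bhD; apply: smemD.
by rewrite dinj_tpure; apply/hS/IH.
Qed.

Lemma tring_eq (G : zmodType) (f g : T -> G) :
  (forall x y, f (x + y) = f x + f y) -> (forall x y, g (x + y) = g x + g y) ->
  (forall k, f (tconst k) = g (tconst k)) ->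
  (forall x v, f x = g x -> f (x * tg v) = g (x * tg v)) -> forall x, f x = g x.
Proof. by move=> fD gD h0 hS; apply: (@tring_gen (eq_subgrp fD gD)). Qed.

Lemma tgr_gen m (H : subgrp T) :
  (forall x v, tgr V m x -> H (x * tg v)) -> forall x, tgr V m.+1 x -> H x.
Proof.
move=> h x [u ->]; elim/tpure_ind: u => [u v|u w hu hw].
  by rewrite dinj_tpure; apply: h; exists u.
by rewrite bhD; apply: smemD.
Qed.

Lemma tgrM i j x y : tgr V i x -> tgr V j y -> tgr V (i + j) (x * y).
Proof.
move=> hx; elim: j y => [|j IH] y.
  move=> [k ->]; rewrite addn0 -[_ * _]/(x * tconst k) -tractM.
  by case: hx => u ->; exists (ract u k); rewrite bhr.
move: y; apply: (@tgr_gen j (preim_subgrp (mulrDr x) (tgr_subgrp (i + j.+1)))) => y v hy /=.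
rewrite mulrA addnS; have [u ->] := IH _ hy.
by rewrite -dinj_tpure; exists (tpure u v).
Qed.

Lemma tgr_sum x : exists N, forall M, (N <= M)%N -> x = \sum_(m < M) tcomp m x.
Proof.
have [N hN] := dfin x; exists N => M h; apply: dsum_decomp => m hm.
by apply: hN; apply: leq_trans hm.
Qed.

Lemma tring_homog (H : subgrp T) : (forall m x, tgr V m x -> H x) -> forall x, H x.
Proof.
move=> h x; have [N hN] := tgr_sum x; rewrite (hN N) //.
by apply: smem_sum => i _; apply/h/tgr_comp.
Qed.

Lemma tcomp0 m : tcomp m 0 = 0. Proof. exact: (additive0 (tcompD m)). Qed.

Lemma tcomp_mulr i j x y : tgr V j y -> tcomp (i + j) (x * y) = tcomp i x * y.
Proof.
move=> hy; move: x.
have fD x x' : tcomp (i + j) ((x + x') * y) = tcomp (i + j) (x * y) + tcomp (i + j) (x' * y).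
  by rewrite mulrDl tcompD.
have gD x x' : tcomp i (x + x') * y = tcomp i x * y + tcomp i x' * y.
  by rewrite tcompD mulrDl.
apply: (@tring_homog (eq_subgrp fD gD)) => m x hx /=.
have [e|ne] := eqVneq m i.
  by rewrite -e (tgrP _ _).1 ?(tgrP _ _).1 //; apply: tgrM.
rewrite (tgr_compN hx); last exact/eqP.
rewrite mul0r (tgr_compN (tgrM hx hy)) //.
by apply/eqP; rewrite eqn_add2r.
Qed.

Lemma tcomp_mull i j x y : tgr V i x -> tcomp (i + j) (x * y) = x * tcomp j y.
Proof.
move=> hx; move: y.
have fD y y' : tcomp (i + j) (x * (y + y')) = tcomp (i + j) (x * y) + tcomp (i + j) (x * y').
  by rewrite mulrDr tcompD.
have gD y y' : x * tcomp j (y + y') = x * tcomp j y + x * tcomp j y'.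
  by rewrite tcompD mulrDr.
apply: (@tring_homog (eq_subgrp fD gD)) => m y hy /=.
have [e|ne] := eqVneq m j.
  by rewrite -e (tgrP _ _).1 ?(tgrP _ _).1 //; apply: tgrM.
rewrite (tgr_compN hy); last exact/eqP.
rewrite mulr0 (tgr_compN (tgrM hx hy)) //.
by apply/eqP; rewrite eqn_add2l.
Qed.

Lemma tcomp_mulr_lt m j x y : tgr V j y -> (m < j)%N -> tcomp m (x * y) = 0.
Proof.
move=> hy lt; move: x.
have fD x x' : tcomp m ((x + x') * y) = tcomp m (x * y) + tcomp m (x' * y).
  by rewrite mulrDl tcompD.
apply: (@tring_homog (eq_subgrp fD (fun _ _ => esym (addr0 0)))) => i x hx.
apply: (tgr_compN (tgrM hx hy)) => e; move: lt; rewrite -e.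
by rewrite ltnNge leq_addl.
Qed.

Lemma tcomp_mull_lt m i x y : tgr V i x -> (m < i)%N -> tcomp m (x * y) = 0.
Proof.
move=> hx lt; move: y.
have fD y y' : tcomp m (x * (y + y')) = tcomp m (x * y) + tcomp m (x * y').
  by rewrite mulrDr tcompD.
apply: (@tring_homog (eq_subgrp fD (fun _ _ => esym (addr0 0)))) => j y hy.
apply: (tgr_compN (tgrM hx hy)) => e; move: lt; rewrite -e.
by rewrite ltnNge leq_addr.
Qed.

Lemma tltP m x : tlt V m x <-> forall q, (m <= q)%N -> tcomp q x = 0.
Proof.
split=> h q hq; first by rewrite /tcomp h // bh0.
by have /(congr1 (fun z : T => z q)) := h q hq; rewrite /tcomp dinjE.
Qed.
Lemma tlt_span m (H : subgrp T) :
  (forall q x, (q < m)%N -> tgr V q x -> H x) -> forall x, tlt V m x -> H x.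
Proof.
move=> h x hx; have [N hN] := tgr_sum x; rewrite (hN N) //.
apply: smem_sum => i _; have [lt|le] := ltnP i m.
  exact: h lt (tgr_comp _ _).
by rewrite (tltP m x).1 //; apply: smem0.
Qed.
Lemma tgr_tlt m q x : (q < m)%N -> tgr V q x -> tlt V m x.
Proof.
move=> h hx; apply/tltP => r hr; apply: (tgr_compN hx) => e.
by rewrite e ltnNge hr in h.
Qed.
Lemma tlt_leq m m' x : (m <= m')%N -> tlt V m x -> tlt V m' x.
Proof. by move=> h hx q hq; apply: hx; apply: leq_trans hq. Qed.
Lemma tlt_mull i d a x : tgr V i a -> tlt V d x -> tlt V (i + d) (a * x).
Proof.
move=> ha hx; apply/tltP => q hq; have le : (i <= q)%N := leq_trans (leq_addr _ _) hq.
rewrite -(subnKC le) (tcomp_mull _ _ ha) ((tltP d x).1 hx) ?mulr0 //.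
by rewrite leq_subRL.
Qed.
Lemma tlt_mulr i d a x : tgr V i a -> tlt V d x -> tlt V (d + i) (x * a).
Proof.
move=> ha hx; apply/tltP => q hq; have le : (i <= q)%N := leq_trans (leq_addl _ _) hq.
rewrite -(subnK le) (tcomp_mulr _ _ ha) ((tltP d x).1 hx) ?mul0r //.
by rewrite leq_subRL // addnC.
Qed.
Lemma tltS m x : tlt V m.+1 x -> tlt V m (x - tcomp m x).
Proof.
move=> hx; apply/tltP => q hq; rewrite (additiveB (tcompD q)).
have [<-|ne] := eqVneq m q; first by rewrite (tgrP m (tcomp m x)).1 ?subrr //; apply: tgr_comp.
rewrite (tgr_compN (tgr_comp m x)); last exact/eqP.
by rewrite subr0 (tltP m.+1 x).1 // ltn_neqAle ne.
Qed.
Lemma tlt_comp0 m x : tlt V m.+1 x -> tcomp m x = 0 -> tlt V m x.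
Proof. by move=> /tltS + h; rewrite h subr0. Qed.
Lemma tlt0 x : tlt V 0 x -> x = 0.
Proof. by move=> h; apply: dsum_ext => m; rewrite h. Qed.

(** [tpow] exposes the last factor only. The first one is reached by induction on the degree,
    applied to the subgroup of those [x] for which [x * tg v] is in [H]. *)
Lemma tgr_genl m (H : subgrp T) :
  (forall x v, tgr V m x -> H (tg v * x)) -> forall x, tgr V m.+1 x -> H x.
Proof.
elim: m H => [|m IH] H h.
  apply: tgr_gen => x v [k ->]; rewrite -[_ * _]/(tconst k * _) -tg_l -[tg _]mulr1.
  by apply: h; rewrite -tconst1; apply: tgr_const.
apply: tgr_gen => x v hx; move: x hx.
apply: (IH (preim_subgrp (fun u u' => mulrDl u u' (tg v)) H)) => x w hx /=.
rewrite -mulrA; apply: h; rewrite -[m.+1]addn1; exact: tgrM hx (tgr_tg v).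
Qed.

Section RightMultiplication.
Variable M : bimod K K.
Local Notation MT := (tens M (tring_bimod V)).
Local Notation mpure m y := (@tpure _ _ _ M (tring_bimod V) m (y : T)).
Implicit Types (m : M) (z : MT).

Lemma vt_mul_bal (a : T) : balanced (@ract _ _ M) (@lact _ _ (tring_bimod V))
  (fun m (y : T) => mpure m (y * a)).
Proof.
split=> [m m' y|m y y'|m k y]; first exact: tpureDl.
  by rewrite mulrDl; exact: tpureDr.
by rewrite tpureM !tlactM mulrA.
Qed.
Definition vt_mul (z : MT) (a : T) : MT :=
  tlift (fun m (y : T) => mpure m (y * a)) z.
Lemma vt_mulE m y a : vt_mul (mpure m y) a = mpure m (y * a).
Proof. exact: (tliftE (vt_mul_bal a)). Qed.
Lemma vt_mulD z z' a : vt_mul (z + z') a = vt_mul z a + vt_mul z' a.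
Proof. exact: (tliftD (vt_mul_bal a)). Qed.
Lemma vt_mul0 a : vt_mul 0 a = 0.
Proof. exact: (additive0 (fun z z' => vt_mulD z z' a)). Qed.
Lemma vt_mulDr z a b : vt_mul z (a + b) = vt_mul z a + vt_mul z b.
Proof.
elim/tpure_ind: z => [m y|z z' IH IH'].
  by rewrite !vt_mulE mulrDr; exact: tpureDr.
by rewrite !vt_mulD IH IH' addrACA.
Qed.
Lemma vt_mulA z a b : vt_mul (vt_mul z a) b = vt_mul z (a * b).
Proof.
elim/tpure_ind: z => [m y|z z' IH IH']; first by rewrite !vt_mulE mulrA.
by rewrite !vt_mulD IH IH'.
Qed.
Lemma vt_mul_const z k : vt_mul z (tconst k) = ract z k.
Proof.
elim/tpure_ind: z => [m y|z z' IH IH']; first by rewrite !vt_mulE tractE tractM.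
by rewrite !vt_mulD IH IH' ractDl.
Qed.
Lemma vt_mul_l k z a : vt_mul (lact k z) a = lact k (vt_mul z a).
Proof.
elim/tpure_ind: z => [m y|z z' IH IH']; first by rewrite tlactE !vt_mulE tlactE.
by rewrite lactDr !vt_mulD IH IH' lactDr.
Qed.

Definition vt_comp k (z : MT) : MT := tmap (bid M) (dinj (tpow V) k ∘ dproj (tpow V) k) z.
Lemma vt_compE k m y : vt_comp k (mpure m y) = mpure m (tcomp k y).
Proof. exact: tmapE. Qed.
Lemma vt_compD k z z' : vt_comp k (z + z') = vt_comp k z + vt_comp k z'.
Proof. exact: (bhD (tmap _ _)). Qed.

Definition vt_gr k : subgrp MT := span [set z | exists m y, tgr V k y /\ z = mpure m y].
Lemma vt_comp_gr k z : vt_gr k (vt_comp k z).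
Proof.
elim/tpure_ind: z => [m y|z z' IH IH']; last by rewrite vt_compD; apply: smemD.
by rewrite vt_compE; apply: span_gen; exists m, (tcomp k y); split=> //; apply: tgr_comp.
Qed.
Lemma vt_comp_id k z : vt_gr k z -> vt_comp k z = z.
Proof.
move: z; apply: (span_least (H := eq_subgrp (vt_compD k) (fun _ _ => erefl))).
by move=> z [m [y [/tgrP hy ->]]] /=; rewrite vt_compE hy.
Qed.
Lemma vt_comp_mul i j z a : tgr V j a -> vt_comp (i + j) (vt_mul z a) = vt_mul (vt_comp i z) a.
Proof.
move=> ha; elim/tpure_ind: z => [m y|z z' IH IH'].
  by rewrite vt_mulE !vt_compE (tcomp_mulr _ _ ha) vt_mulE.
by rewrite vt_compD !vt_mulD vt_compD IH IH'.
Qed.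
Lemma vt_comp_mul_lt k j z a : tgr V j a -> (k < j)%N -> vt_comp k (vt_mul z a) = 0.
Proof.
move=> ha lt; elim/tpure_ind: z => [m y|z z' IH IH'].
  by rewrite vt_mulE vt_compE (tcomp_mulr_lt _ ha lt) (additive0 (tpureDr m)).
by rewrite vt_mulD vt_compD IH IH' addr0.
Qed.

End RightMultiplication.
Arguments vt_gr {M} k.

(* The splitting [T_+ -> V (x) T] of multiplication; [tpow] adds factors on the
   right, so it is built by recursion on the degree. *)
Local Notation VT := (tens V (tring_bimod V)).
Local Notation vpure v y := (@tpure _ _ _ V (tring_bimod V) v (y : T)).

Lemma lam1_subproof : @is_bimul K K K (reg K) V VT
  (fun k v => vpure (lact k v) 1).
Proof.
split=> [k k' v|k v v'|k k' v|k k' v|k v k'].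
- by rewrite lactDl tpureDl.
- by rewrite lactDr tpureDl.
- by rewrite /= lactA.
- by rewrite [RHS]tlactE -lactA.
- by rewrite -lract tpureM tractE tlactM tractM mulr1 mul1r.
Qed.
Lemma lamS_subproof m (f : bihom (tpow V m) VT) :
  @is_bimul K K K (tpow V m) V VT (fun u v => vt_mul (f u) (tg v)).
Proof.
split=> [x x' v|x v v'|x k v|k x v|x v k].
- by rewrite bhD vt_mulD.
- by rewrite tgD vt_mulDr.
- by rewrite bhr -vt_mul_const vt_mulA -tg_l.
- by rewrite bhl vt_mul_l.
- by rewrite tg_r -vt_mulA vt_mul_const.
Qed.
Fixpoint lam_pow m : bihom (tpow V m.+1) VT :=
  match m return bihom (tpow V m.+1) VT with
  | 0 => tens_hom lam1_subproof
  | m'.+1 => tens_hom (lamS_subproof (lam_pow m'))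
  end.

Definition lam_comp m : tpow V m -> VT :=
  match m return tpow V m -> VT with 0 => fun=> 0 | m'.+1 => lam_pow m' end.
Definition lam_fun (x : T) : VT := dlift lam_comp x.
Lemma lam_compD m (u u' : tpow V m) : lam_comp (u + u') = lam_comp u + lam_comp u'.
Proof. by case: m u u' => [|m] u u' /=; [rewrite addr0|apply: (bhD (lam_pow m))]. Qed.
Lemma lam_funD x y : lam_fun (x + y) = lam_fun x + lam_fun y.
Proof. exact: dliftD lam_compD _ _. Qed.
Lemma lam_inj m (u : tpow V m) : lam_fun (dinj (tpow V) m u) = lam_comp u.
Proof. exact: (dlift_inj lam_compD). Qed.
Lemma lam_subproof : @is_bihom K K (tring_bimod V) VT lam_fun.
Proof.
split=> [|k x|x k]; first exact: lam_funD.
  elim/dsum_ind: x => [m u|x y hx hy]; last by rewrite !(lactDr, lam_funD) hx hy.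
  rewrite -(bhl (dinj (tpow V) m)) !lam_inj; case: m u => [|m] u; last exact: (bhl (lam_pow m)).
  exact: (esym (lact0 VT k)).
elim/dsum_ind: x => [m u|x y hx hy]; last by rewrite !(ractDl, lam_funD) hx hy.
rewrite -(bhr (dinj (tpow V) m)) !lam_inj; case: m u => [|m] u; last exact: (bhr (lam_pow m)).
exact: (esym (ract0 VT k)).
Qed.
Definition lam : bihom (tring_bimod V) VT := Bihom lam_subproof.

Lemma lam_const k : lam (tconst k) = 0. Proof. exact: lam_inj. Qed.
(** The constant part of [x] is killed by [lam], yet it contributes an element of degree 1 to the
    product; the second summand accounts for it. *)
Lemma lam_mul_tg x v :
  lam (x * tg v) = vt_mul (lam x) (tg v) + vpure (lact (x 0%N : K) v) 1.
Proof.
elim/dsum_ind: x => [m u|x y hx hy]; last first.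
  rewrite mulrDl (bhD lam) hx hy (bhD lam) vt_mulD dsumDE lactDl tpureDl.
  by rewrite addrACA.
rewrite -dinj_tpure !/(lam _) /= !lam_inj; case: m u => [|m] u.
  rewrite dinj_valE -[lam_comp u]/(0 : VT).
  rewrite -[LHS]/(tens_hom lam1_subproof _) tens_homE.
  by rewrite vt_mul0 add0r.
rewrite dinj_valN // lactr0 tpure0l addr0.
by rewrite -[LHS]/(tens_hom (lamS_subproof _) _) tens_homE.
Qed.

Lemma tg0 v : (tg v : T) 0%N = 0. Proof. exact: dinjN. Qed.

Lemma lam_tg v x : lam (tg v * x) = vpure v x.
Proof.
move: x; apply: tring_eq => [x y|x y|k|x w].
- by rewrite mulrDr; apply: (bhD lam).
- exact: tpureDr.
- rewrite -tg_r -[tg _]mul1r lam_mul_tg -tconst1 lam_const vt_mul0 add0r.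
  by rewrite tconst0E lact1 tpureM tlactM tconst1 mulr1.
move=> hx; rewrite mulrA lam_mul_tg hx vt_mulE.
by rewrite taug_subproof tg0 mul0r lactr0 tpure0l addr0.
Qed.

Definition vt_mult : bihom VT (tring_bimod V) :=
  tmult V ∘ tmap (tgen V) (bid (tring_bimod V)).
Lemma vt_multE v (x : T) : vt_mult (vpure v x) = tg v * x.
Proof. by rewrite -[LHS]/(tmult V (tmap _ _ _)) tmapE [LHS]tens_homE. Qed.
(** [lam] is a retraction, so V (x) T embeds in T by construction, and identities in V (x) T can be
    tested on products in T. *)
Lemma lam_mult z : lam (vt_mult z) = z.
Proof.
elim/tpure_ind: z => [v x|z z' IH IH']; first by rewrite vt_multE lam_tg.
by rewrite !bhD IH IH'.
Qed.
Lemma vt_mult_mul z a : vt_mult (vt_mul z a) = (vt_mult z : T) * a :> T.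
Proof.
elim/tpure_ind: z => [v x|z z' IH IH']; first by rewrite vt_mulE !vt_multE mulrA.
by rewrite vt_mulD !bhD IH IH'; apply/esym/mulrDl.
Qed.
Lemma mult_lam x : vt_mult (lam x) = x - tconst (x 0%N).
Proof.
move: x; apply: tring_eq => [x y|x y|k|x v hx].
- by rewrite (bhD lam) bhD.
- by rewrite dsumDE tconstD opprD addrACA.
- by rewrite lam_const bh0 tconst0E subrr.
rewrite lam_mul_tg bhD vt_mult_mul hx vt_multE mulr1 taug_subproof tg0 mulr0.
by rewrite (additive0 tconstD) subr0 tg_l mulrBl subrK.
Qed.
Lemma tring_genl (H : subgrp T) :
  (forall k, H (tconst k)) -> (forall v x, H (tg v * x)) -> forall x, H x.
Proof.
move=> h0 hS x; have -> : x = vt_mult (lam x) + tconst (x 0%N) by rewrite mult_lam subrK.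
apply: smemD => //; elim/tpure_ind: (lam x) => [v y|z z' hz hz'].
  by rewrite vt_multE; apply: hS.
by rewrite bhD; apply: (smemD hz hz').
Qed.
(** Without constant term [x] is a sum of products starting in V, and a multiplication on the right
    leaves the first factor alone. *)
Lemma lamM x y : x 0%N = 0 -> lam (x * y) = vt_mul (lam x) y.
Proof.
move=> x0; have <- : vt_mult (lam x) = x by rewrite mult_lam x0 (additive0 tconstD) subr0.
rewrite lam_mult; elim/tpure_ind: (lam x) => [v z|z z' IH IH'].
  by rewrite vt_multE -mulrA lam_tg vt_mulE.
by rewrite bhD [X in lam X](@mulrDl T) (bhD lam) IH IH' vt_mulD.
Qed.

Section Contraction.
Variable E : V -> K.
Hypothesis ED : forall v w, E (v + w) = E v + E w.
Hypothesis Er : forall v k, E (ract v k) = E v * k.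

Lemma contr_bal : balanced (@ract _ _ V) (@lact _ _ (tring_bimod V))
  (fun v x => lact (E v) (x : tring_bimod V)).
Proof.
split=> [v v' x|v x x'|v k x]; first by rewrite ED lactDl.
  by rewrite lactDr.
by rewrite Er lactA.
Qed.
(** Applies [E] to the first factor and kills constants. For a coordinate function [E] this is left
    division by a basis vector, and it lowers the degree by one. *)
Definition contr (x : T) : T := tlift (fun v x => lact (E v) (x : tring_bimod V)) (lam x).
Lemma contrD x y : contr (x + y) = contr x + contr y.
Proof. by rewrite /contr (bhD lam) (tliftD contr_bal). Qed.
Lemma contrE v x : contr (tg v * x) = tconst (E v) * x.
Proof. by rewrite /contr lam_tg (tliftE contr_bal) tlactM. Qed.
Lemma contr_tlt m x : tlt V m.+1 x -> tlt V m (contr x).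
Proof.
move: x; apply: (@tlt_span _ (preim_subgrp contrD (tlt V m))) => -[|q] x hq hx /=.
  by case: hx => k ->; rewrite /contr lam_const (additive0 (tliftD contr_bal)).
move: x hx; apply: (@tgr_genl _ (preim_subgrp contrD (tlt V m))) => x v hx /=.
rewrite contrE; apply: (@tgr_tlt _ q) => //.
exact: (tgrM (tgr_const _) hx).
Qed.
End Contraction.

End TensorRing.

Arguments vt_gr {K V M} k.

(** * Graded modules and comparison of resolutions *)

Section Grading.
Variables (M : zmodType) (Mgr : nat -> set M).
Hypothesis hM : is_grading Mgr.

Lemma grading_uniq N (a b : nat -> M) :
  (forall i, Mgr i (a i)) -> (forall i, Mgr i (b i)) ->
  \sum_(i < N) a i = \sum_(i < N) b i -> forall i, (i < N)%N -> a i = b i.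
Proof.
move=> ha hb e i hi; apply/eqP; rewrite -subr_eq0; apply/eqP.
apply: (gr_indep hM (c := fun i => a i - b i)) hi => [j|]; first exact: (gr_B hM).
by rewrite sumrB e subrr.
Qed.

(** The family from [gr_span] is padded with zeros, so that decompositions of different lengths can
    be compared over a common bound. *)
Lemma grading_decomp (x : M) : exists c : nat -> M,
  (forall i, Mgr i (c i)) /\ exists N, forall B, (N <= B)%N -> x = \sum_(i < B) c i.
Proof.
have [N [c [hc ->]]] := gr_span hM x.
exists (fun i => if (i < N)%N then c i else 0); split=> [i|].
  by case: ifP => // _; apply: (gr_0 hM).
exists N => B h; rewrite (big_ord_widen B c h) big_mkcond; apply: eq_bigr => i _.
by case: ifP.
Qed.

Definition gcomp m x : M := sval (cid (grading_decomp x)) m.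
Lemma gcomp_gr m x : Mgr m (gcomp m x).
Proof. by rewrite /gcomp; case: cid => c []. Qed.
Lemma gcomp_sum x : exists N, forall B, (N <= B)%N -> x = \sum_(i < B) gcomp i x.
Proof. exact: (svalP (cid (grading_decomp x))).2. Qed.
Lemma gcomp_uniq x (c : nat -> M) N m : (forall i, Mgr i (c i)) ->
  (forall B, (N <= B)%N -> x = \sum_(i < B) c i) -> gcomp m x = c m.
Proof.
move=> hc hx; have [N' hN'] := gcomp_sum x.
pose B := maxn (maxn N N') m.+1.
have [hB hB' hm] : [/\ (N <= B)%N, (N' <= B)%N & (m < B)%N].
  by rewrite !leq_max !leqnn !orbT.
apply: (@grading_uniq B _ _ (fun i => gcomp_gr i x) hc) hm.
by rewrite -hN' // -hx.
Qed.
Lemma gr_D i x y : Mgr i x -> Mgr i y -> Mgr i (x + y).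
Proof.
move=> hx hy; rewrite -[y]opprK -[- y]sub0r; apply: (gr_B hM) => //.
by apply: (gr_B hM) => //; apply: (gr_0 hM).
Qed.
Lemma gcompD m x y : gcomp m (x + y) = gcomp m x + gcomp m y.
Proof.
have [N hN] := gcomp_sum x; have [N' hN'] := gcomp_sum y.
apply: (@gcomp_uniq _ (fun m => gcomp m x + gcomp m y) (maxn N N')) => [i|B].
  by apply: gr_D; apply: gcomp_gr.
by rewrite geq_max => /andP[h h']; rewrite big_split -hN // -hN'.
Qed.
Lemma gcomp_homog m m' x : Mgr m x -> gcomp m' x = if m' == m then x else 0.
Proof.
move=> hx; apply: (@gcomp_uniq _ (fun m' => if m' == m then x else 0) m.+1) => [i|B h].
  by case: eqP => [->|_] //; apply: (gr_0 hM).
by rewrite -big_mkcond /= (big_pred1 (Ordinal h)).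
Qed.
Lemma gcomp_id m x : Mgr m x -> gcomp m x = x.
Proof. by move/gcomp_homog->; rewrite eqxx. Qed.
Lemma gr_homog (H : subgrp M) : (forall m x, Mgr m x -> H x) -> forall x, H x.
Proof.
move=> h x; have [N hN] := gcomp_sum x; rewrite (hN N) //.
by apply: smem_sum => i _; apply: h (gcomp_gr _ _).
Qed.
End Grading.

Section GradedModules.
Variables (A : pzRingType) (Agr : nat -> set A).

Lemma gcomp_ract (M : rmod A) (Mgr : nat -> set M) (hM : is_graded_rmod Agr Mgr) m j x a :
  Agr j a -> gcomp hM.1 (m + j) (ract x a) = ract (gcomp hM.1 m x) a.
Proof.
move=> ha; move: x.
have fD x y : gcomp hM.1 (m + j) (ract (x + y) a) =
    gcomp hM.1 (m + j) (ract x a) + gcomp hM.1 (m + j) (ract y a).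
  by rewrite ractDl gcompD.
have gD x y : ract (gcomp hM.1 m (x + y)) a =
    ract (gcomp hM.1 m x) a + ract (gcomp hM.1 m y) a.
  by rewrite gcompD ractDl.
apply: (@gr_homog _ _ hM.1 (eq_subgrp fD gD)) => i x hx.
rewrite -[smem _ _]/(_ = _) (gcomp_homog hM.1 _ hx) (gcomp_homog hM.1 _ (hM.2 _ _ _ _ hx ha)).
by rewrite eqn_add2r; case: eqP => // _; rewrite ract0.
Qed.

Lemma gcomp_ract_lt (M : rmod A) (Mgr : nat -> set M) (hM : is_graded_rmod Agr Mgr) m j x a :
  Agr j a -> (m < j)%N -> gcomp hM.1 m (ract x a) = 0.
Proof.
move=> ha lt; move: x.
have fD x y : gcomp hM.1 m (ract (x + y) a) =
    gcomp hM.1 m (ract x a) + gcomp hM.1 m (ract y a).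
  by rewrite ractDl gcompD.
have gD (x y : M) : 0 = 0 + 0 :> M by rewrite addr0.
apply: (@gr_homog _ _ hM.1 (eq_subgrp fD gD)) => i x hx.
rewrite -[smem _ _]/(_ = _) (gcomp_homog hM.1 _ (hM.2 _ _ _ _ hx ha)).
by case: eqP => // e; rewrite e ltnNge leq_addl in lt.
Qed.

Lemma gcomp_map (M M' : zmodType) (Mgr : nat -> set M) (Mgr' : nat -> set M')
    (hM : is_grading Mgr) (hM' : is_grading Mgr') (f : M -> M') m x :
  (forall x y, f (x + y) = f x + f y) -> (forall m x, Mgr m x -> Mgr' m (f x)) ->
  gcomp hM' m (f x) = f (gcomp hM m x).
Proof.
move=> fD hf; move: x.
have aD x y : gcomp hM' m (f (x + y)) = gcomp hM' m (f x) + gcomp hM' m (f y).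
  by rewrite fD gcompD.
have bD x y : f (gcomp hM m (x + y)) = f (gcomp hM m x) + f (gcomp hM m y).
  by rewrite gcompD fD.
apply: (@gr_homog _ _ hM (eq_subgrp aD bD)) => i x hx.
rewrite -[smem _ _]/(_ = _) (gcomp_homog hM _ hx) (gcomp_homog hM' _ (hf _ _ hx)).
by case: eqP => // _; rewrite (additive0 fD).
Qed.

End GradedModules.

(** The classical comparison argument, cut off at [C2]: with no further module to lift to, the
    homotopy leaves an error [s] with values in the kernel of [c2]. The relation is
    [g f2 - 1 = s1 c2 + s], and its homotopy term vanishes on that kernel. *)
Lemma comparison (A : pzRingType) (N C0 C1 C2 Q0 Q1 Q2 Q3 : rmod A)
    (c0 : bihom C0 N) (c1 : bihom C1 C0) (c2 : bihom C2 C1)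
    (q0 : bihom Q0 N) (q1 : bihom Q1 Q0) (q2 : bihom Q2 Q1) (q3 : bihom Q3 Q2)
    (f0 : bihom C0 Q0) (f1 : bihom C1 Q1) (f2 : bihom C2 Q2) :
  projective C0 -> projective C1 -> projective Q0 -> projective Q1 -> projective Q2 ->
  (forall y, exists x, c0 x = y) ->
  (forall y, c0 y = 0 -> exists x, c1 x = y) -> (forall y, c1 y = 0 -> exists x, c2 x = y) ->
  (forall x, c0 (c1 x) = 0) -> (forall x, c1 (c2 x) = 0) ->
  (forall x, q0 (q1 x) = 0) -> (forall x, q1 (q2 x) = 0) -> (forall x, q2 (q3 x) = 0) ->
  (forall x, q0 (f0 x) = c0 x) -> (forall x, q1 (f1 x) = f0 (c1 x)) ->
  (forall x, q2 (f2 x) = f1 (c2 x)) ->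
  exists (g : bihom Q2 C2) (s : bihom C2 C2),
    [/\ forall x, c2 (g (q3 x)) = 0, forall x, c2 (s x) = 0
      & forall x, c2 x = 0 -> g (f2 x) - x = s x].
Proof.
move=> pC0 pC1 pQ0 pQ1 pQ2 c0s ex0 ex1 c01 c12 q01 q12 q23 hf0 hf1 hf2.
have [g0 hg0] := proj_lift (g := c0) (f := q0) pQ0 (fun x => c0s (q0 x)).
have [|g1 hg1] := proj_lift (g := c1) (f := g0 ∘ q1) pQ1.
  by move=> x; apply: ex0; rewrite /= hg0 q01.
have [|g2 hg2] := proj_lift (g := c2) (f := g1 ∘ q2) pQ2.
  by move=> x; apply: ex1; rewrite /= hg1 /= q12 bh0.
have [|s0 hs0] := proj_lift (g := c1) (f := bh_sub (g0 ∘ f0) (bid C0)) pC0.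
  by move=> x; apply: ex0; rewrite /= bhB hg0 hf0 subrr.
have [|s1 hs1] := proj_lift (g := c2)
    (f := bh_sub (bh_sub (g1 ∘ f1) (bid C1)) (s0 ∘ c1)) pC1.
  move=> x; apply: ex1; rewrite /= !bhB hg1 hs0 /= hf1.
  by rewrite subrr.
exists g2, (bh_sub (bh_sub (g2 ∘ f2) (bid C2)) (s1 ∘ c2)); split=> [x|x|x hx] /=.
- by rewrite hg2 /= q23 bh0.
- by rewrite !bhB hg2 hs1 /= hf2 c12 bh0 subr0 subrr.
- by rewrite hx bh0 subr0.
Qed.

Section RingOverK.
Variables (K A : pzRingType) (iota : {rmorphism K -> A}).

Definition ring_bimod : bimod K A := lres iota (reg A).

Definition as_rhom (M N : bimod K A) (f : bihom M N) : bihom (as_rmod M) (as_rmod N) :=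
  @rhom A (as_rmod M) (as_rmod N) f (bhD f) (bhr f).

Variable M : bimod K K.
Local Notation MA := (tens M ring_bimod).
Local Notation mpure m a := (@tpure _ _ _ M ring_bimod m a).

Section Extension.
Variables (N : rmod A) (h : bihom (as_rmod M) (rres iota N)).

Lemma ext_bal : balanced (@ract _ _ M) (@lact _ _ ring_bimod) (fun m a => ract (h m : N) a).
Proof.
split=> [m m' a|m a a'|m k a].
- by rewrite (bhD h) [LHS]ractDl.
- exact: ractDr.
- by rewrite (bhr h) -[ract (h m) k]/(ract (h m : N) (iota k)) -ractA.
Qed.
Definition ext_fun (z : MA) : N := tlift (fun m a => ract (h m : N) a) z.
Lemma ext_funE m a : ext_fun (mpure m a) = ract (h m : N) a.
Proof. exact: (tliftE ext_bal). Qed.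
Lemma ext_funD x y : ext_fun (x + y) = ext_fun x + ext_fun y.
Proof. exact: (tliftD ext_bal). Qed.
Lemma ext_fun_r x a : ext_fun (ract x a) = ract (ext_fun x) a.
Proof.
elim/tpure_ind: x => [m b|x y IHx IHy]; first by rewrite tractE !ext_funE -ractA.
by rewrite ractDl !ext_funD IHx IHy ractDl.
Qed.
Definition ext_hom : bihom (as_rmod MA) N := @rhom A (as_rmod MA) N ext_fun ext_funD ext_fun_r.
End Extension.

Section Restrict.
Variables (N : rmod A) (f : bihom (as_rmod MA) N).
Lemma restr_subproof : @is_bihom int K (as_rmod M) (rres iota N) (fun m => f (mpure m 1)).
Proof.
apply: rhom_subproof => [x y|x k].
  by rewrite tpureDl; apply: (bhD f).
rewrite [mpure _ _](@tpureM _ _ _ M ring_bimod).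
rewrite -[RHS](bhr f) -[ract _ _]/(@ract K A MA _ _) tractE; congr (f (mpure _ _)).
by rewrite /= mulr1 mul1r.
Qed.
Definition restr_hom : bihom (as_rmod M) (rres iota N) := Bihom restr_subproof.
Lemma rhom_ext (g : bihom (as_rmod MA) N) :
  (forall m, f (mpure m 1) = g (mpure m 1)) -> forall z, f z = g z.
Proof.
move=> h; apply: tensor_ext => [x y|x y|m a]; [exact: (bhD f)|exact: (bhD g)|].
rewrite -[a]mul1r -[mpure _ _]/(mpure m (ract (1 : ring_bimod) a)) -tractE.
by rewrite [LHS](bhr f) [RHS](bhr g) h.
Qed.
End Restrict.

(** Extension of scalars is left adjoint to restriction along [iota], and restriction preserves
    surjections. *)
Lemma tens_projective : projective (as_rmod M) -> projective (as_rmod MA).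
Proof.
move=> projM N N' g f gs.
have gK : @is_bihom int K (rres iota N) (rres iota N') g.
  by apply: rhom_subproof => [x y|x k]; [exact: (bhD g)|exact: (bhr g)].
have [h hh] := projM _ _ (Bihom gK) (restr_hom f) gs.
exists (ext_hom h); apply: (@rhom_ext _ (g ∘ ext_hom h) f) => m.
rewrite -[LHS]/(g (ext_fun h _)) ext_funE ract1; exact: (hh m).
Qed.

End RingOverK.

Lemma ring_bimod_projective (K A : pzRingType) (iota : {rmorphism K -> A}) :
  projective (as_rmod (ring_bimod iota)).
Proof.
move=> N N' g f gs; have [x hx] := gs (f (1 : A)).
have hD (a b : as_rmod (ring_bimod iota)) :
    ract x ((a : A) + b) = ract x (a : A) + ract x (b : A) by exact: ractDr.
exists (@rhom A (as_rmod (ring_bimod iota)) N (fun a => ract x (a : A)) hD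
  (fun a b => ractA x a b)).
move=> a /=; rewrite bhr hx -(bhr f); congr (f _); exact: mul1r.
Qed.

(** * The kernel of R (x) A -> V (x) A *)

Section QuotientAlgebra.
Variables (K : pzRingType) (V : bimod K K) (X : set (tring V)).
Local Notation T := (tring V).
Local Notation A := (qring X).

Definition qconst (k : K) : A := qclass X (tconst V k).
Fact qconst_zmod : zmod_morphism qconst.
Proof. by move=> a b; rewrite /qconst -qclassB (additiveB (@tconstD _ V)). Qed.
Fact qconst_monoid : monoid_morphism qconst.
Proof.
split=> [|a b]; first by rewrite /qconst tconst1.
by rewrite /qconst tconstM -[RHS]/(qmul _ _) qmulE.
Qed.
HB.instance Definition _ := GRing.isZmodMorphism.Build _ _ qconst qconst_zmod.
HB.instance Definition _ := GRing.isMonoidMorphism.Build _ _ qconst qconst_monoid.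

Lemma qclassM x y : qclass X (x * y) = qclass X x * qclass X y.
Proof. by rewrite -[RHS]/(qmul _ _) qmulE. Qed.
Lemma qclass_0 x : qclass X x = 0 <-> ideal X x.
Proof. exact: qpi_0. Qed.

Local Notation AK := (ring_bimod qconst).

Lemma qcl_subproof : @is_bihom K K (tring_bimod V) (rres qconst AK) (qclass X).
Proof.
split=> [x y|k x|x k]; first exact: qclassD.
  by rewrite tlactM qclassM.
by rewrite tractM qclassM.
Qed.
Definition qcl : bihom (tring_bimod V) (rres qconst AK) := Bihom qcl_subproof.

Variable M : bimod K K.
Local Notation MA := (tens M AK).
Local Notation MT := (tens M (tring_bimod V)).
Local Notation mpure m a := (@tpure _ _ _ M AK m a).
Local Notation tpure' m x := (@tpure _ _ _ M (tring_bimod V) m (x : T)).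

Definition qtens (z : MT) : MA := tmap (bid M) qcl z.
Lemma qtensE m x : qtens (tpure' m x) = mpure m (qclass X x).
Proof. exact: (tmapE (bid M) qcl). Qed.
Lemma qtensD x y : qtens (x + y) = qtens x + qtens y.
Proof. exact: (bhD (tmap (bid M) qcl)). Qed.
Lemma qtens_surj z : exists y, qtens y = z.
Proof.
elim/tpure_ind: z => [m a|x y [x' <-] [y' <-]]; last by exists (x' + y'); rewrite qtensD.
by have [x ->] := qclass_surj a; exists (tpure' m x); rewrite qtensE.
Qed.
Lemma qtens_ker z : qtens z = 0 ->
  span [set z : MT | exists m x, ideal X x /\ z = tpure' m x] z.
Proof.
have qs (a : rres qconst AK) : exists x, qcl x = a.
  by have [x ->] := qclass_surj (a : A); exists x.
move=> hz; apply: (span_mono _ (tens_ker_r qs hz)).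
by move=> y [m [x [/qclass_0 h ->]]]; exists m, x.
Qed.

End QuotientAlgebra.

Arguments qconst {K V} X k.

Section Algebra.
Variables (K : pzRingType) (V : bimod K K) (n : nat) (R : subbimod (tpow V n)).
Hypothesis n2 : (1 < n)%N.
Local Notation T := (tring V).
Local Notation X := (rel_set R).
Local Notation A := (alg R).
Local Notation RM := (sub_bimod R).
Local Notation AK := (ring_bimod (qconst X)).
Local Notation VA := (tens V AK).
Local Notation RA := (tens RM AK).
Local Notation RT := (tens RM (tring_bimod V)).
Local Notation vpure v a := (@tpure _ _ _ V AK v a).
Local Notation rpure r a := (@tpure _ _ _ RM AK r a).
Local Notation rtpure r x := (@tpure _ _ _ RM (tring_bimod V) r (x : T)).
Local Notation L := (ideal X).

Definition relt (r : RM) : T := rel_incl R r.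
Lemma relD r r' : relt (r + r') = relt r + relt r'. Proof. exact: (bhD (rel_incl R)). Qed.
Lemma rel_l k r : relt (lact k r) = tconst V k * relt r.
Proof. by rewrite /relt bhl tlactM. Qed.
Lemma rel_r r k : relt (ract r k) = relt r * tconst V k.
Proof. by rewrite /relt bhr tractM. Qed.
Lemma rel_gr r : tgr V n (relt r). Proof. by eexists. Qed.
Lemma rel0 r : relt r 0%N = 0. Proof. by apply: (rel_set0 n2); exists r. Qed.
Lemma rel_ideal r : L (relt r). Proof. by apply: ideal_gen; exists r. Qed.
Lemma rel_inj : injective relt.
Proof.
move=> r r' /(congr1 (fun z : T => z n)); rewrite [X in X = _](dinjE (val r)).
by rewrite [X in _ = X](dinjE (val r')); apply: val_inj.
Qed.

Definition V_ideal : set T := [set z | exists v x, L x /\ z = tg v * x].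
Definition rel_T : set T := [set z | exists r x, z = relt r * x].

(** In a product a r b a constant a is absorbed into r, and any other a starts with a factor from V.
    This one-sided form of the ideal, L = R T + V L, is what yields exactness at V (x) A. *)
Lemma ideal_decomp x : L x -> span (rel_T `|` V_ideal) x.
Proof.
elim=> {x} [x [r _ <-]||x y _ hx _ hy|a x Lx hx|x a _].
- by apply: span_gen; left; exists r, 1; rewrite mulr1.
- exact: smem0.
- exact: smemB.
- move: a; apply: (@tring_genl _ _ (preim_subgrp (fun u u' => mulrDl u u' x)
    (span (rel_T `|` V_ideal)))) => [k|v y] /=; last first.
    rewrite -mulrA; apply: span_gen; right; exists v, (y * x); split=> //.
    exact: ideal_l.
  elim: hx {Lx} => {x} [x [[r [y ->]]|[v [y [Ly ->]]]]||x y _ hx _ hy].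
  + by rewrite mulrA -rel_l; apply: span_gen; left; exists (lact k r), y.
  + by rewrite mulrA -tg_l; apply: span_gen; right; exists (lact k v), y.
  + by rewrite mulr0; apply: span_zero.
  + by rewrite mulrBr; apply: span_sub.
- move=> hx; elim: hx => {x} [x [[r [y ->]]|[v [y [Ly ->]]]]||x y _ hx _ hy].
  + by rewrite -mulrA; apply: span_gen; left; exists r, (y * a).
  + rewrite -mulrA; apply: span_gen; right; exists v, (y * a); split=> //.
    exact: ideal_r.
  + by rewrite mul0r; apply: smem0.
  + by rewrite mulrBl; apply: smemB.
Qed.

Lemma ideal_tcomp m x : L x -> L (tcomp m x).
Proof.
move=> hx; elim: hx m => {x} [x [r _ <-]||x y _ hx _ hy|a x _ hx|x a _ hx] m.
- have [e|ne] := eqVneq n m; first by rewrite -e (tgrP _ _).1; [exact: rel_ideal|exact: rel_gr].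
  by rewrite (tgr_compN (rel_gr r)); [exact: smem0|exact/eqP].
- by rewrite tcomp0; apply: smem0.
- by rewrite (additiveB (tcompD m)); apply: smemB.
- move: a.
  have fD a b : tcomp m ((a + b) * x) = tcomp m (a * x) + tcomp m (b * x).
    by rewrite mulrDl tcompD.
  apply: (@tring_homog _ _ (preim_subgrp fD L)) => i a ha /=.
  have [lt|le] := ltnP m i; first by rewrite (tcomp_mull_lt _ ha lt); apply: ideal_zero.
  by rewrite -(subnKC le) (tcomp_mull _ _ ha); apply/ideal_l/hx.
- move: a.
  have fD a b : tcomp m (x * (a + b)) = tcomp m (x * a) + tcomp m (x * b).
    by rewrite mulrDr tcompD.
  apply: (@tring_homog _ _ (preim_subgrp fD L)) => i a ha /=.
  have [lt|le] := ltnP m i; first by rewrite (tcomp_mulr_lt _ ha lt); apply: ideal_zero.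
  by rewrite -(subnK le) (tcomp_mulr _ _ ha); apply/ideal_r/hx.
Qed.

Lemma V_ideal_tcomp m x : span V_ideal x -> span V_ideal (tcomp m x).
Proof.
move: x; apply: (@span_map _ _ _ (tcompD m) V_ideal (span V_ideal)) => x [v [y [Ly ->]]].
case: m => [|m]; first by rewrite (tcomp_mull_lt _ (tgr_tg v)) //; apply: smem0.
rewrite -[m.+1]add1n (tcomp_mull _ _ (tgr_tg v)); apply: span_gen.
by exists v, (tcomp m y); split=> //; apply: ideal_tcomp.
Qed.

(* R (x) A -> V (x) A -> A, the start of a projective resolution of K. *)
Definition kappa1 : bihom VA AK.
Proof.
refine (@tens_hom _ _ _ V AK AK (fun v a => qclass X (tg v) * a) _).
split=> [v v' a|v a a'|v k a|k v a|v a b].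
- by rewrite tgD qclassD mulrDl.
- by rewrite mulrDr.
- by rewrite tg_r qclassM -mulrA.
- by rewrite tg_l qclassM -mulrA.
- exact: mulrA.
Defined.
Lemma kappa1E v a : kappa1 (vpure v a) = qclass X (tg v) * a.
Proof. exact: tens_homE. Qed.

Definition qlam (x : T) : VA := qtens X (lam V x).
Lemma qlamD x y : qlam (x + y) = qlam x + qlam y.
Proof. by rewrite /qlam (bhD (lam V)) qtensD. Qed.
Lemma qlam_mul (x y : T) : x 0%N = 0 -> qlam (x * y) = ract (qlam x) (qclass X y).
Proof.
move=> x0; rewrite /qlam lamM //; elim/tpure_ind: (lam V x) => [v z|z z' IH IH'].
  by rewrite vt_mulE !qtensE tractE qclassM.
by rewrite vt_mulD !qtensD ractDl IH IH'.
Qed.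
Lemma qlam_l k x : qlam (tconst V k * x) = lact k (qlam x).
Proof.
rewrite /qlam -[tconst V k * x]tlactM (bhl (lam V)).
exact: (bhl (tmap (bid V) (qcl X))).
Qed.
Lemma qlam_tg v x : qlam (tg v * x) = vpure v (qclass X x).
Proof. by rewrite /qlam lam_tg qtensE. Qed.

Definition kappa2 : bihom RA VA.
Proof.
refine (@tens_hom _ _ _ RM AK VA (fun r a => ract (qlam (relt r)) a) _).
split=> [r r' a|r a a'|r k a|k r a|r a b].
- by rewrite relD qlamD ractDl.
- by rewrite ractDr.
- by rewrite rel_r qlam_mul ?rel0 // -ractA.
- by rewrite rel_l qlam_l lract.
- exact: ractA.
Defined.
Lemma kappa2E r a : kappa2 (rpure r a) = ract (qlam (relt r)) a.
Proof. exact: tens_homE. Qed.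

Definition rmult (y : RT) : T := tmult V (tmap (rel_incl R) (bid (tring_bimod V)) y).
Lemma rmultD x y : rmult (x + y) = rmult x + rmult y.
Proof. by rewrite /rmult !bhD. Qed.
Lemma rmultE r x : rmult (rtpure r x) = relt r * x.
Proof. by rewrite /rmult tmapE [LHS]tens_homE. Qed.

Lemma kappa2_qtens y : kappa2 (qtens X y) = qlam (rmult y).
Proof.
elim/tpure_ind: y => [r x|x y hx hy].
  by rewrite qtensE kappa2E rmultE qlam_mul ?rel0.
by rewrite qtensD bhD rmultD qlamD hx hy.
Qed.
Lemma kappa1_qtens z : kappa1 (qtens X z) = qclass X (vt_mult V z).
Proof.
elim/tpure_ind: z => [v x|x y hx hy].
  by rewrite qtensE kappa1E vt_multE qclassM.
by rewrite qtensD !bhD qclassD hx hy.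
Qed.

Lemma kappa12 z : kappa1 (kappa2 z) = 0.
Proof.
have [y <-] := qtens_surj z; rewrite kappa2_qtens kappa1_qtens mult_lam.
apply/qclass_0; elim/tpure_ind: y => [r x|x y hx hy].
  rewrite rmultE taug_subproof rel0 mul0r (additive0 (@tconstD _ V)) subr0.
  exact/ideal_r/rel_ideal.
by rewrite rmultD dsumDE tconstD opprD addrACA; apply: (smemD hx hy).
Qed.

(** Lift to V (x) T: the product lies in L = R T + V L, and [qlam] sends R T into the image of
    [kappa2] and V L to 0. *)
Lemma kappa_exact z : kappa1 z = 0 -> exists y, kappa2 y = z.
Proof.
have [z' <-] := qtens_surj z; rewrite kappa1_qtens => /qclass_0/ideal_decomp.
rewrite -[in qtens X z'](lam_mult z') -/(qlam _); move: (vt_mult V z') => x.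
elim=> {x} [x [[r [y ->]]|[v [y [/qclass_0 e ->]]]]||x y _ [u hu] _ [w hw]].
- by exists (rpure r (qclass X y)); rewrite kappa2E qlam_mul ?rel0.
- by exists 0; rewrite bh0 qlam_tg e (additive0 (tpureDr v)).
- by exists 0; rewrite bh0 (additive0 qlamD).
- by exists (u - w); rewrite bhB hu hw (additiveB qlamD).
Qed.

Lemma kappa_exact0 a : qaug (rel_set0 n2) a = 0 -> exists y, kappa1 y = a.
Proof.
have [x ->] := qclass_surj a; rewrite qaugE => x0; exists (qlam x).
by rewrite kappa1_qtens mult_lam x0 (additive0 (@tconstD _ V)) subr0.
Qed.

Lemma qaug_kappa1 z : qaug (rel_set0 n2) (kappa1 z) = 0.
Proof.
elim/tpure_ind: z => [v a|x y hx hy]; last by rewrite bhD raddfD /= hx hy addr0.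
by rewrite kappa1E; have [x ->] := qclass_surj a; rewrite -qclassM qaugE taug_subproof tg0 mul0r.
Qed.

Lemma qlam_ker (x : T) : x 0%N = 0 -> qlam x = 0 -> span V_ideal x.
Proof.
move=> x0 /qtens_ker h.
have -> : x = vt_mult V (lam V x) by rewrite mult_lam x0 (additive0 (@tconstD _ V)) subr0.
apply: (span_map (bhD (vt_mult V)) _ h) => z [v [y [Ly ->]]].
by rewrite vt_multE; apply: span_gen; exists v, y.
Qed.
Lemma qlam_V_ideal x : span V_ideal x -> qlam x = 0.
Proof.
elim=> {x} [x [v [y [/qclass_0 e ->]]]||x y _ hx _ hy].
- by rewrite qlam_tg e (additive0 (tpureDr v)).
- exact: (additive0 qlamD).
- by rewrite (additiveB qlamD) hx hy subrr.
Qed.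
Lemma rmult0 y : rmult y 0%N = 0.
Proof.
elim/tpure_ind: y => [r x|x y hx hy]; first by rewrite rmultE taug_subproof rel0 mul0r.
by rewrite rmultD dsumDE hx hy addr0.
Qed.
(** Among elements without constant term [qlam] vanishes exactly on V L. The kernel is thereby
    described inside T, where homogeneous components are at hand. *)
Lemma kappa2_ker y : kappa2 (qtens X y) = 0 <-> span V_ideal (rmult y).
Proof.
rewrite kappa2_qtens; split=> [|/qlam_V_ideal] //.
exact: (qlam_ker (rmult0 y)).
Qed.

End Algebra.

(** * Comparison with the given resolution *)

Section TorAnalysis.
Variables (K : pzRingType) (V : bimod K K) (n : nat) (R : subbimod (tpow V n)).
Hypothesis n2 : (1 < n)%N.
Local Notation T := (tring V).
Local Notation X := (rel_set R).
Local Notation A := (alg R).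
Local Notation RM := (sub_bimod R).
Local Notation AK := (ring_bimod (qconst X)).
Local Notation VA := (tens V AK).
Local Notation RA := (tens RM AK).
Local Notation RT := (tens RM (tring_bimod V)).
Local Notation vpure v a := (@tpure _ _ _ V AK v (a : A)).
Local Notation rpure r a := (@tpure _ _ _ RM AK r (a : A)).
Local Notation rtpure r x := (@tpure _ _ _ RM (tring_bimod V) r (x : T)).
Local Notation L := (ideal X).
Local Notation N' := (as_lmod (ground R n2)).
Local Notation aug := (qaug (rel_set0 n2)).

Lemma aug_const k : aug (qconst X k) = k.
Proof. by rewrite /qconst qaugE tconst0E. Qed.

Lemma augB (a b : A) : aug (a - b) = aug a - aug b. Proof. exact: raddfB. Qed.
Lemma augM (a b : A) : aug (a * b) = aug a * aug b. Proof. exact: rmorphM. Qed.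

Definition aug_part (Q : rmod A) : set Q := [set z | exists x a, aug a = 0 /\ z = ract x a].

Section OneModule.
Variable Q : rmod A.
Local Notation npure q k := (@tpure _ _ _ Q N' q (k : K)).

Lemma npure1 q k : npure q k = npure (ract q (qconst X k)) 1.
Proof. by rewrite tpureM; congr (npure q _); rewrite /= mulr1 aug_const. Qed.

Lemma tens_ground_surj (z : tens Q N') : exists q, z = npure q 1.
Proof.
elim/tpure_ind: z => [q k|x y [q ->] [q' ->]]; first by eexists; apply: npure1.
by exists (q + q'); rewrite tpureDl.
Qed.

(** The assignment q (x) k -> q k is balanced modulo Q A_+, because [a] and its augmentation act
    alike on the ground ring; it undoes q -> q (x) 1. *)
Lemma tens_ground_ker q : npure q 1 = 0 -> span (@aug_part Q) q.
Proof.
move=> h; pose F (q : Q) (k : N') := qpi (span (@aug_part Q)) (ract q (qconst X (k : K))).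
have Fb : balanced (@ract _ _ Q) (@lact _ _ N') F.
  split=> [x y k|x k k'|x a k]; rewrite /F.
  - by rewrite ractDl qpiD.
  - by rewrite -qpiD -ractDr -raddfD.
  - rewrite -ractA; apply/qpi_eq; rewrite -[- ract _ _]/(- ract x _).
    rewrite -(additiveB (ractDr x)); apply: span_gen.
    exists x, (a * qconst X (k : K) - qconst X (aug a * (k : K))); split=> //.
    by rewrite augB augM !aug_const subrr.
apply/qpi_0; rewrite -[q]ract1 -[1](rmorph1 (qconst X)).
have := congr1 (tlift F) h; rewrite (additive0 (tliftD Fb)) (tliftE Fb); exact.
Qed.
End OneModule.
Arguments aug_part Q : clear implicits.

Hypothesis V_proj : projective (as_rmod V).
Hypothesis R_proj : projective (as_rmod RM).
Variable res : gr_proj_resolution (alg_gr R) (deg0_gr (as_rmod (ground R n2))).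

(** M (x) A carries no grading here; its degrees are prescribed on the generators x (x) 1. A lift
    over K need not respect them, but its component of degree [m] still lifts [f], since [d]
    preserves degrees. *)
Lemma graded_lift (M : bimod K K) (projM : projective (as_rmod M)) (Q Q' : rmod A)
    Qgr Qgr' (hQ : is_graded_rmod (alg_gr R) Qgr)
    (hQ' : is_graded_rmod (alg_gr R) Qgr') (d : bihom Q Q')
    (f : bihom (as_rmod (tens M AK)) Q') m :
  (forall i x, Qgr i x -> Qgr' i (d x)) ->
  (forall x, Qgr' m (f (@tpure _ _ _ M AK x (1 : A)))) ->
  (forall x, exists y, d y = f (@tpure _ _ _ M AK x (1 : A))) ->
  exists g : bihom (as_rmod (tens M AK)) Q,
    (forall z, d (g z) = f z) /\ forall x, Qgr m (g (@tpure _ _ _ M AK x (1 : A))).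
Proof.
move=> dgr fgr fd.
have dK : @is_bihom int K (rres (qconst X) Q) (rres (qconst X) Q') d.
  by apply: rhom_subproof => [x y|x k]; [exact: (bhD d)|exact: (bhr d)].
have [h hh] := proj_lift (g := Bihom dK) (f := restr_hom f) projM fd.
have gr0 k : alg_gr R 0 (qconst X k) by exists (tconst V k) => //; apply: tgr_const.
have hgD x y : gcomp hQ.1 m (h (x + y)) = gcomp hQ.1 m (h x) + gcomp hQ.1 m (h y).
  by rewrite (bhD h) gcompD.
have hgr x k : gcomp hQ.1 m (h (ract x k)) = ract (gcomp hQ.1 m (h x)) (qconst X k).
  rewrite -(gcomp_ract hQ m _ (gr0 k)) addn0; congr gcomp; exact: (bhr h).
pose h' := @rhom K (as_rmod M) (rres (qconst X) Q) (fun x => gcomp hQ.1 m (h x)) hgD hgr.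
have gE x : ext_hom h' (@tpure _ _ _ M AK x (1 : A)) = gcomp hQ.1 m (h x).
  by rewrite -[LHS]/(ext_fun h' _) ext_funE ract1.
exists (ext_hom h'); split=> [|x]; last by rewrite gE; apply: gcomp_gr.
apply: (@rhom_ext _ _ _ _ _ (d ∘ ext_hom h') f) => x.
rewrite -[LHS]/(d (ext_hom h' _)) gE -(gcomp_map hQ.1 hQ'.1 m _ (bhD d) dgr).
by rewrite -[d (h x)]/(Bihom dK (h x)) hh (gcomp_id hQ'.1) //; apply: fgr.
Qed.

Lemma ground_cover_subproof : (forall a b, aug (a * b) = ract (aug a : as_rmod (ground R n2)) b).
Proof. exact: augM. Qed.

Definition ground_cover : bihom (as_rmod AK) (as_rmod (ground R n2)) :=
  @rhom A (as_rmod AK) (as_rmod (ground R n2)) aug (fun a b => raddfD aug a b)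
    ground_cover_subproof.

Local Notation Qgr i := (@rs_gr _ _ _ _ res i).

Lemma comparison_res : exists (f : bihom (as_rmod RA) (res 2)) (g : bihom (res 2) (as_rmod RA))
    (s : bihom (as_rmod RA) (as_rmod RA)),
  [/\ forall r, Qgr 2 n (f (rpure r 1)),
      forall z, kappa2 R n2 z = 0 -> rs_d res 1 (f z) = 0,
      forall x, kappa2 R n2 (g (rs_d res 2 x)) = 0,
      forall z, kappa2 R n2 (s z) = 0
    & forall z, kappa2 R n2 z = 0 -> g (f z) - z = s z].
Proof.
have grQ i := rs_graded res i.
(* Any preimage of 1 may be replaced by its component of degree 0: the ground ring sits in degree 0,
   so the other components map to 0. *)
have [x0 x0gr x0aug] : exists2 x, Qgr 0 0 x & rs_aug res x = (1 : K).
  have [x hx] := rs_aug_surj res (1 : K).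
  exists (gcomp (grQ 0%N).1 0 x); first exact: gcomp_gr.
  have [N hN] := gcomp_sum (grQ 0%N).1 x.
  rewrite -hx {2}(hN N.+1) // bh_sum big_ord_recl [X in _ + X]big1 ?addr0 // => i _.
  exact: (rs_aug_gr (gcomp_gr (grQ 0%N).1 (fintype.lift ord0 i) x)).
have f0D (a b : as_rmod AK) : ract x0 ((a : A) + b) = ract x0 (a : A) + ract x0 (b : A).
  exact: ractDr.
pose f0 := @rhom A (as_rmod AK) (res 0%N) (fun a => ract x0 (a : A)) f0D
  (fun a b => ractA x0 a b).
have hf0 a : rs_aug res (f0 a) = ground_cover a.
  by rewrite /= bhr x0aug; apply: mul1r.
pose c1 := as_rhom (kappa1 R); pose c2 := as_rhom (kappa2 R n2).
have k1 v : kappa1 R (vpure v 1) = qclass X (tg v) by rewrite kappa1E mulr1.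
have [|v|v|f1 [hf1 f1gr]] := @graded_lift V V_proj _ _ _ _ (grQ 1%N) (grQ 0%N)
  (rs_d res 0) (f0 ∘ c1) 1.
- exact: rs_d_gr.
- rewrite -[(_ ∘ _) _]/(ract x0 (kappa1 R (vpure v 1))) k1 -[1%N]add0n; apply: (grQ 0%N).2 => //.
  by exists (tg v) => //; apply: tgr_tg.
- by apply/rs_exact0; rewrite -[(_ ∘ _) _]/(f0 (kappa1 R _)) hf0; apply: qaug_kappa1.
(* This places the image of each relation in degree [n], as [graded_lift] requires for [f2]. *)
have f1_gr m x : tgr V m x -> Qgr 1 m (f1 (qlam R x)).
  case: m => [|m].
    move=> [k ->]; rewrite /qlam lam_const (additive0 (@qtensD _ _ X V)) (bh0 f1).
    exact: (gr_0 (grQ 1%N).1).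
  have f1D y z : f1 (qlam R (y + z)) = f1 (qlam R y) + f1 (qlam R z).
    by rewrite qlamD; apply: (bhD f1).
  pose H := Subgrp (gr_0 (grQ 1%N).1 m.+1) (@gr_B _ _ (grQ 1%N).1 m.+1).
  move: x; apply: (@tgr_genl _ _ m (preim_subgrp f1D H)) => {}x v hx /=.
  rewrite qlam_tg -[qclass X x]mul1r -[vpure _ _]/(vpure v (ract (1 : AK) (qclass X x))).
  rewrite -tractE [f1 _](bhr f1) -[m.+1]add1n; apply: (grQ 1%N).2 => //.
  by exists x.
have k2 r : kappa2 R n2 (rpure r 1) = qlam R (relt r) by rewrite kappa2E ract1.
have [|r|r|f2 [hf2 f2gr]] := @graded_lift RM R_proj _ _ _ _ (grQ 2) (grQ 1%N)
  (rs_d res 1) (f1 ∘ c2) n.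
- exact: rs_d_gr.
- by rewrite -[(_ ∘ _) _]/(f1 (kappa2 R n2 _)) k2; apply/f1_gr/rel_gr.
- apply/rs_exact; rewrite -[(_ ∘ _) _]/(f1 (kappa2 R n2 _)) hf1.
  by rewrite -[(_ ∘ _) _]/(f0 (kappa1 R (kappa2 R n2 _))) kappa12 (bh0 f0).
have := @comparison A _ _ _ _ _ _ _ _ ground_cover c1 c2 (rs_aug res) (rs_d res 0)
  (rs_d res 1) (rs_d res 2) f0 f1 f2.
case=> //.
- exact: ring_bimod_projective.
- exact: tens_projective.
- exact: rs_projective.
- exact: rs_projective.
- exact: rs_projective.
- by move=> k; exists (qconst X k); apply: aug_const.
- by move=> a; apply: kappa_exact0.
- by move=> a; apply: kappa_exact.
- by move=> z; apply: qaug_kappa1.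
- by move=> z; apply: kappa12.
- by move=> z; apply/rs_exact0; exists z.
- by move=> z; apply/rs_exact; exists z.
- by move=> z; apply/rs_exact; exists z.
move=> g [s [h1 h2 h3]]; exists f2, g, s; split=> // z hz.
by rewrite hf2 -[(_ ∘ _) _]/(f1 (kappa2 R n2 _)) hz (bh0 f1).
Qed.

End TorAnalysis.

Arguments aug_part {K V n R} n2 Q.

Section KernelAnalysis.
Variables (K : pzRingType) (V : bimod K K) (n : nat) (R : subbimod (tpow V n)).
Hypothesis n2 : (1 < n)%N.
Local Notation T := (tring V).
Local Notation X := (rel_set R).
Local Notation A := (alg R).
Local Notation RM := (sub_bimod R).
Local Notation AK := (ring_bimod (qconst X)).
Local Notation RA := (tens RM AK).
Local Notation RT := (tens RM (tring_bimod V)).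
Local Notation rpure r a := (@tpure _ _ _ RM AK r (a : A)).
Local Notation rtpure r x := (@tpure _ _ _ RM (tring_bimod V) r (x : T)).
Local Notation L := (ideal X).
Local Notation N' := (as_lmod (ground R n2)).
Local Notation aug := (qaug (rel_set0 n2)).
Local Notation npure Q q k := (@tpure _ _ _ (Q : rmod A) N' q (k : K)).

Hypothesis V_proj : projective (as_rmod V).
Hypothesis R_proj : projective (as_rmod RM).
Variable res : gr_proj_resolution (alg_gr R) (deg0_gr (as_rmod (ground R n2))).
Local Notation Qgr i := (@rs_gr _ _ _ _ res i).

Lemma tgr_eval0 k (x : T) : (0 < k)%N -> tgr V k x -> x 0%N = 0.
Proof. by move=> k0 [u ->]; rewrite [LHS]dinjN // => e; rewrite e in k0. Qed.

Definition ker_aug : set RA :=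
  [set z | exists w a, [/\ kappa2 R n2 w = 0, aug a = 0 & z = ract w a]].

Lemma aug_tcomp (x : T) i : x 0%N = 0 -> aug (qclass X (tcomp i x)) = 0.
Proof.
move=> x0; rewrite qaugE; case: i => [|i]; [exact: (etrans (dinjE _) x0)|].
by rewrite /tcomp [LHS]dinjN.
Qed.

(* A cycle of the resolution lifting a kernel element of degree [n + k] splits
   off its part of degree [n + 1], up to boundaries and decomposable elements;
   for [k <> 1] the former disappears when passing to degree [n + k]. *)
Lemma kernel_decomposable k y : (0 < k)%N ->
  Tor res N' 3 = [set 0] \/ (Tor res N' 3 = Tor_gr res N' 3 n.+1 /\ k <> 1%N) ->
  vt_gr k y -> kappa2 R n2 (qtens X y) = 0 -> span ker_aug (qtens X y).
Proof.
move=> k0 tor ygr yker.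
have [f [g [s [fgr fker gker sker gfs]]]] := comparison_res V_proj R_proj res.
have grQ i := rs_graded res i.
set z := qtens X y in yker *.
have rp r x : rpure r (qclass X x) = ract (rpure r 1) (qclass X x).
  by rewrite tractE; congr (rpure r _); rewrite /= mul1r.
(* As [k] is positive, the second factors lie in A_+. *)
have zaug : span (aug_part n2 (as_rmod RA)) z.
  apply: (span_map (@qtensD _ _ X RM) _ ygr) => _ [r [x [hx ->]]].
  rewrite qtensE rp; apply: span_gen; exists (rpure r 1), (qclass X x); split=> //.
  by rewrite qaugE (tgr_eval0 k0 hx).
have fz_gr : Qgr 2 (n + k) (f z).
  pose H := Subgrp (gr_0 (grQ 2).1 (n + k)) (@gr_B _ _ (grQ 2).1 (n + k)).
  have fqD u v : f (qtens X (u + v)) = f (qtens X u) + f (qtens X v).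
    by rewrite qtensD; apply: (bhD f).
  apply: (@span_map _ _ _ fqD _ H _ _ ygr) => _ [r [x [hx ->]]] /=.
  rewrite qtensE rp [f _](bhr f); apply: (grQ 2).2; first exact: fgr.
  by exists x.
have [q hq] := (@rs_exact _ _ _ _ res 1 _).1 (fker _ yker).
have augpure (Q : rmod A) u : span (aug_part n2 Q) u -> npure Q u 1 = 0.
  apply: (@span_least _ _ (eq_subgrp (fun a b => @tpureDl _ _ _ Q N' a b (1 : K))
    (fun _ _ => esym (addr0 0)))) => _ [x [a [ha ->]]] /=.
  by rewrite tpureM [X in tpure _ X](_ : _ = 0) ?(additive0 (tpureDr x)) //= ha mul0r.
have fz_aug : span (aug_part n2 (res 2)) (f z).
  apply: (span_map (bhD f) _ zaug) => _ [w [a [ha ->]]].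
  by rewrite (bhr f); apply: span_gen; exists (f w), a.
(* [q] itself need not be a cycle, but its boundary [f z] lies in Q_2 A_+ and so vanishes after
   tensoring with the ground ring. *)
have qcycle : @cycle _ _ _ _ res N' 3 (npure (res 3) q 1).
  by rewrite -[@cycle _ _ _ _ _ _ _ _]/(chain_d res N' 2 _ = 0) [LHS]tmapE hq; apply: augpure.
(* The hypothesis on Tor_3 gives [q']: either 0, or homogeneous of degree n + 1. In the second case
   its boundary has degree n + 1, which differs from n + k. *)
have [q' q'gr qq'] : exists2 q', gcomp (grQ 2).1 (n + k) (rs_d res 2 q') = 0
    & boundary res N' 3 (npure (res 3) q 1 - npure (res 3) q' 1).
  have qTor : Tor res N' 3 (qpi _ (npure (res 3) q 1)) by exists (npure (res 3) q 1).
  case: tor => [e|[e k1]]; rewrite e in qTor.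
    exists 0; first by rewrite bh0 (additive0 (gcompD _ _)).
    by rewrite tpure0l subr0; apply/qpi_0.
  have [z0 [_ z0gr] ez0] := qTor.
  have [q' q'gr eq'] : exists2 q', Qgr 3 n.+1 q' & z0 = npure (res 3) q' 1.
    elim: z0gr => {z0 ez0} [z0 [x [l [hx ->]]]||z1 z2 _ [q1 h1 ->] _ [q2 h2 ->]].
    + exists (ract x (qconst X (l : K))); last exact: (@npure1 _ _ _ _ n2).
      rewrite -[n.+1]addn0; apply: (grQ 3).2 => //.
      by exists (tconst V (l : K)) => //; apply: tgr_const.
    + by exists 0; [exact: (gr_0 (grQ 3).1)|rewrite tpure0l].
    + exists (q1 - q2); first exact: (gr_B (grQ 3).1).
      by rewrite (additiveB (fun a b => @tpureDl _ _ _ (res 3) N' a b (1 : K))).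
  exists q'; last by rewrite -eq'; apply/qpi_eq.
  rewrite (gcomp_homog (grQ 2).1 _ (rs_d_gr q'gr)) -[n.+1]addn1 eqn_add2l.
  by case: eqP.
have [b _ eb] := qq'; have [q'' eq''] := tens_ground_surj b.
have : npure (res 3) (q - q' - rs_d res 3 q'') 1 = 0.
  have D := fun a b => @tpureDl _ _ _ (res 3) N' a b (1 : K).
  rewrite (additiveB D) (additiveB D) -eb eq''.
  by rewrite -[chain_d _ _ _ _]/(tmap _ _ _) tmapE subrr.
move=> /tens_ground_ker haug.
pose D : set (res 2) := [set u | exists x a, aug a = 0 /\ u = ract (rs_d res 2 x) a].
have hD : span D (rs_d res 2 q - rs_d res 2 q').
  have <- : rs_d res 2 (q - q' - rs_d res 3 q'') = rs_d res 2 q - rs_d res 2 q'.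
    by rewrite !bhB (@rs_exact _ _ _ _ res 2 (rs_d res 3 q'')).2 ?subr0 //; exists q''.
  apply: (span_map (bhD (rs_d res 2)) _ haug) => _ [x [a [ha ->]]].
  by rewrite bhr; apply: span_gen; exists x, a.
(* [f z] is homogeneous of degree n + k, so passing to that component removes the boundary of
   [q']. *)
have hD' : span D (f z).
  have -> : f z = gcomp (grQ 2).1 (n + k) (rs_d res 2 q - rs_d res 2 q').
    by rewrite (additiveB (gcompD _ _)) q'gr subr0 hq gcomp_id.
  apply: (@span_map _ _ _ (gcompD _ _) _ (span D) _ _ hD) => _ [x [a [ha ->]]].
  have [t et] := qclass_surj a; have t0 : t 0%N = 0 by move: ha; rewrite et qaugE.
  have [M /(_ M (leqnn M)) eM] := tgr_sum t.
  rewrite et eM (additive_sum (@qclassD _ X)) (additive_sum (ractDr _)) (additive_sum (gcompD _ _)).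
  apply: smem_sum => i _.
  have hi : alg_gr R i (qclass X (tcomp i t)) by exists (tcomp i t) => //; apply: tgr_comp.
  have [lt|le] := ltnP (n + k) i.
    by rewrite (gcomp_ract_lt _ _ hi lt); apply: smem0.
  rewrite -(subnK le) (gcomp_ract (grQ 2) _ _ hi).
  rewrite (gcomp_map (grQ 3).1 (grQ 2).1 _ _ (bhD (rs_d res 2)) (@rs_d_gr _ _ _ _ res 2)).
  by apply: span_gen; do 2!eexists; split; last reflexivity; apply: aug_tcomp.
(* Both [g] after the boundary and [s] take values in the kernel of [kappa2]; the factors from A_+
   in [hD'] and [zaug] make the two terms decomposable. *)
have -> : z = g (f z) - s z by rewrite -gfs // opprB addrC subrK.
apply: smemB.
  apply: (span_map (bhD g) _ hD') => _ [x [a [ha ->]]].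
  by rewrite (bhr g); apply: span_gen; exists (g (rs_d res 2 x)), a.
apply: (span_map (bhD s) _ zaug) => _ [w [a [ha ->]]].
by rewrite (bhr s); apply: span_gen; exists (s w), a.
Qed.

End KernelAnalysis.

(** * Generators of the kernel, degree by degree *)

Section KernelGenerators.
Variables (K : pzRingType) (V : bimod K K) (n : nat) (R : subbimod (tpow V n)).
Hypothesis n2 : (1 < n)%N.
Local Notation T := (tring V).
Local Notation X := (rel_set R).
Local Notation RM := (sub_bimod R).
Local Notation RT := (tens RM (tring_bimod V)).
Local Notation rtpure r x := (@tpure _ _ _ RM (tring_bimod V) r (x : T)).
Local Notation L := (ideal X).
Local Notation N' := (as_lmod (ground R n2)).

Definition ideal_gens k : set T := [set z | exists a (r : RM) b i j,
  [/\ tgr V i a, tgr V j b, (i + n + j = k)%N & z = a * relt r * b]].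

Lemma ideal_gensP k x : L x -> span (ideal_gens k) (tcomp k x).
Proof.
have mull i k' a y : tgr V i a -> span (ideal_gens k') y -> span (ideal_gens (i + k')) (a * y).
  move=> ha; apply: (@span_map _ _ _ (mulrDr a) _ (span (ideal_gens (i + k')))).
  move=> _ [a' [r [b [i' [j [ha' hb <- ->]]]]]]; apply: span_gen.
  exists (a * a'), r, b, (i + i')%N, j; split=> //; last by rewrite !mulrA.
    exact: tgrM.
  by rewrite !addnA.
have mulr j k' b y : tgr V j b -> span (ideal_gens k') y -> span (ideal_gens (k' + j)) (y * b).
  move=> hb; apply: (@span_map _ _ _ (fun u v => mulrDl u v b) _ (span (ideal_gens (k' + j)))).
  move=> _ [a [r [b' [i [j' [ha hb' <- ->]]]]]]; apply: span_gen.
  exists a, r, (b' * b), i, (j' + j)%N; split=> //; last by rewrite !mulrA.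
    exact: tgrM.
  by rewrite !addnA.
move=> hx; elim: hx k => {x} [x [r _ <-]||x y _ hx _ hy|a x _ hx|x a _ hx] k.
- have [<-|ne] := eqVneq n k; last first.
    by rewrite (tgr_compN (rel_gr r)); [exact: smem0|exact/eqP].
  rewrite (tgrP _ _).1; last exact: rel_gr.
  apply: span_gen; exists 1, r, 1, 0%N, 0%N; rewrite mulr1 mul1r addn0.
  by split=> //; rewrite -tconst1; apply: tgr_const.
- by rewrite tcomp0; apply: smem0.
- by rewrite (additiveB (tcompD k)); apply: smemB.
- move: a.
  have fD a b : tcomp k ((a + b) * x) = tcomp k (a * x) + tcomp k (b * x).
    by rewrite mulrDl tcompD.
  apply: (@tring_homog _ _ (preim_subgrp fD (span (ideal_gens k)))) => i a ha /=.
  have [lt|le] := ltnP k i; first by rewrite (tcomp_mull_lt _ ha lt); apply: span_zero.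
  by rewrite -(subnKC le) (tcomp_mull _ _ ha); apply: mull.
- move: a.
  have fD a b : tcomp k (x * (a + b)) = tcomp k (x * a) + tcomp k (x * b).
    by rewrite mulrDr tcompD.
  apply: (@tring_homog _ _ (preim_subgrp fD (span (ideal_gens k)))) => i a ha /=.
  have [lt|le] := ltnP k i; first by rewrite (tcomp_mulr_lt _ ha lt); apply: span_zero.
  by rewrite -(subnK le) (tcomp_mulr _ _ ha); apply: mulr.
Qed.

Lemma ideal_rel_low k x : L x -> (k < n)%N -> tcomp k x = 0.
Proof.
move=> /(ideal_gensP k) h lt; elim: h => {x} [x [a [r [b [i [j [_ _ e _]]]]]]||x y _ -> _ ->].
- by move: lt; rewrite -e addnAC addnC ltnNge leq_addr.
- by [].
- exact: subrr.
Qed.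

Lemma ideal_rel_degn x : L x -> exists r : RM, tcomp n x = relt r :> T.
Proof.
move=> /(ideal_gensP n) h; elim: h => {x}
  [x [a [r [b [i [j [ha hb e ->]]]]]]||x y _ [r ->] _ [s ->]].
- have [i0 j0] : i = 0%N /\ j = 0%N.
    move/eqP: e; rewrite addnAC -[X in _ == X]add0n eqn_add2r addn_eq0.
    by move=> /andP[/eqP-> /eqP->].
  move: ha hb; rewrite i0 j0 => -[k ->] [l ->].
  by exists (ract (lact (k : K) r) (l : K)); rewrite rel_r rel_l.
- by exists 0; rewrite (additive0 (@relD _ _ _ R)).
- by exists (r - s); rewrite (additiveB (@relD _ _ _ R)).
Qed.

(* [C] tells whether the kernel elements of degree [n + 1] are allowed. *)
Variable C : Prop.
(** The first kind spans the part R (x) L_k of the kernel of R (x) T -> R (x) A; the second consists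
    of right multiples of the overlaps in X. *)
Definition ker_gen k : set RT := [set z |
  (exists r x, ideal_gens k x /\ z = rtpure r x) \/
  (exists u w x j, [/\ C, in_X u w, tgr V j x, k = j.+1
     & z = vt_mul (tmap (bid RM) (tgen V) w) x])].

Lemma ker_gen_mul i j y x : span (ker_gen i) y -> tgr V j x ->
  span (ker_gen (i + j)) (vt_mul y x).
Proof.
move=> hy hx; apply: (@span_map _ _ (fun z => vt_mul z x) (fun u v => vt_mulD u v x) _
  (span (ker_gen (i + j))) _ _ hy) => _ [[r [b [hb ->]]]|[u [w [b [j' [hC huw hb -> ->]]]]]].
  rewrite vt_mulE; apply: span_gen; left; exists r, (b * x); split=> //.
  case: hb => a [r' [c [k [l [ha hc <- ->]]]]].
  exists a, r', (c * x), k, (l + j)%N; split=> //; last by rewrite !mulrA.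
    exact: tgrM.
  by rewrite addnA.
rewrite vt_mulA; apply: span_gen; right; exists u, w, (b * x), (j' + j)%N.
by split=> //; apply: tgrM.
Qed.

Hypothesis V_proj : projective (as_rmod V).
Hypothesis R_proj : projective (as_rmod RM).
Variable res : gr_proj_resolution (alg_gr R) (deg0_gr (as_rmod (ground R n2))).

Lemma rmult_comp k (y : RT) : rmult (vt_comp k y) = tcomp (n + k) (rmult y) :> T.
Proof.
elim/tpure_ind: y => [r x|y z hy hz].
  by rewrite vt_compE !rmultE (tcomp_mull _ _ (rel_gr r)).
by rewrite vt_compD !rmultD tcompD hy hz.
Qed.

Lemma rmult_gr k (y : RT) : vt_gr k y -> tgr V (n + k) (rmult y).
Proof. by move=> /vt_comp_id <-; rewrite rmult_comp; apply: tgr_comp. Qed.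

(** V L vanishes in degree n because L does in degree n - 1, while [y] is some r (x) 1 and R embeds
    in T. *)
Lemma kernel_deg0 (y : RT) : vt_gr 0 y -> span (@V_ideal _ _ _ R) (rmult y) -> y = 0.
Proof.
move=> hy hV.
have [r er] : exists r, y = rtpure r 1.
  elim: hy {hV} => {y} [y [r [x [[k ->] ->]]]||y z _ [r ->] _ [s ->]].
  - exists (ract r (k : K)); rewrite tpureM; congr tpure.
    by rewrite tlactM mulr1.
  - by exists 0; rewrite tpure0l.
  - by exists (r - s); rewrite (additiveB (fun a b => @tpureDl _ _ _ RM (tring_bimod V) a b _)).
move: hV; rewrite er rmultE mulr1 => hV.
suff : relt r = 0 :> T.
  by rewrite -(additive0 (@relD _ _ _ R)) => /rel_inj ->; rewrite tpure0l.
rewrite -[relt r](tgrP n _).1; last exact: rel_gr.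
elim: hV => [_ [v [x [Lx ->]]]||x z _ hx _ hz].
- have en : (1 + n.-1 = n)%N by rewrite add1n prednK // ltnW.
  rewrite -{1}en (tcomp_mull _ _ (tgr_tg v)) (ideal_rel_low Lx) ?mulr0 //.
  by rewrite prednK // ltnW.
- exact: tcomp0.
- by rewrite (additiveB (tcompD n)) hx hz subrr.
Qed.

(** In degree n + 1 the group V L is V R, so an element of R (x) V whose product lies in V L is the
    second half of a pair in X. *)
Lemma kernel_deg1 (y : RT) : C -> vt_gr 1 y -> span (@V_ideal _ _ _ R) (rmult y) ->
  span (ker_gen 1) y.
Proof.
move=> hC hy hV.
have [w ew] : exists w, y = tmap (bid RM) (tgen V) w.
  elim: hy {hV} => {y} [y [r [x [hx ->]]]||y z _ [w ->] _ [w' ->]].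
  - have [v ->] : exists v, x = tg v :> T.
      case: hx => u ->; elim/tpure_ind: u => [k v|u u' [v e] [v' e']].
        by exists (lact (k : K) v); rewrite dinj_tpure tg_l.
      by exists (v + v'); rewrite bhD e e' tgD.
    by exists (tpure r v); rewrite tmapE.
  - by exists 0; rewrite bh0.
  - by exists (w - w'); rewrite bhB.
have [u eu] : exists u, tcomp (1 + n) (rmult y) = tmult V (tmap (tgen V) (rel_incl R) u) :> T.
  elim: hV {hy ew} => [_ [v [x [Lx ->]]]||x z _ [a ha] _ [b hb]].
  - rewrite (tcomp_mull _ _ (tgr_tg v)); have [r ->] := ideal_rel_degn Lx.
    by exists (tpure v r); rewrite tmapE [RHS]tens_homE.
  - by exists 0; rewrite tcomp0 !bh0.
  - by exists (a - b); rewrite (additiveB (tcompD _)) ha hb !bhB.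
apply: span_gen; right; exists u, w, 1, 0%N; split=> //.
- rewrite /in_X -eu addnC (tgrP _ _).1; last exact: rmult_gr.
  rewrite ew /rmult; congr (tmult V _).
  by elim/tpure_ind: w {ew} => [r v|w w' h h']; rewrite ?tmapE // !bhD h h'.
- by rewrite -tconst1; apply: tgr_const.
- by rewrite -tconst1 vt_mul_const ract1.
Qed.

Lemma ker_aug_lift z : span (@ker_aug _ _ _ R n2) z ->
  exists2 y, span [set y : RT | exists (w : RT) (x : T), [/\ span (@V_ideal _ _ _ R) (rmult w),
    x 0%N = 0 & y = vt_mul w x]] y & qtens X y = z.
Proof.
elim=> {z} [_ [w [a [hw ha ->]]]||x z _ [a ha <-] _ [b hb <-]].
- have [w' ew] := qtens_surj w; have [x ex] := qclass_surj a.
  exists (vt_mul w' x).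
    apply: span_gen; exists w', x; split=> //; last by move: ha; rewrite ex qaugE.
    by apply/(kappa2_ker n2); rewrite ew.
  rewrite -ew ex; elim/tpure_ind: (w') => [r t|u v hu hv].
    by rewrite vt_mulE !qtensE tractE qclassM.
  by rewrite vt_mulD !qtensD ractDl hu hv.
- by exists 0; [exact: smem0|rewrite (additive0 (@qtensD _ _ X RM))].
- by exists (a - b); [exact: smemB|rewrite (additiveB (@qtensD _ _ X RM))].
Qed.

(** Induction on the degree in place of Nakayama's lemma: modulo R (x) L, a kernel element is a sum
    of products w x with w in the kernel and x without constant term, so that the components of w
    involved have lower degree. *)
Lemma kernel_generators k (y : RT) :
  Tor res N' 3 = [set 0] \/ (Tor res N' 3 = Tor_gr res N' 3 n.+1 /\ C) ->
  vt_gr k y -> span (@V_ideal _ _ _ R) (rmult y) -> span (ker_gen k) y.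
Proof.
move=> tor; elim/ltn_ind: k y => k IH y hy hV.
have [k0|kn0] := posnP k.
  by rewrite k0 in hy *; rewrite (kernel_deg0 hy hV); apply: smem0.
(* In degree n + 1 the overlaps in X are used directly when [C] is available; in all remaining cases
   the kernel element is decomposable. *)
have [kC|tor'] : (k = 1%N /\ C) \/
    (Tor res N' 3 = [set 0] \/ (Tor res N' 3 = Tor_gr res N' 3 n.+1 /\ k <> 1%N)).
- case: tor => [h|[h hC]]; first by right; left.
  by have [->|/eqP k1] := eqVneq k 1%N; [left|right; right].
- by case: kC => k1 hC; rewrite k1 in hy *; apply: kernel_deg1.
have := kernel_decomposable V_proj R_proj kn0 tor' hy ((kappa2_ker n2 y).2 hV).
move=> /ker_aug_lift [y' hy' ey].
(* The difference dies in R (x) A, so it lies in R (x) L and is covered by generators of the first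
   kind. *)
have : qtens X (y - y') = 0 by rewrite (additiveB (@qtensD _ _ X RM)) ey subrr.
move=> /qtens_ker hyy'.
rewrite -(vt_comp_id hy) -[y](subrK y') vt_compD; apply: smemD.
  apply: (@span_map _ _ _ (vt_compD k) _ (span (ker_gen k)) _ _ hyy').
  move=> _ [r [x [Lx ->]]]; rewrite vt_compE.
  apply: (@span_map T _ (fun x => rtpure r x) (@tpureDr _ _ _ RM (tring_bimod V) r) (ideal_gens k)
    (span (ker_gen k)) _ (tcomp k x)).
    by move=> z hz; apply: span_gen; left; exists r, z.
  exact: ideal_gensP.
apply: (@span_map _ _ _ (vt_compD k) _ (span (ker_gen k)) _ _ hy').
move=> _ [w [x [hw x0 ->]]]; have [N /(_ N (leqnn N)) ->] := tgr_sum x.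
rewrite (additive_sum (vt_mulDr w)) (additive_sum (vt_compD k)); apply: smem_sum => j _.
have hj : tgr V j (tcomp j x) := tgr_comp j x.
have [lt|le] := ltnP k j; first by rewrite (vt_comp_mul_lt _ hj lt); apply: smem0.
rewrite -{2}(subnK le) (vt_comp_mul _ _ hj) -{1}(subnK le).
have [j0|jn0] := posnP j.
  rewrite j0 /tcomp x0 bh0 (additive0 (vt_mulDr _)); exact: smem0.
apply: ker_gen_mul hj; apply: IH (vt_comp_gr _ _) _.
  by rewrite ltn_subrL jn0.
by rewrite rmult_comp; apply: V_ideal_tcomp.
Qed.

End KernelGenerators.

(** * The tensor ring of V (x) S *)

Section TwistedRing.
Variables (K S : pzRingType) (eta : {rmorphism K -> S}) (V : bimod K K).
Variable t : twisting eta V.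
Local Notation T := (tring V).
Local Notation W := (tring (twV t)).
Local Notation Sr := (SKS eta).
Local Notation Sk := (SKK eta).
Local Notation B := (tens (tring_bimod V) Sr).
Local Notation bpure x s := (@tpure _ _ _ (tring_bimod V) Sr (x : T) (s : S)).
Implicit Types (x : T) (s : S) (v : V) (w : W).

Definition sc (s : S) : W := tconst (twV t) s.
Definition jt (x : T) : W := psi_tring t x.
Definition tv (v : V) : twV t := @tpure _ _ _ V Sr v 1.

Lemma scM s s' : sc (s * s') = sc s * sc s'. Proof. exact: tconstM. Qed.
Lemma sc1 : sc 1 = 1. Proof. by []. Qed.
Lemma scD s s' : sc (s + s') = sc s + sc s'. Proof. exact: tconstD. Qed.

Lemma psi_pure x s : psi t (bpure x s) = jt x * sc s :> W.
Proof. by rewrite [LHS]tens_homE; apply: tractM. Qed.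
Lemma jtE x : jt x = psi t (bpure x 1).
Proof. by rewrite psi_pure sc1 mulr1. Qed.
Lemma jtD x (y : T) : jt (x + y) = jt x + jt y.
Proof. by rewrite !jtE tpureDl (bhD (psi t)). Qed.
Lemma jt_in m (u : tpow V m) : jt (dinj (tpow V) m u) = dinj (tpow (twV t)) m (psi_pow t m u).
Proof.
apply: dsum_ext => i; rewrite /= /dinj_val.
by case: eqP => [e|_]; [case: i / e|exact: (bh0 (psi_pow t i))].
Qed.
Lemma jt_const k : jt (tconst V k) = sc (eta k).
Proof. exact: (jt_in (m := 0) k). Qed.
Lemma jt_mul_tg x v : jt (x * tg v) = jt x * tg (tv v).
Proof.
elim/dsum_ind: x => [m u|x y hx hy].
  rewrite -dinj_tpure !jt_in -dinj_tpure; congr (dinj _ _ _).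
  exact: (tens_homE (psiS_subproof (psi_pow t m)) u v).
by rewrite mulrDl !jtD mulrDl hx hy.
Qed.
Lemma jt1 : jt 1 = 1. Proof. by rewrite -tconst1 jt_const rmorph1. Qed.
Lemma jt_tg v : jt (tg v) = tg (tv v).
Proof. by rewrite -[tg v]mul1r jt_mul_tg jt1 mul1r. Qed.
Lemma jtM x (y : T) : jt (x * y) = jt x * jt y.
Proof.
move: y; apply: tring_eq => [y y'|y y'|k|y v h].
- by rewrite mulrDr jtD.
- by rewrite jtD mulrDr.
- rewrite jt_const -tractM jtE tpureM psi_pure; congr (_ * sc _).
  exact: mulr1.
- by rewrite mulrA !jt_mul_tg h mulrA.
Qed.

Lemma jt_tgr m x : tgr V m x -> tgr (twV t) m (jt x).
Proof. by move=> [u ->]; rewrite jt_in; eexists. Qed.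
Lemma jt_tcomp m x : tcomp m (jt x) = jt (tcomp m x).
Proof. by rewrite /tcomp jt_in. Qed.

Lemma tg_tpure v s : tg (@tpure _ _ _ V Sr v s : twV t) = jt (tg v) * sc s.
Proof.
rewrite jt_tg /sc -tg_r; congr tg.
by rewrite [RHS]tractE; congr tpure; rewrite /= mul1r.
Qed.
(** The left action on [twV t] is defined by the twisting, so this is the commutation rule that
    moves scalars to the right of V. *)
Lemma sc_tg s v : sc s * jt (tg v) = tg (t (@tpure _ _ _ Sk V s v) : twV t).
Proof.
rewrite jt_tg /sc -tg_l; congr tg.
by rewrite -[LHS]/(twlact t s _) twlactE ract1.
Qed.

Lemma tw_gr_gen m (H : subgrp W) :
  (forall x s, tgr V m x -> H (jt x * sc s)) -> forall w, tgr (twV t) m w -> H w.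
Proof.
pose X m := [set w : W | exists x s, tgr V m x /\ w = jt x * sc s].
suff h w : tgr (twV t) m w -> span (X m) w.
  by move=> hH w /h; apply: span_least => _ [x [s [hx ->]]]; apply: hH.
elim: m w => [|m IH] w.
  move=> [s ->]; apply: span_gen; exists 1, s; rewrite jt1 mul1r; split=> //.
  by rewrite -tconst1; apply: tgr_const.
move: w; apply: tgr_gen => w z /IH hw.
apply: (@span_map _ _ (fun w => w * tg z) (fun a b => mulrDl a b _) (X m) (span (X m.+1)) _ _ hw).
move=> _ [x [s [hx ->]]].
elim/tpure_ind: z => [v s'|z z' hz hz']; last by rewrite tgD mulrDr; apply: smemD.
rewrite tg_tpure mulrA -[_ * _ * jt _]mulrA sc_tg.
move: (t _) => z; elim/tpure_ind: z => [v' s''|z z' hz hz'].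
  rewrite -[tg _]/(tg (@tpure _ _ _ V Sr v' s'' : twV t)) tg_tpure mulrA -mulrA -jtM -scM.
  apply: span_gen; exists (x * tg v'), (s'' * s'); split=> //.
  by rewrite -[m.+1]addn1; apply: tgrM hx (tgr_tg _).
by rewrite [tg _](@tgD _ (twV t)) mulrDr mulrDl; apply: smemD.
Qed.
Lemma tw_gen (H : subgrp W) : (forall x s, H (jt x * sc s)) -> forall w, H w.
Proof. by move=> h; apply: tring_homog => m; apply: tw_gr_gen => x s _; apply: h. Qed.

Lemma psi_surj w : exists z, psi t z = w.
Proof.
have : img_subgrp (bhB (psi t)) (full_subgrp _) w.
  by apply: tw_gen => x s; exists (bpure x s); rewrite ?psi_pure.
by case=> z _ <-; exists z.
Qed.

(** The twisting fixes the unit of S, so scalars from K act as before; this is what makes [theta]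
    balanced. *)
Lemma twlact_eta k (z : tens V Sr) : twlact t (eta k) z = lact k z.
Proof.
elim/tpure_ind: z => [v s|z z' hz hz']; last by rewrite twlactD hz hz' lactDr.
rewrite twlactE tlactE.
have -> : @tpure _ _ _ Sk V (eta k) v = @tpure _ _ _ Sk V 1 (lact k v).
  by rewrite -tpureM; congr tpure; rewrite /= mul1r.
by rewrite tw_one [LHS]tractE; congr tpure; apply: mul1r.
Qed.

Section Theta.
Variable m : nat.
Local Notation Bm := (tens (tpow V m) Sr).
Lemma theta_bal (z : twV t) : balanced (@ract _ _ (tpow V m)) (@lact _ _ Sr)
  (fun u s => tassocV (tpow V m) V Sr (tpure u (twlact t s z : tens V Sr))).
Proof.
split=> [u u' s|u s s'|u k s].
- by rewrite tpureDl bhD.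
- by rewrite [twlact t _ _](@lactDl _ _ (twV t)) [X in tassocV _ _ _ X]tpureDr bhD.
- by rewrite tpureM -twlact_eta [twlact t _ z in RHS](@lactA _ _ (twV t)).
Qed.
(** One step of the inverse of psi: (T^m (x) S) (x)_S (V (x) S) -> T^{m+1} (x) S, where the scalar
    acts on the new factor. *)
Definition theta (y : Bm) (z : twV t) : tens (tpow V m.+1) Sr :=
  tlift (fun u s => tassocV (tpow V m) V Sr (tpure u (twlact t s z : tens V Sr))) y.
Lemma thetaE u s z :
  theta (@tpure _ _ _ (tpow V m) Sr u s) z =
  tassocV (tpow V m) V Sr (tpure u (twlact t s z : tens V Sr)).
Proof. exact: (tliftE (theta_bal z)). Qed.
Lemma thetaDl y y' z : theta (y + y') z = theta y z + theta y' z.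
Proof. exact: (tliftD (theta_bal z)). Qed.
Lemma thetaDr y z z' : theta y (z + z') = theta y z + theta y z'.
Proof.
elim/tpure_ind: y => [u s|y y' h h'].
  by rewrite !thetaE twlactD [X in tassocV _ _ _ X]tpureDr bhD.
by rewrite !thetaDl h h' addrACA.
Qed.
Lemma theta_mid y s z : theta (ract y s) z = theta y (lact s z).
Proof.
elim/tpure_ind: y => [u s'|y y' h h'].
  by rewrite tractE !thetaE -[twlact t s' _](@lactA _ _ (twV t)).
by rewrite ractDl !thetaDl h h'.
Qed.
Lemma theta_r y z s : theta y (ract z s) = ract (theta y z) s.
Proof.
elim/tpure_ind: y => [u s'|y y' h h'].
  by rewrite !thetaE -bhr tractE -twlact_r.
by rewrite !thetaDl h h' ractDl.
Qed.
End Theta.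

Lemma phi0_D s s' : @tpure _ _ _ (reg K) Sr 1 (s + s') =
  @tpure _ _ _ (reg K) Sr 1 s + @tpure _ _ _ (reg K) Sr 1 s'.
Proof. exact: tpureDr. Qed.
Lemma phi0_r s s' : @tpure _ _ _ (reg K) Sr 1 (s * s') =
  ract (@tpure _ _ _ (reg K) Sr 1 s) s'.
Proof. by rewrite tractE. Qed.

Section PhiStep.
Variables (m : nat) (f : bihom (as_rmod (tpow (twV t) m)) (as_rmod (tens (tpow V m) Sr))).
Lemma phi_bal : balanced (@ract _ _ (tpow (twV t) m)) (@lact _ _ (twV t))
  (fun u z => theta (f u) z).
Proof.
split=> [u u' z|u z z'|u s z]; first by rewrite (bhD f) thetaDl.
  by rewrite thetaDr.
by rewrite (bhr f) -theta_mid.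
Qed.
Definition phi_fun (y : tpow (twV t) m.+1) : tens (tpow V m.+1) Sr :=
  tlift (fun u z => theta (f u) z) y.
Lemma phi_funE u z : phi_fun (tpure u z) = theta (f u) z.
Proof. exact: (tliftE phi_bal). Qed.
Lemma phi_funD y y' : phi_fun (y + y') = phi_fun y + phi_fun y'.
Proof. exact: (tliftD phi_bal). Qed.
Lemma phi_fun_r y s : phi_fun (ract y s) = ract (phi_fun y) s.
Proof.
elim/tpure_ind: y => [u z|y y' h h'].
  by rewrite tractE !phi_funE theta_r.
by rewrite ractDl !phi_funD h h' ractDl.
Qed.
End PhiStep.

Fixpoint phi_pow m : bihom (as_rmod (tpow (twV t) m)) (as_rmod (tens (tpow V m) Sr)) :=
  match m return bihom (as_rmod (tpow (twV t) m)) (as_rmod (tens (tpow V m) Sr)) with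
  | 0 => @rhom S (as_rmod (reg S)) (as_rmod (tens (reg K) Sr))
           (fun s => @tpure _ _ _ (reg K) Sr 1 (s : S)) phi0_D phi0_r
  | m'.+1 => @rhom S (as_rmod (tpow (twV t) m'.+1)) (as_rmod (tens (tpow V m'.+1) Sr))
           _ (phi_funD (phi_pow m')) (phi_fun_r (phi_pow m'))
  end.

Lemma phi_psi_pow m (u : tpow V m) s :
  phi_pow m (ract (psi_pow t m u : tpow (twV t) m) s) = @tpure _ _ _ (tpow V m) Sr u s.
Proof.
elim: m u s => [|m IH] u s.
  rewrite -[LHS]/(@tpure _ _ _ (reg K) Sr 1 (lact (u : K) (s : Sr))) -tpureM.
  by congr tpure; apply: mul1r.
elim/tpure_ind: u => [u v|u u' h h']; last first.
  by rewrite (bhD (psi_pow t m.+1)) [ract _ s](@ractDl _ _ (tpow (twV t) m.+1))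
    (bhD (phi_pow m.+1)) h h' -tpureDl.
have -> : ract (psi_pow t m.+1 (tpure u v) : tpow (twV t) m.+1) s =
    @tpure _ _ _ (tpow (twV t) m) (twV t) (psi_pow t m u) (ract (tv v) s).
  rewrite -tractE; congr ract; exact: (tens_homE (psiS_subproof (psi_pow t m)) u v).
rewrite -[LHS]/(phi_fun (phi_pow m) _) phi_funE.
have := IH u 1; rewrite [ract _ 1](@ract1 _ _ (tpow (twV t) m)) => ->.
rewrite thetaE [twlact t 1 _](@lact1 _ _ (twV t)) tractE.
rewrite -[X in tassocV _ _ _ X]/(tpure u (tpure v (1 * s : Sr))) mul1r.
exact: tassocVE.
Qed.

Definition phi_comp m (u : tpow (twV t) m) : B := tmap (dinj (tpow V) m) (bid Sr) (phi_pow m u).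
Lemma phi_compD m (u u' : tpow (twV t) m) : phi_comp (u + u') = phi_comp u + phi_comp u'.
Proof. by rewrite /phi_comp (bhD (phi_pow m)) (bhD (tmap _ _)). Qed.
Definition phi (w : W) : B := dlift phi_comp w.
Lemma phiD w w' : phi (w + w') = phi w + phi w'.
Proof. exact: dliftD phi_compD _ _. Qed.
(** Surjectivity of psi comes from [tw_gen], so this one composition makes psi bijective. *)
Lemma phi_psi (z : B) : phi (psi t z) = z.
Proof.
elim/tpure_ind: z => [x s|z z' h h']; last by rewrite (bhD (psi t)) phiD h h'.
rewrite psi_pure; elim/dsum_ind: x => [m u|x y hx hy]; last first.
  by rewrite jtD mulrDl phiD hx hy -tpureDl.
rewrite jt_in -tractM -(bhr (dinj (tpow (twV t)) m)).
rewrite [LHS](dlift_inj phi_compD) /phi_comp phi_psi_pow; exact: tmapE.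
Qed.
Lemma psi_inj : injective (psi t).
Proof. exact: can_inj phi_psi. Qed.
Lemma psi_phi w : psi t (phi w) = w.
Proof. by have [z <-] := psi_surj w; rewrite phi_psi. Qed.

End TwistedRing.

(** * Leading forms *)

Section PBWCriterion.
Variables (K : pzRingType) (V : bimod K K).
Local Notation T := (tring V).
Variables (Rel P : set T).
Hypothesis lead_of_rel : forall m x, ideal Rel x ->
  exists2 p, ideal P p & tlt V m (tcomp m x - p).

Lemma qlt_class m x : tlt V m x -> qlt P m (qclass P x).
Proof. by move=> h; exists x. Qed.

(** [lead_of_rel] makes the map to the graded ring well defined, and it is always onto. What remains
    is injectivity, which in degree [m] says that leading forms of elements of <P> are relations. *)
Lemma PBW_lead : is_PBW_deformation Rel P <->
  forall m x, ideal P x -> tlt V m.+1 x -> ideal Rel (tcomp m x).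
Proof.
split=> [h m x Px xm|h m].
  have [phi [hphi [_ hinj _]]] := h m.
  have gcm : tgr V m (tcomp m x) := tgr_comp m x.
  apply/qclass_0; rewrite -[RHS](qpi0 (ideal Rel)) -[RHS]/(qclass Rel 0).
  apply: hinj.
  - by apply: mem_set; exists (tcomp m x).
  - by apply: mem_set; exists 0 => //; apply: tgr_zero.
  rewrite !hphi //; last exact: tgr_zero.
  apply/qpi_eq; rewrite -qclassB subr0.
  have -> : qclass P (tcomp m x) = qclass P (- (x - tcomp m x)).
    by apply/qpi_eq; rewrite opprK addrC subrK.
  by apply/qlt_class/smemN/tltS.
(* The witness is a function on the whole quotient, so it first projects to degree [m]. *)
pose phi := qlift (fun x => qpi (qlt P m) (qclass P (tcomp m x))) : qring Rel -> _.
have phiE x : phi (qclass Rel x) = qpi (qlt P m) (qclass P (tcomp m x)).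
  apply: qliftE => u v /(lead_of_rel m) [p Pp hp]; apply/qpi_eq.
  rewrite -qclassB -(additiveB (tcompD m)).
  have -> : qclass P (tcomp m (u - v)) = qclass P (tcomp m (u - v) - p).
    by apply/qpi_eq; rewrite opprB addrC subrK.
  exact: qlt_class.
exists phi; split=> [x xm|]; first by rewrite phiE (tgrP m x).1.
split=> [a [x xm <-]|a b /set_mem [x xm <-] /set_mem [y ym <-]|b [c [x xm <-] <-]].
- rewrite phiE (tgrP m x).1 //; exists (qclass P x) => //.
  by apply: qlt_class; apply: tgr_tlt xm.
- rewrite !phiE !(tgrP m _).1 // => /qpi_eq [z zm ez].
  have Pz : ideal P (x - y - z) by apply/qclass_0; rewrite qclassB ez qclassB subrr.
  apply/qpi_eq.
  have <- : tcomp m (x - y - z) = x - y.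
    rewrite (additiveB (tcompD m)) ((tltP m z).1 zm) // subr0.
    by apply/tgrP/tgr_sub.
  apply: h => //; apply: smemB; last exact: tlt_leq zm.
  by apply: (@tgr_tlt _ _ _ m) => //; apply: tgr_sub.
- exists (qclass Rel (tcomp m x)); first by exists (tcomp m x) => //; apply: tgr_comp.
  rewrite phiE (tgrP m _).1; last exact: tgr_comp.
  apply/qpi_eq; rewrite -qclassB; apply: qlt_class.
  by rewrite -opprB; apply/smemN/tltS.
Qed.
End PBWCriterion.

Section LeadingForms.
Variables (K S : pzRingType) (eta : {rmorphism K -> S}) (V : bimod K K).
Variables (t : twisting eta V) (n : nat) (R : subbimod (tpow V n)).
Variable (P : subbimod (tring_bimod (twV t))).
Local Notation T := (tring V).
Local Notation W := (tring (twV t)).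
Local Notation Sr := (SKS eta).
Local Notation Sk := (SKK eta).
Local Notation RM := (sub_bimod R).
Local Notation jt := (jt t).
Local Notation sc := (@sc _ _ _ _ t).
Local Notation L := (ideal (rel_set R)).
Local Notation Pset := ([set x | P x] : set W).

Hypothesis P_le : forall x, P x -> tlt (twV t) n.+1 x.
Hypothesis P_top : [set dinj (tpow (twV t)) n (dproj (tpow (twV t)) n x)
               | x in [set x | P x]] = twisted_rel t R.

Definition tw_ideal : subgrp W := span [set w | exists l s, L l /\ w = jt l * sc s].
Definition tw_rels : subgrp W := span [set w | exists (r : RM) s, w = jt (relt r) * sc s].

Lemma psi_rel (y : tens RM Sk) : tw_rels (psi t (tmap (rel_incl R) (bid Sk) y)).
Proof.
elim/tpure_ind: y => [r s|y y' h h'].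
  by rewrite tmapE psi_pure; apply: span_gen; exists r, s.
rewrite bhD [psi t _](bhD (psi t)); exact: smemD.
Qed.
Lemma twisted_relP w : twisted_rel t R w <-> tw_rels w.
Proof.
split=> [[y _ <-]|]; first exact: psi_rel.
have tE (y : tens RM Sk) : exists2 z, [set: tens RM Sk] z &
    psi t (tmap (rel_incl R) (bid Sk) z) = psi t (tmap (rel_incl R) (bid Sk) y).
  by exists y.
elim=> {w} [_ [r [s ->]]||w w' _ [y _ hy] _ [y' _ hy']].
- by exists (@tpure _ _ _ RM Sk r s) => //; rewrite tmapE psi_pure.
- by exists 0 => //; rewrite bh0 [LHS](bh0 (psi t)).
- by exists (y - y') => //; rewrite bhB [LHS](bhB (psi t)) hy hy'.
Qed.
Lemma P_topP w : tw_rels w <-> exists2 p, P p & w = tcomp n p.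
Proof.
by rewrite -twisted_relP -P_top; split=> [[p Pp <-]|[p Pp ->]]; exists p.
Qed.

Lemma P_scl s (p : W) : P p -> P (sc s * p).
Proof. by move=> h; rewrite -[_ * _]tlactM; apply: (sbm_l s h). Qed.
Lemma P_scr s (p : W) : P p -> P (p * sc s).
Proof. by move=> h; rewrite -[_ * _]tractM; apply: (sbm_r s h). Qed.
Lemma tgr_sc s : tgr (twV t) 0 (sc s). Proof. exact: tgr_const. Qed.
Lemma tcomp_scr m w s : tcomp m (w * sc s) = tcomp m w * sc s.
Proof. by have := tcomp_mulr m w (tgr_sc s); rewrite addn0. Qed.
Lemma tcomp_scl m w s : tcomp m (sc s * w) = sc s * tcomp m w.
Proof. by have := tcomp_mull m w (tgr_sc s); rewrite add0n. Qed.

(** R S consists of the components of degree [n] of P, and P is stable under S on the left. *)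
Lemma tw_rels_scl s w : tw_rels w -> tw_rels (sc s * w).
Proof.
move=> /P_topP [p Pp ->]; apply/P_topP; exists (sc s * p); first exact: P_scl.
by rewrite tcomp_scl.
Qed.

Lemma tw_rels_ideal w : tw_rels w -> tw_ideal w.
Proof.
move: w; apply: span_mono => _ [r [s ->]]; exists (relt r), s; split=> //.
exact: rel_ideal.
Qed.
Lemma tw_ideal_jt x w : tw_ideal w -> tw_ideal (jt x * w).
Proof.
move: w; apply: (@span_map _ _ _ (mulrDr (jt x)) _ tw_ideal) => _ [l [s [Ll ->]]].
rewrite mulrA -jtM; apply: span_gen; exists (x * l), s; split=> //.
exact: ideal_l.
Qed.
Lemma tw_ideal_scr s w : tw_ideal w -> tw_ideal (w * sc s).
Proof.
move: w; apply: (@span_map _ _ (fun w => w * sc s) (fun a b => mulrDl a b _) _ tw_ideal).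
move=> _ [l [s' [Ll ->]]].
by rewrite -mulrA -scM; apply: span_gen; exists l, (s' * s).
Qed.
Lemma tw_ideal_jt_mul l w : L l -> tw_ideal (jt l * w).
Proof.
move=> Ll; move: w; apply: (tw_gen (H := preim_subgrp (mulrDr (jt l)) tw_ideal)) => x s /=.
rewrite mulrA -jtM; apply: span_gen; exists (l * x), s; split=> //.
exact: ideal_r.
Qed.
Lemma tw_ideal_r w a : tw_ideal w -> tw_ideal (w * a).
Proof.
move: w; apply: (@span_map _ _ (fun w => w * a) (fun a b => mulrDl a b _) _ tw_ideal).
by move=> _ [l [s [Ll ->]]]; rewrite -mulrA; apply: tw_ideal_jt_mul.
Qed.
(** Every [a] is a sum of products [jt x * sc s], so it is enough to carry a scalar across an
    element of L; induction on that element leads back to [tw_rels_scl]. *)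
Lemma tw_ideal_l w a : tw_ideal w -> tw_ideal (a * w).
Proof.
suff h l : L l -> forall s, tw_ideal (sc s * jt l).
  move: w; apply: (@span_map _ _ _ (mulrDr a) _ tw_ideal) => _ [l [s [Ll ->]]].
  rewrite mulrA; apply: tw_ideal_scr; move: a.
  apply: (tw_gen (H := preim_subgrp (fun a b => mulrDl a b (jt l)) tw_ideal)) => x s' /=.
  by rewrite -mulrA; apply/tw_ideal_jt/h.
elim=> {l} [_ [r _ <-]||x y _ hx _ hy|b x _ hx|x b _ hx] s.
- apply/tw_rels_ideal/tw_rels_scl; apply: span_gen; exists r, 1.
  by rewrite sc1 mulr1.
- by rewrite (additive0 (@jtD _ _ _ _ t)) mulr0; apply: smem0.
- by rewrite (additiveB (@jtD _ _ _ _ t)) mulrBr; apply: smemB.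
- rewrite jtM mulrA; move: (sc s * jt b) => c; move: c.
  apply: (tw_gen (H := preim_subgrp (fun a b => mulrDl a b (jt x)) tw_ideal)) => y s' /=.
  by rewrite -mulrA; apply/tw_ideal_jt/hx.
- by rewrite jtM mulrA; apply/tw_ideal_r/hx.
Qed.

Lemma twisted_idealP w : ideal (twisted_rel t R) w <-> tw_ideal w.
Proof.
split=> [|h].
  elim=> {w} [w /twisted_relP/tw_rels_ideal //||w w' _ h _ h'|a w _ h|w a _ h].
  - exact: smem0.
  - exact: smemB.
  - exact: tw_ideal_l.
  - exact: tw_ideal_r.
elim: h => {w} [_ [l [s [Ll ->]]]||w w' _ h _ h'].
- apply: ideal_r; elim: Ll => {l} [_ [r _ <-]||x y _ hx _ hy|b x _ hx|x b _ hx].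
  + apply/ideal_gen/twisted_relP; apply: span_gen; exists r, 1.
    by rewrite sc1 mulr1.
  + by rewrite (additive0 (@jtD _ _ _ _ t)); apply: ideal_zero.
  + by rewrite (additiveB (@jtD _ _ _ _ t)); apply: ideal_sub.
  + by rewrite jtM; apply: ideal_l.
  + by rewrite jtM; apply: ideal_r.
- exact: ideal_zero.
- exact: ideal_sub.
Qed.

Definition is_lead m : set W :=
  [set w | exists2 p, ideal Pset p & tlt (twV t) m (tcomp m w - p)].
Lemma is_lead0 m : is_lead m 0.
Proof. by exists 0; [exact: ideal_zero|rewrite tcomp0 subr0]. Qed.
Lemma is_leadB m w w' : is_lead m w -> is_lead m w' -> is_lead m (w - w').
Proof.
move=> [p Pp hp] [p' Pp' hp']; exists (p - p'); first exact: ideal_sub.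
rewrite (additiveB (tcompD m)) opprD addrACA -opprD; exact: smemB.
Qed.

(** All components are treated, not just the leading one, because the map in [PBW_lead] is defined
    on arbitrary classes. The property is stable under products with homogeneous elements, which
    shift it in degree. *)
Lemma lead_twisted m x : ideal (twisted_rel t R) x ->
  exists2 p, ideal Pset p & tlt (twV t) m (tcomp m x - p).
Proof.
move=> hx; pose H m' := Subgrp (@is_lead0 m') (@is_leadB m').
rewrite -[exists2 p, _ & _]/(H m x); elim: hx m => {x} [x hx||x y _ hx _ hy|a x _ hx|x a _ hx] m.
- move: hx => /twisted_relP/P_topP [p Pp ->]; have [<-|ne] := eqVneq n m.
    exists p; first exact: ideal_gen.
    rewrite (tgrP n _).1; last exact: tgr_comp.
    by rewrite -opprB; apply/smemN/tltS/P_le.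
  exists 0; first exact: ideal_zero.
  by rewrite subr0 (tgr_compN (tgr_comp n p)); [exact: smem0|exact/eqP].
- exact: smem0.
- exact: (smemB (hx m) (hy m)).
- move: a; apply: (@tring_homog _ _ (preim_subgrp (fun a b => mulrDl a b x) (H m))) => i a ha.
  have [lt|le] := ltnP m i.
    exists 0; first exact: ideal_zero.
    by rewrite subr0 (tcomp_mull_lt _ ha lt); exact: smem0.
  have [p Pp hp] := hx (m - i)%N; exists (a * p); first exact: ideal_l.
  rewrite -(subnKC le) (tcomp_mull _ _ ha) -mulrBr; exact: tlt_mull.
- move: a; apply: (@tring_homog _ _ (preim_subgrp (mulrDr x) (H m))) => i a ha.
  have [lt|le] := ltnP m i.
    exists 0; first exact: ideal_zero.
    by rewrite subr0 (tcomp_mulr_lt _ ha lt); exact: smem0.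
  have [p Pp hp] := hx (m - i)%N; exists (p * a); first exact: ideal_r.
  rewrite -(subnK le) (tcomp_mulr _ _ ha) -mulrBl; exact: tlt_mulr.
Qed.

End LeadingForms.

(** * The maps of the conditions J as products in W *)

Section PsiConditions.
Variables (K S : pzRingType) (eta : {rmorphism K -> S}) (V : bimod K K).
Variables (t : twisting eta V) (n : nat) (R : subbimod (tpow V n)).
Local Notation T := (tring V).
Local Notation W := (tring (twV t)).
Local Notation Sk := (SKK eta).
Local Notation RM := (sub_bimod R).
Local Notation TS := (tens (tring_bimod V) Sk).
Local Notation tspure x s := (@tpure _ _ _ (tring_bimod V) Sk (x : T) (s : S)).
Local Notation jt := (jt t).
Local Notation sc := (@sc _ _ _ _ t).

Definition psk (z : TS) : W := psi t z.
Lemma pskE x s : psk (tspure x s) = jt x * sc s.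
Proof. exact: psi_pure. Qed.
Lemma pskD x y : psk (x + y) = psk x + psk y.
Proof. exact: (bhD (psi t)). Qed.
Lemma psk_inj : injective psk.
Proof. exact: (@psi_inj _ _ _ _ t). Qed.
Lemma psk_l k z : psk (lact k z) = sc (eta k) * psk z.
Proof. by rewrite -tlactM; apply: (bhl (psi t)). Qed.
Lemma psk_r z k : psk (ract z k) = psk z * sc (eta k).
Proof.
elim/tpure_ind: z => [x s|x y hx hy]; last by rewrite ractDl !pskD hx hy mulrDl.
by rewrite tractE !pskE -mulrA -scM.
Qed.

Lemma psk_component m z : psk (TS_component eta V m z) = tcomp m (psk z).
Proof.
elim/tpure_ind: z => [x s|x y hx hy]; last by rewrite bhD !pskD tcompD hx hy.
rewrite /TS_component tmapE [LHS]pskE pskE.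
by rewrite tcomp_scr jt_tcomp.
Qed.

Variable b : bihom RM TS.

Lemma psk_V_tens v r : psk (V_tens b (tpure v r)) = jt (tg v) * psk (b r).
Proof.
rewrite -[V_tens b _]/(tmap _ _ (tassocV V (tring_bimod V) Sk (tmap _ _ _))) tmapE.
move: (b r) => z; elim/tpure_ind: z => [x s|x y hx hy].
  rewrite tassocVE tmapE [LHS]pskE pskE mulrA -jtM; congr (jt _ * _).
  exact: vt_multE.
by rewrite (tpureDr (M := V)) !bhD !pskD hx hy mulrDr.
Qed.

(** The twisting in [tens_V] reorders a scalar and a vector exactly as the product of W does, so it
    is absorbed into that product. *)
Lemma psk_tens_V r v : psk (tens_V t b (tpure r v)) = psk (b r) * jt (tg v).
Proof.
rewrite -[tens_V t b _]/(tmap _ _ (tassocV (tring_bimod V) V Sk (tmap _ _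
  (tassoc (tring_bimod V) Sk V (tmap _ _ _))))) tmapE.
move: (b r) => z; elim/tpure_ind: z => [x s|x y hx hy]; last first.
  by rewrite (tpureDl (M := TS)) !bhD !pskD hx hy mulrDl.
rewrite tassocE tmapE pskE -mulrA sc_tg.
move: (t _) => z; elim/tpure_ind: z => [v' s'|x' y hx hy].
  rewrite tassocVE tmapE pskE -[tg _]/(tg (@tpure _ _ _ V (SKS eta) v' s' : twV t)).
  rewrite tg_tpure mulrA -jtM; congr (jt _ * _).
  by rewrite -[LHS]/(tmult V (tmap _ _ _)) tmapE [LHS]tens_homE.
rewrite (tpureDr (M := tring_bimod V)) !bhD !pskD hx hy.
by rewrite -mulrDr -(@tgD _ (twV t)).
Qed.

Definition b_S : bihom (tens RM Sk) TS :=
  tmap (bid (tring_bimod V)) (mS eta) ∘ tassoc (tring_bimod V) Sk Sk ∘ tmap b (bid Sk).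
Lemma psk_b_S r s : psk (b_S (@tpure _ _ _ RM Sk r s)) = psk (b r) * sc s.
Proof.
rewrite -[b_S _]/(tmap _ _ (tassoc (tring_bimod V) Sk Sk (tmap _ _ _))) tmapE.
move: (b r) => z; elim/tpure_ind: z => [x s'|x y hx hy]; last first.
  by rewrite (tpureDl (M := TS)) !bhD !pskD hx hy mulrDl.
rewrite tassocE tmapE pskE [mS _ _]tens_homE pskE -mulrA -scM //.
Qed.

End PsiConditions.

(** * Sufficiency of the conditions *)

Section FilteredIdeal.
Variables (K S : pzRingType) (eta : {rmorphism K -> S}) (V : bimod K K).
Variables (t : twisting eta V) (n : nat) (P : subbimod (tring_bimod (twV t))).
Local Notation T := (tring V).
Local Notation W := (tring (twV t)).
Local Notation jt := (jt t).
Local Notation sc := (@sc _ _ _ _ t).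
Local Notation Wtlt := (tlt (twV t)).
Local Notation Wtgr := (tgr (twV t)).
Local Notation Pset := ([set x | P x] : set W).
Hypothesis P_le : forall x, P x -> Wtlt n.+1 x.

(* The elements of the ideal generated by P which are visibly of degree at most
   the index; only generators p * w and left multiples by V are needed, which is
   the shape in which the kernel of R (x) A -> V (x) A enters. *)
Inductive fideal_set : nat -> set W :=
| fideal_gen p k w : P p -> Wtgr k w -> fideal_set (n + k) ((p : W) * w)
| fideal_V v m w : fideal_set m w -> fideal_set m.+1 (jt (tg v) * w)
| fideal_up m w : fideal_set m w -> fideal_set m.+1 w
| fideal_zero m : fideal_set m 0
| fideal_sub m w w' : fideal_set m w -> fideal_set m w' -> fideal_set m (w - w').

Definition fideal m : subgrp W := Subgrp (@fideal_zero m) (@fideal_sub m).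

Lemma fideal_le m m' w : (m <= m')%N -> fideal m w -> fideal m' w.
Proof.
move=> /subnK <-; elim: (m' - m)%N => // d IH h.
by rewrite addSn; apply/fideal_up/IH.
Qed.

Lemma fideal_tlt m w : fideal m w -> Wtlt m.+1 w.
Proof.
elim=> {m w} [p k w Pp hw|v m w _ h|m w _ h|m|m w w' _ h _ h'].
- by rewrite -addSn; apply: tlt_mulr => //; apply: P_le.
- by rewrite -add1n; apply: tlt_mull => //; apply/jt_tgr/tgr_tg.
- exact: tlt_leq h.
- exact: smem0.
- exact: smemB.
Qed.

Lemma fideal_mulr m k w x : fideal m w -> Wtgr k x -> fideal (m + k) (w * x).
Proof.
move=> h hx; elim: h => {m w} [p k' w Pp hw|v m w _ h|m w _ h|m|m w w' _ h _ h'].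
- by rewrite -mulrA -addnA; apply: fideal_gen => //; apply: tgrM.
- by rewrite -mulrA; apply: fideal_V.
- exact: fideal_up.
- by rewrite mul0r; apply: fideal_zero.
- by rewrite mulrBl; apply: fideal_sub.
Qed.

Lemma fideal_scr m w s : fideal m w -> fideal m (w * sc s).
Proof. by move=> h; rewrite -[m]addn0; apply: fideal_mulr (tgr_sc t s). Qed.

(** The twisting carries [s] across each factor from V without raising the index, and P is stable on
    the left. *)
Lemma fideal_scl m w s : fideal m w -> fideal m (sc s * w).
Proof.
move=> h; elim: h s => {m w} [p k w Pp hw|v m w _ h|m w _ h|m|m w w' _ h _ h'] s.
- by rewrite mulrA; apply: fideal_gen => //; rewrite -tlactM; apply: (sbm_l s Pp).
- rewrite mulrA sc_tg; move: (t _) => z.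
  elim/tpure_ind: z => [v' s'|z z' hz hz'].
    rewrite -[tg _]/(tg (@tpure _ _ _ V (SKS eta) v' s' : twV t)) tg_tpure -mulrA.
    exact/fideal_V/h.
  have -> : tg (z + z' : twV t) = tg (z : twV t) + tg (z' : twV t) :=
    @tgD _ (twV t) z z'.
  by rewrite mulrDl; apply: (smemD (H := fideal m.+1)).
- exact/fideal_up/h.
- by rewrite mulr0; apply: fideal_zero.
- by rewrite mulrBr; apply: fideal_sub; [apply: h|apply: h'].
Qed.

Lemma fideal_tg m (z : twV t) w : fideal m w -> fideal m.+1 (tg z * w).
Proof.
move=> h; elim/tpure_ind: z => [v s|z z' hz hz'].
  by rewrite tg_tpure -mulrA; apply/fideal_V/fideal_scl.
by rewrite tgD mulrDl; apply: smemD.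
Qed.

Lemma fideal_mull m k w x : fideal m w -> Wtgr k x -> fideal (k + m) (x * w).
Proof.
move=> h; elim: k x => [|k IH] x; first by move=> [s ->]; apply: fideal_scl.
move: x; apply: (@tgr_genl _ _ k (preim_subgrp (fun a b => mulrDl a b w) (fideal (k.+1 + m)))).
move=> x z hx /=; rewrite -mulrA; apply/fideal_tg/IH => //.
Qed.

Lemma fideal_mulr_tlt m k w (x : W) : fideal m w -> Wtlt k.+1 x -> fideal (m + k) (w * x).
Proof.
move=> h; move: x; apply: (@tlt_span _ _ _ (preim_subgrp (mulrDr w) (fideal (m + k)))).
move=> q x hq hx /=; apply: fideal_le (fideal_mulr h hx).
by rewrite leq_add2l.
Qed.
Lemma fideal_mull_tlt m k w (x : W) : fideal m w -> Wtlt k.+1 x -> fideal (k + m) (x * w).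
Proof.
move=> h; move: x.
apply: (@tlt_span _ _ _ (preim_subgrp (fun a b => mulrDl a b w) (fideal (k + m)))).
move=> q x hq hx /=; apply: fideal_le (fideal_mull h hx).
by rewrite leq_add2r.
Qed.

Lemma tlt_exists (x : W) : exists k, Wtlt k.+1 x.
Proof.
by have [N hN] := dfin x; exists N => q hq; apply: hN; apply: leq_trans hq.
Qed.

Lemma ideal_fideal w : ideal Pset w -> exists m, fideal m w.
Proof.
elim=> {w} [p Pp||w w' _ [m h] _ [m' h']|a w _ [m h]|w a _ [m h]].
- exists (n + 0)%N; rewrite -[p]mulr1; apply: fideal_gen => //.
  by rewrite -tconst1; apply: tgr_const.
- by exists 0%N; apply: fideal_zero.
- by exists (maxn m m'); apply: fideal_sub; [apply: fideal_le h|apply: fideal_le h'];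
    rewrite ?leq_maxl ?leq_maxr.
- by have [k hk] := tlt_exists a; exists (k + m)%N; apply: fideal_mull_tlt.
- by have [k hk] := tlt_exists a; exists (m + k)%N; apply: fideal_mulr_tlt.
Qed.


Lemma fideal_low m w : fideal m w -> (m < n)%N -> w = 0.
Proof.
elim=> {m w} [p k w Pp _|v m w _ h|m w _ h|m|m w w' _ h _ h'] lt //.
- by move: lt; rewrite ltnNge leq_addr.
- by rewrite h ?mulr0 // ltnW.
- by rewrite h // ltnW.
- by rewrite h // h' // subrr.
Qed.

(** This is V I_m + I_m, the target of one reduction of an element of I_{m+1}. *)
Definition fstep m : subgrp W :=
  span (fideal m `|` [set w' | exists v w, fideal m w /\ w' = jt (tg v) * w]).

Lemma fstep_fideal m w : fideal m w -> fstep m w.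
Proof. by move=> h; apply: span_gen; left. Qed.
Lemma fstep_V m v w : fideal m w -> fstep m (jt (tg v) * w).
Proof. by move=> h; apply: span_gen; right; exists v, w. Qed.
Lemma fstep_scr m w s : fstep m w -> fstep m (w * sc s).
Proof.
move: w; apply: (@span_map _ _ (fun w => w * sc s) (fun a b => mulrDl a b _) _ (fstep m)).
move=> w [h|[v [w' [h ->]]]]; first exact/fstep_fideal/fideal_scr.
by rewrite -mulrA; apply/fstep_V/fideal_scr.
Qed.

(* Coordinates with respect to a dual basis of V allow dividing by V on the left. *)
Hypothesis V_proj : projective (as_rmod V).

Lemma fstep_lower m :
  (forall m' w, m = m'.+1 -> fideal m w -> Wtlt m w -> fideal m' w) ->
  forall w, fstep m w -> Wtlt m.+1 w -> fideal m w.
Proof.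
move=> IH.
(* By [IH] an element of I_m of degree below m is in I_{m-1}, and multiplying by [v] restores the
   index; for [m = 0] it is 0. *)
have step v q : fideal m q -> Wtlt m q -> fideal m (jt (tg v) * q).
  case: m IH => [|m] IH hq qm; first by rewrite (tlt0 qm) mulr0; apply: smem0.
  by apply: fideal_V; apply: (IH m).
have [e [eD er eE]] := dual_basis V_proj.
(* The coordinate of index [i] on V, extended to a right S-linear function on V (x) S and then
   applied to the first factor in W by [D i]. *)
pose ef i (v : V) (s : SKS eta) : S := eta (e i v) * s.
have eb i : balanced (@ract _ _ V) (@lact _ _ (SKS eta)) (ef i).
  split=> [v v' s|v s s'|v k s]; rewrite /ef.
  - by rewrite eD rmorphD mulrDl.
  - by rewrite mulrDr.
  - by rewrite er rmorphM -mulrA.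
pose E i (z : twV t) : S := tlift (ef i) z.
have ED i z z' : E i (z + z') = E i z + E i z' by exact: (tliftD (eb i)).
have Er i z s : E i (ract z s) = E i z * s.
  elim/tpure_ind: z => [v s'|z z' hz hz'].
    by rewrite tractE /E !(tliftE (eb i)) /ef /= mulrA.
  by rewrite ractDl !ED hz hz' mulrDl.
pose D i (w : W) : W := contr (E i) w.
have DD i a b : D i (a + b) = D i a + D i b := contrD (ED i) (Er i) a b.
have DE i v w : D i (jt (tg v) * w) = sc (eta (e i v)) * w.
  rewrite jt_tg /D (contrE (ED i) (Er i)); congr (tconst _ _ * _).
  by rewrite /E (tliftE (eb i)) /ef mulr1.
pose VI := [set w' : W | exists v w, fideal m w /\ w' = jt (tg v) * w].
(* The coordinates of v w are e_i(v) w, hence stay in I_m. Quantifying over all larger lists gives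
   both terms of a difference a common support. *)
have VI_coord q : span VI q -> (forall i, fideal m (D i q)) /\
    exists s0 : seq V, forall s, uniq s -> {subset s0 <= s} ->
    q = \sum_(i <- s) jt (tg i) * D i q.
  elim=> {q} [_ [v [w [hw ->]]]||q q' _ [h [s0 hs0]] _ [h' [s0' hs0']]].
  - split=> [i|]; first by rewrite DE; apply: fideal_scl.
    have [s0 hs0] := eE v; exists s0 => s us ss; rewrite {1}(hs0 s us ss).
    rewrite (additive_sum (@tgD _ V)) (additive_sum (@jtD _ _ _ _ t)) mulr_suml.
    apply: eq_bigr => i _; rewrite DE mulrA; congr (_ * _).
    rewrite -jt_const -jtM -tg_r //.
  - split=> [i|]; first by rewrite (additive0 (DD i)); apply: smem0.
    exists [::] => s _ _; rewrite big1 // => i _.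
    by rewrite (additive0 (DD i)) mulr0.
  - split=> [i|]; first by rewrite (additiveB (DD i)); apply: smemB.
    exists (s0 ++ s0') => s us ss.
    rewrite {1}(hs0 s us) => [|i hi]; last by apply: ss; rewrite mem_cat hi.
    rewrite {1}(hs0' s us) => [|i hi]; last by apply: ss; rewrite mem_cat hi orbT.
    by rewrite -sumrB; apply: eq_bigr => i _; rewrite (additiveB (DD i)) mulrBr.
move=> w hw wm.
have [w' [q [hw' hq ew]]] : exists w' q, [/\ fideal m w', span VI q & w = w' + q].
  elim: hw {wm} => {w} [w [h|h]||w w' _ [a [b [ha hb ->]]] _ [a' [b' [ha' hb' ->]]]].
  - by exists w, 0; rewrite addr0; split=> //; apply: smem0.
  - by exists 0, w; rewrite add0r; split=> //; [exact: smem0|apply: span_gen].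
  - by exists 0, 0; rewrite addr0; split=> //; apply: smem0.
  - exists (a - a'), (b - b'); rewrite opprD addrACA.
    by split=> //; apply: smemB.
have qm : Wtlt m.+1 q.
  have -> : q = w - w' by rewrite ew addrC addKr.
  by apply: smemB => //; apply: fideal_tlt.
have [Dq [s0 hs0]] := VI_coord q hq.
rewrite ew; apply: smemD => //; rewrite (hs0 (undup s0)) ?undup_uniq //; last first.
  by move=> i; rewrite mem_undup.
apply: smem_sum => i _.
(* Contraction turns degree at most m into degree below m, as [step] demands. *)
have Dm : Wtlt m (D i q) := contr_tlt (ED i) (Er i) qm.
exact: step.
Qed.

(** Each element of <P> lies in some I_{m'}, and the hypothesis lowers m' one unit at a time while
    it exceeds the degree bound. *)
Lemma ideal_fideal_tlt :
  (forall m w, fideal m.+1 w -> Wtlt m.+1 w -> fideal m w) ->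
  forall m w, ideal Pset w -> Wtlt m.+1 w -> fideal m w.
Proof.
move=> h m w /ideal_fideal [m' hw] wm.
have [le|lt] := leqP m' m; first exact: fideal_le hw.
move: hw; rewrite -(subnK (ltnW lt)).
elim: (m' - m)%N => // d IHd; rewrite addSn => /h h'; apply: IHd; apply: h'.
by apply: tlt_leq wm; rewrite ltnS leq_addl.
Qed.

End FilteredIdeal.

(** * Elements of I_{m+1} of degree at most m *)

Section DegreeLowering.
Variables (K S : pzRingType) (eta : {rmorphism K -> S}).
Hypothesis S_flat : flat (as_lmod (SKS eta)).
Variables (V : bimod K K) (t : twisting eta V).
Variables (n : nat) (R : subbimod (tpow V n)) (P : subbimod (tring_bimod (twV t))).
Hypothesis n2 : (1 < n)%N.
Local Notation T := (tring V).
Local Notation W := (tring (twV t)).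
Local Notation Sr := (SKS eta).
Local Notation Sk := (SKK eta).
Local Notation X := (rel_set R).
Local Notation RM := (sub_bimod R).
Local Notation AK := (ring_bimod (qconst X)).
Local Notation VA := (tens V (rres (qconst X) AK)).
Local Notation RT := (tens RM (tring_bimod V)).
Local Notation TS := (tens (tring_bimod V) Sk).
Local Notation rtpure r x := (@tpure _ _ _ RM (tring_bimod V) r (x : T)).
Local Notation jt := (jt t).
Local Notation sc := (@sc _ _ _ _ t).
Local Notation psk := (@psk _ _ _ _ t).
Local Notation Wtlt := (tlt (twV t)).
Local Notation Wtgr := (tgr (twV t)).
Local Notation N' := (as_lmod (ground R n2)).
Local Notation fid := (fideal n P).
Local Notation step := (fstep n P).
Hypothesis P_le : forall x, P x -> Wtlt n.+1 x.
Hypothesis P_top : [set dinj (tpow (twV t)) n (dproj (tpow (twV t)) n x)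
               | x in [set x | P x]] = twisted_rel t R.
Hypothesis V_proj : projective (as_rmod V).
Hypothesis R_proj : projective (as_rmod RM).
Variable res : gr_proj_resolution (alg_gr R) (deg0_gr (as_rmod (ground R n2))).

Variable alpha : bihom RM TS.
Definition av (r : RM) : W := psk (alpha r).
Hypothesis av_P : forall r, P (av r).
Hypothesis av_lead : forall r, Wtlt n (av r - jt (relt r)).
Hypothesis av_gen : forall p, P p -> span [set w : W | exists r s, w = av r * sc s] p.

(** The content of the conditions J before it is split into homogeneous components. *)
Definition compatible : Prop := forall u w, in_X u w ->
  P (psk (V_tens alpha u) - psk (tens_V t alpha w)).
Hypothesis tor : Tor res N' 3 = [set 0] \/
  (Tor res N' 3 = Tor_gr res N' 3 n.+1 /\ compatible).

Lemma avD r r' : av (r + r') = av r + av r'.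
Proof. by rewrite /av bhD pskD. Qed.

Lemma lift_bal : balanced (@ract _ _ RM) (@lact _ _ (tring_bimod V))
  (fun r (x : T) => av r * jt x).
Proof.
split=> [r r' x|r x y|r k x].
- by rewrite avD mulrDl.
- by rewrite jtD mulrDr.
- by rewrite tlactM jtM jt_const mulrA /av bhr psk_r.
Qed.
Definition lift_rel (y : RT) : W := tlift (fun r (x : T) => av r * jt x) y.
Lemma lift_relE r x : lift_rel (rtpure r x) = av r * jt x.
Proof. exact: (tliftE lift_bal). Qed.
Lemma lift_relD y y' : lift_rel (y + y') = lift_rel y + lift_rel y'.
Proof. exact: (tliftD lift_bal). Qed.
Lemma lift_rel_r y k : lift_rel (ract y k) = lift_rel y * sc (eta k).
Proof.
elim/tpure_ind: y => [r x|y y' h h'].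
  by rewrite tractE !lift_relE tractM jtM jt_const mulrA.
by rewrite ractDl !lift_relD h h' mulrDl.
Qed.
Lemma lift_rel_mul y x : lift_rel (vt_mul y x) = lift_rel y * jt x.
Proof.
elim/tpure_ind: y => [r z|y y' h h']; first by rewrite vt_mulE !lift_relE jtM mulrA.
by rewrite vt_mulD !lift_relD h h' mulrDl.
Qed.

Section Degree.
Variable k : nat.
Local Notation RTk := (tens RM (tpow V k)).
(** R (x) T^k is taken as a bimodule of its own, because flatness of S has to be applied to a
    bimodule map defined on it; [vt_gr k] is just a subgroup. *)
Definition rt_in : bihom RTk RT := tmap (bid RM) (dinj (tpow V) k).

Lemma liftS_bal : balanced (@ract _ _ RTk) (@lact _ _ Sr)
  (fun z (s : S) => lift_rel (rt_in z) * sc s).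
Proof.
split=> [z z' s|z s s'|z c s].
- by rewrite bhD lift_relD mulrDl.
- by rewrite scD mulrDr.
- by rewrite bhr lift_rel_r -mulrA -scM.
Qed.
Definition liftS (y : tens RTk Sr) : W := tlift (fun z (s : S) => lift_rel (rt_in z) * sc s) y.
Lemma liftSE z s : liftS (@tpure _ _ _ RTk Sr z s) = lift_rel (rt_in z) * sc s.
Proof. exact: (tliftE liftS_bal). Qed.
Lemma liftSD y y' : liftS (y + y') = liftS y + liftS y'.
Proof. exact: (tliftD liftS_bal). Qed.

Definition kmap : bihom RTk VA := tmap (bid V) (qcl X) ∘ lam V ∘
  tmult V ∘ tmap (rel_incl R) (bid (tring_bimod V)) ∘ rt_in.
Lemma kmapE z : kmap z = qlam R (rmult (rt_in z)).
Proof. by []. Qed.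

Lemma rt_in_gr z : vt_gr k (rt_in z).
Proof.
elim/tpure_ind: z => [r u|z z' h h']; last by rewrite bhD; apply: smemD.
by rewrite /rt_in tmapE; apply: span_gen; exists r, (dinj (tpow V) k u); split=> //; exists u.
Qed.
End Degree.

Definition theta_hom : bihom (tens (tring_bimod V) Sr) (tens VA Sr) :=
  tmap (tmap (bid V) (qcl X) ∘ lam V) (bid Sr).
(** The map W = T (x) S -> V (x) A (x) S. It kills V L S, hence the component of degree m + 1 of V
    I_m + I_m, and so isolates the contribution of R (x) T (x) S. *)
Definition Theta (w : W) : tens VA Sr := theta_hom (phi w).
Lemma ThetaD w w' : Theta (w + w') = Theta w + Theta w'.
Proof. by rewrite /Theta phiD bhD. Qed.
Lemma ThetaE x s : Theta (jt x * sc s) = @tpure _ _ _ VA Sr (qlam R x) s.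
Proof. by rewrite -psi_pure /Theta phi_psi; apply: tmapE. Qed.

Lemma Theta0 : Theta 0 = 0. Proof. exact: (additive0 ThetaD). Qed.
Lemma ThetaB w w' : Theta (w - w') = Theta w - Theta w'. Proof. exact: (additiveB ThetaD). Qed.

Lemma Theta_V v w : tw_ideal t R w -> Theta (jt (tg v) * w) = 0.
Proof.
elim=> {w} [_ [l [s [Ll ->]]]||w w' _ h _ h'].
- have hl : span (@V_ideal _ _ _ R) (tg v * l) by apply: span_gen; exists v, l.
  rewrite mulrA -jtM ThetaE (qlam_V_ideal hl); exact: (@tpure0l _ _ _ VA Sr).
- by rewrite mulr0 Theta0.
- by rewrite mulrBr ThetaB h h' subrr.
Qed.

Lemma fideal_lead m w : fid m w -> tw_ideal t R (tcomp m w).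
Proof.
elim=> {m w} [p k w Pp hw|v m w _ h|m w h _|m|m w w' _ h _ h'].
- rewrite (tcomp_mulr _ _ hw); apply/tw_ideal_r/tw_rels_ideal.
  by apply/(P_topP P_top); exists p.
- by rewrite -add1n (tcomp_mull _ _ (jt_tgr t (tgr_tg v))); apply: tw_ideal_jt.
- by rewrite ((tltP m.+1 w).1 (fideal_tlt P_le h)) //; apply: smem0.
- by rewrite tcomp0; apply: smem0.
- by rewrite (additiveB (tcompD m)); apply: smemB.
Qed.

Lemma Theta_step m w : step m w -> Theta (tcomp m.+1 w) = 0.
Proof.
elim=> {w} [w [h|[v [w' [h ->]]]]||w w' _ h _ h'].
- by rewrite ((tltP m.+1 w).1 (fideal_tlt P_le h)) // Theta0.
- rewrite -add1n (tcomp_mull _ _ (jt_tgr t (tgr_tg v))); apply: Theta_V.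
  exact: fideal_lead.
- by rewrite tcomp0 Theta0.
- by rewrite (additiveB (tcompD _)) ThetaB h h' subrr.
Qed.

Lemma Theta_liftS k y : Theta (tcomp (n + k) (liftS y)) = tmap (kmap k) (bid Sr) y.
Proof.
elim/tpure_ind: y => [z s|y y' h h']; last first.
  by rewrite liftSD tcompD ThetaD h h' bhD.
rewrite liftSE tmapE kmapE tcomp_scr.
have -> : tcomp (n + k) (lift_rel (rt_in k z)) = jt (rmult (rt_in k z)).
  elim/tpure_ind: z => [r u|z z' h h'].
    rewrite [rt_in _ _]tmapE lift_relE rmultE jtM.
    have hu : tgr V k (dinj (tpow V) k u) by exists u.
    rewrite (tcomp_mulr _ _ (jt_tgr t hu)); congr (_ * _).
    have := (tltP n _).1 (av_lead r) n (leqnn n).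
    rewrite (additiveB (tcompD n)) (tgrP n (jt (relt r))).1; last exact: jt_tgr (rel_gr r).
    by move/eqP; rewrite subr_eq0 => /eqP.
  by rewrite bhD lift_relD tcompD rmultD jtD h h'.
exact: ThetaE.
Qed.

Lemma step_l m k k' w x : (k + k' = m.+1)%N -> fid k' w -> tgr V k x -> (0 < k)%N ->
  step m (jt x * w).
Proof.
move=> e hw; case: k e => // k [e] hx _; move: x hx.
have D a b : jt (a + b) * w = jt a * w + jt b * w by rewrite jtD mulrDl.
apply: (@tgr_genl _ _ k (preim_subgrp D (step m))) => x v hx /=.
rewrite jtM -mulrA; apply: fstep_V; rewrite -e; apply: fideal_mull => //.
exact: jt_tgr.
Qed.

Lemma av_fid r : fid n (av r).
Proof.
have := fideal_gen n (av_P r) (tgr_sc t 1).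
by rewrite addn0 sc1 mulr1.
Qed.

(** In r (x) b r' c two disjoint relations can be replaced by their lifts in either order. For a
    pair in X the two ways differ by Delta(u, w), which is in P by [compatible]. *)
Lemma step_ker_gen m k z : (n + k = m.+1)%N -> ker_gen compatible k z ->
  step m (lift_rel z).
Proof.
move=> e [[r [x [[b [r' [c [i [j [hb hc ek ->]]]]]] ->]]]|].
  rewrite lift_relE.
  have n0 : (0 < n)%N := ltnW n2.
  (* With this [l], av(r) (b r' c) = av(r) (b r' c - l) + (av(r) - r) l + r l. The first two terms
     lose a degree and lie in I_m; the last starts in V since n > 0. *)
  pose l := jt b * av r' * jt c.
  have hl : fid k l.
    by rewrite -ek; apply: fideal_mulr (jt_tgr t hc); apply: fideal_mull (jt_tgr t hb);
      apply: av_fid.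
  have k0 : (0 < k)%N by rewrite -ek addnAC addn_gt0 n0 orbT.
  have hlow : Wtlt k (jt (b * relt r' * c) - l).
    rewrite -opprB !jtM /l -mulrBl -mulrBr -ek; apply: smemN.
    apply: (tlt_mulr (jt_tgr t hc)); apply: (tlt_mull (jt_tgr t hb)); exact: av_lead.
  rewrite -(subrK l (jt (b * relt r' * c))) mulrDr; apply: smemD.
    apply: fstep_fideal; have -> : m = (n + k.-1)%N.
      by apply: succn_inj; rewrite -e -addnS prednK.
    apply: fideal_mulr_tlt; first exact: av_fid.
    by rewrite prednK.
  rewrite -(subrK (jt (relt r)) (av r)) mulrDl; apply: smemD; last first.
    exact: (step_l e hl (rel_gr r)).
  apply: fstep_fideal; have -> : m = (n.-1 + k)%N.
    by apply: succn_inj; rewrite -e -addSn prednK.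
  apply: fideal_mull_tlt => //; rewrite prednK //; exact: av_lead.
move=> [u [w [x [j [hC huw hx ek ->]]]]]; rewrite lift_rel_mul.
have em : (n + j)%N = m by apply: succn_inj; rewrite -e ek addnS.
have -> : lift_rel (tmap (bid RM) (tgen V) w) = psk (tens_V t alpha w).
  elim/tpure_ind: w {huw} => [r v|w w' h h']; last by rewrite !bhD lift_relD pskD h h'.
  by rewrite tmapE lift_relE psk_tens_V.
have -> : psk (tens_V t alpha w) =
    psk (V_tens alpha u) - (psk (V_tens alpha u) - psk (tens_V t alpha w)).
  by rewrite opprB addrC subrK.
rewrite mulrBl; apply: smemB; last first.
  rewrite -em; apply/fstep_fideal/fideal_gen; [exact: hC|exact: jt_tgr].
elim/tpure_ind: u {huw} => [v r|u u' h h'].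
  rewrite psk_V_tens -mulrA; apply: fstep_V; rewrite -em.
  by apply: fideal_mulr (jt_tgr t hx); apply: av_fid.
by rewrite bhD pskD mulrDl; apply: smemD.
Qed.

(** By flatness the kernel is spanned by pure tensors z (x) s with [kmap k z = 0], and
    [kernel_generators] describes each such z. *)
Lemma step_ker m k y : (n + k = m.+1)%N -> tmap (kmap k) (bid Sr) y = 0 -> step m (liftS y).
Proof.
move=> e /(flat_ker S_flat); move: y.
apply: (@span_map _ _ _ (@liftSD k) _ (step m)) => _ [z [s [hz ->]]].
rewrite liftSE; apply: fstep_scr; rewrite kmapE in hz.
have := kernel_generators V_proj R_proj tor (rt_in_gr z) (qlam_ker (rmult0 n2 _) hz).
by apply: (@span_map _ _ _ lift_relD _ (step m)) => y; apply: step_ker_gen.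
Qed.

Definition liftS_range k : subgrp W :=
  @img_subgrp _ _ (@liftS k) (additiveB (@liftSD k)) (full_subgrp _).

Lemma liftS_rangeP r k w : Wtgr k w -> liftS_range k (av r * w).
Proof.
move: w; apply: (tw_gr_gen (H := preim_subgrp (mulrDr (av r)) (liftS_range k))).
move=> _ s [u ->]; exists (@tpure _ _ _ (tens RM (tpow V k)) Sr (tpure r u) s) => //.
by rewrite liftSE [rt_in _ _]tmapE lift_relE mulrA.
Qed.

(** Only generators p w of index m + 1 contribute to the lift: p is a combination of terms av(r) s,
    and s is absorbed into w. The other constructors already land in V I_m + I_m. *)
Lemma fideal_decomp m k w : (n + k = m.+1)%N -> fid m.+1 w ->
  exists2 w', liftS_range k w' & step m (w - w').
Proof.
move=> e h; move: {-2}m.+1 h (erefl m.+1) => m' h.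
elim: h => {m' w} [p k' w Pp hw|v m' w h _|m' w h _|m'|m' w w' _ h _ h'] em.
- have ek : k' = k by apply/eqP; rewrite -(eqn_add2l n) e em.
  rewrite ek in hw; exists ((p : W) * w); last by rewrite subrr; apply: smem0.
  apply: (@span_map _ _ (fun p : W => p * w) (fun a b => mulrDl a b w) _ (liftS_range k)
    _ _ (av_gen Pp)) => _ [r [s ->]].
  rewrite -mulrA; apply: liftS_rangeP.
  by rewrite -[k]add0n; apply: tgrM (tgr_sc t s) hw.
- by exists 0; [exact: smem0|rewrite subr0; apply: fstep_V; case: em => ->].
- by exists 0; [exact: smem0|rewrite subr0; apply: fstep_fideal; case: em => ->].
- by exists 0; [exact: smem0|rewrite subr0; apply: smem0].
- have [y ry hy] := h em; have [y' ry' hy'] := h' em; exists (y - y'); first exact: smemB.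
  by rewrite opprD addrACA -opprD; apply: smemB.
Qed.

Lemma fideal_lower m w : fid m.+1 w -> Wtlt m.+1 w -> fid m w.
Proof.
elim: m w => [|m IH] w hw wm.
  (* I_1 = 0 because n >= 2. *)
  by rewrite (fideal_low hw n2); apply: smem0.
have [lt|le] := ltnP m.+2 n; first by rewrite (fideal_low hw lt); apply: smem0.
have [k e] : exists k, (n + k = m.+2)%N by exists (m.+2 - n)%N; rewrite subnKC.
apply: (fstep_lower P_le V_proj) => //; first by move=> m' w' [<-]; apply: IH.
have [w' [y _ <-] hy] := fideal_decomp e hw.
rewrite -[w](subrK (liftS y)); apply: smemD => //; apply: (step_ker e).
(* [w] has no component of degree m + 2, and the [fstep] part is invisible to [Theta] there. So
   [Theta] also kills that component of [liftS y], and its value is [kmap] (x) S at [y]. *)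
have : Theta (tcomp m.+2 w) = 0 by rewrite ((tltP m.+2 w).1 wm) // Theta0.
rewrite -{1}[w](subrK (liftS y)) tcompD ThetaD (Theta_step hy) add0r -e.
by rewrite Theta_liftS.
Qed.

Lemma lead_tw_ideal m (w : W) :
  ideal ([set x | P x] : set W) w -> Wtlt m.+1 w -> tw_ideal t R (tcomp m w).
Proof.
move=> hw wm; apply: fideal_lead; exact: (ideal_fideal_tlt fideal_lower).
Qed.

End DegreeLowering.

(** * The conditions J *)

Section Conditions.
Variables (K S : pzRingType) (eta : {rmorphism K -> S}).
Variables (V : bimod K K) (t : twisting eta V).
Variables (n : nat) (R : subbimod (tpow V n)) (P : subbimod (tring_bimod (twV t))).
Hypothesis n2 : (1 < n)%N.
Local Notation T := (tring V).
Local Notation W := (tring (twV t)).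
Local Notation Sr := (SKS eta).
Local Notation Sk := (SKK eta).
Local Notation RM := (sub_bimod R).
Local Notation TS := (tens (tring_bimod V) Sk).
Local Notation jt := (jt t).
Local Notation sc := (@sc _ _ _ _ t).
Local Notation psk := (@psk _ _ _ _ t).
Local Notation Wtlt := (tlt (twV t)).
Local Notation Wtgr := (tgr (twV t)).
Hypothesis P_le : forall x, P x -> Wtlt n.+1 x.
Hypothesis P_top : [set dinj (tpow (twV t)) n (dproj (tpow (twV t)) n x)
               | x in [set x | P x]] = twisted_rel t R.

Definition rel_S (y : tens RM Sk) : W := psk (tmap (rel_incl R) (bid Sk) y).
Lemma rel_SE r s : rel_S (@tpure _ _ _ RM Sk r s) = jt (relt r) * sc s.
Proof. by rewrite /rel_S tmapE; apply: pskE. Qed.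
Lemma rel_SD y y' : rel_S (y + y') = rel_S y + rel_S y'.
Proof. by rewrite /rel_S bhD pskD. Qed.
Lemma rel_S_surj w : tw_rels t R w -> exists y, rel_S y = w.
Proof.
elim=> {w} [_ [r [s ->]]||w w' _ [y <-] _ [y' <-]].
- by exists (@tpure _ _ _ RM Sk r s); apply: rel_SE.
- by exists 0; rewrite (additive0 rel_SD).
- by exists (y - y'); rewrite (additiveB rel_SD).
Qed.

Variable alpha : bihom RM TS.
Local Notation av := (av t alpha).

Lemma psk_alpha i r : psk (alpha_ alpha i r) = tcomp (n - i) (psk (alpha r)).
Proof. exact: psk_component. Qed.

Lemma psk_delta_V i u : (i <= n)%N ->
  psk (V_tens (alpha_ alpha i) u) = tcomp (n - i).+1 (psk (V_tens alpha u)).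
Proof.
move=> _; elim/tpure_ind: u => [v r|u u' h h']; last by rewrite !bhD !pskD tcompD h h'.
by rewrite !psk_V_tens psk_alpha -add1n (tcomp_mull _ _ (jt_tgr t (tgr_tg v))).
Qed.
Lemma psk_delta_tens i w : (i <= n)%N ->
  psk (tens_V t (alpha_ alpha i) w) = tcomp (n - i).+1 (psk (tens_V t alpha w)).
Proof.
move=> _; elim/tpure_ind: w => [r v|w w' h h']; last by rewrite !bhD !pskD tcompD h h'.
by rewrite !psk_tens_V psk_alpha -addn1 (tcomp_mulr _ _ (jt_tgr t (tgr_tg v))).
Qed.

Definition Delta (u : tens V RM) (w : tens RM V) : W :=
  psk (V_tens alpha u) - psk (tens_V t alpha w).

(** The factor from V raises the degree n - i of alpha_i by one. So delta 1 is the component of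
    degree n, where the leading forms of P live, and delta (i + 1) has degree n - i, like alpha_i
    (x) S. *)
Lemma psk_delta i u w : (i <= n)%N ->
  psk (delta t alpha i u w) = tcomp (n - i).+1 (Delta u w).
Proof.
move=> hi; rewrite /delta (additiveB (@pskD _ _ _ _ t)) psk_delta_V // psk_delta_tens //.
by rewrite /Delta (additiveB (tcompD _)).
Qed.

Definition lift_S (y : tens RM Sk) : W := psk (b_S alpha y).
Lemma lift_SE r s : lift_S (@tpure _ _ _ RM Sk r s) = av r * sc s.
Proof. exact: psk_b_S. Qed.
Lemma lift_SD y y' : lift_S (y + y') = lift_S y + lift_S y'.
Proof. by rewrite /lift_S bhD pskD. Qed.

Lemma psk_alpha_S i y : psk (alpha_S alpha i y) = tcomp (n - i) (lift_S y).
Proof.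
elim/tpure_ind: y => [r s|y y' h h']; last by rewrite bhD pskD lift_SD tcompD h h'.
rewrite lift_SE -[alpha_S alpha i]/(b_S (alpha_ alpha i)) psk_b_S psk_alpha.
by rewrite tcomp_scr.
Qed.

Hypothesis norm : normalized alpha.
Hypothesis av_P : forall r, P (av r).

Lemma av_top r : tcomp n (av r) = jt (relt r).
Proof.
have := psk_alpha 0 r; rewrite subn0 norm => <-; exact: (etrans (pskE _ _ _) (mulr1 _)).
Qed.
Lemma av_lead r : Wtlt n (av r - jt (relt r)).
Proof. by rewrite -av_top; apply/tltS/P_le. Qed.

Lemma lift_S_P y : P (lift_S y).
Proof.
elim/tpure_ind: y => [r s|y y' h h']; last by rewrite lift_SD; apply: smemD.
by rewrite lift_SE; apply/P_scr/av_P.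
Qed.
Lemma lift_S_top y : tcomp n (lift_S y) = rel_S y.
Proof.
elim/tpure_ind: y => [r s|y y' h h']; last by rewrite lift_SD tcompD rel_SD h h'.
by rewrite lift_SE rel_SE tcomp_scr av_top.
Qed.

(** The components of degree n + 1 of the two terms are the images of [u] and [w] in T^{n+1}, and
    they cancel for a pair in X. *)
Lemma Delta_tlt u w : in_X u w -> Wtlt n.+1 (Delta u w).
Proof.
move=> huw.
have hV u' : Wtlt n.+2 (psk (V_tens alpha u')) /\
    tcomp n.+1 (psk (V_tens alpha u')) = jt (tmult V (tmap (tgen V) (rel_incl R) u')).
  elim/tpure_ind: u' => [v r|a b [ha ha'] [hb hb']]; last first.
    rewrite !bhD pskD tcompD ha' hb' -jtD; split=> //; exact: smemD.
  rewrite psk_V_tens tmapE [tmult V _]tens_homE; split.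
    rewrite -add1n; apply: (tlt_mull (jt_tgr t (tgr_tg v))); exact: P_le (av_P r).
  by rewrite -add1n (tcomp_mull _ _ (jt_tgr t (tgr_tg v))) av_top -jtM.
have hW w' : Wtlt n.+2 (psk (tens_V t alpha w')) /\
    tcomp n.+1 (psk (tens_V t alpha w')) = jt (tmult V (tmap (rel_incl R) (tgen V) w')).
  elim/tpure_ind: w' => [r v|a b [ha ha'] [hb hb']]; last first.
    rewrite !bhD pskD tcompD ha' hb' -jtD; split=> //; exact: smemD.
  rewrite psk_tens_V tmapE [tmult V _]tens_homE; split.
    rewrite -addn1; apply: (tlt_mulr (jt_tgr t (tgr_tg v))); exact: P_le (av_P r).
  by rewrite -addn1 (tcomp_mulr _ _ (jt_tgr t (tgr_tg v))) av_top -jtM.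
have [ku eu] := hV u; have [kw ew] := hW w.
apply: tlt_comp0; first exact: smemB.
by rewrite (additiveB (tcompD _)) eu ew huw subrr.
Qed.

(** Both terms are multiples of elements of V; this is the origin of the 0 on the right of the last
    condition J. *)
Lemma Delta_comp0 u w : tcomp 0 (Delta u w) = 0.
Proof.
rewrite /Delta (additiveB (tcompD _)).
have -> : tcomp 0 (psk (V_tens alpha u)) = 0.
  elim/tpure_ind: u => [v r|a b ha hb]; last by rewrite bhD pskD tcompD ha hb addr0.
  by rewrite psk_V_tens (tcomp_mull_lt _ (jt_tgr t (tgr_tg v))).
have -> : tcomp 0 (psk (tens_V t alpha w)) = 0.
  elim/tpure_ind: w => [r v|a b ha hb]; last by rewrite bhD pskD tcompD ha hb addr0.
  by rewrite psk_tens_V (tcomp_mulr_lt _ (jt_tgr t (tgr_tg v))).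
exact: subrr.
Qed.

(** [J_0] provides [y], hence the element [lift_S y] of P; the other conditions say, one degree at a
    time, that it equals Delta(u, w). *)
Lemma J_compatible : J_0 t alpha -> (forall i, (0 < i < n)%N -> J_i t alpha i) ->
  J_n t alpha -> compatible P alpha.
Proof.
move=> J0 Ji Jn u w huw; have [y hy] := J0 u w huw.
suff e : Delta u w = lift_S y by rewrite -/(Delta u w) e; apply: lift_S_P.
have n1 : (0 < n)%N := ltnW n2.
apply: dsum_ext => q; have [lt|le] := ltnP n q.
  by rewrite (Delta_tlt huw) ?(P_le (lift_S_P y)).
suff : tcomp q (Delta u w) = tcomp q (lift_S y).
  by move/(congr1 (fun z : W => z q)); rewrite ![X in X = _](dinjE _) [X in _ = X](dinjE _).
move: le; rewrite leq_eqVlt => /orP[/eqP ->|lt].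
  rewrite lift_S_top /rel_S hy psk_delta //.
  by rewrite subn1 prednK.
have [q0|q0] := posnP q.
  rewrite q0 -{2}(subnn n) -psk_alpha_S (Jn u w y huw hy) (additive0 (@pskD _ _ _ _ t)).
  exact: Delta_comp0.
(* The component of degree [q] is governed by the condition of index n - q. *)
have hi : (0 < n - q < n)%N by rewrite subn_gt0 lt ltn_subrL q0.
have := congr1 psk (Ji _ hi u w y huw hy); rewrite psk_alpha_S psk_delta.
  have e1 : (n - (n - q) = q)%N by rewrite subKn // ltnW.
  have e2 : ((n - (n - q).+1).+1 = q)%N by rewrite subnSK ?e1 //; case/andP: hi.
  by rewrite e1 e2.
by case/andP: hi.
Qed.

Lemma lift_S_Delta u w y :
  (forall p, P p -> Wtlt n p -> p = 0) -> in_X u w -> P (Delta u w) ->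
  rel_S y = tcomp n (Delta u w) -> lift_S y = Delta u w.
Proof.
move=> P0 huw hP hy; apply/eqP; rewrite -subr_eq0; apply/eqP; apply: P0.
  by apply: smemB => //; apply: lift_S_P.
apply: tlt_comp0; first by apply: smemB; [apply/P_le/lift_S_P|apply: Delta_tlt].
by rewrite (additiveB (tcompD n)) lift_S_top hy subrr.
Qed.

Lemma delta1_liftP u w y : delta1_lift t alpha u w y <-> rel_S y = tcomp n (Delta u w).
Proof.
have -> : tcomp n (Delta u w) = psk (delta t alpha 1 u w).
  by rewrite psk_delta ?(ltnW n2) // subn1 prednK // ltnW.
by split=> [e|/psk_inj]; first by rewrite /rel_S e.
Qed.

Lemma compatible_J : (forall p, P p -> Wtlt n p -> p = 0) -> compatible P alpha ->
  [/\ J_0 t alpha, forall i, (0 < i < n)%N -> J_i t alpha i & J_n t alpha].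
Proof.
move=> P0 hC; split=> [u w huw|i /andP[i0 hi] u w y huw /delta1_liftP hy
  |u w y huw /delta1_liftP hy].
- have : tw_rels t R (tcomp n (Delta u w)).
    by apply/(P_topP P_top); exists (Delta u w) => //; apply: hC.
  by move=> /rel_S_surj [y hy]; exists y; apply/delta1_liftP.
- apply: (@psk_inj _ _ _ _ t).
  rewrite psk_alpha_S psk_delta // (lift_S_Delta P0 huw (hC _ _ huw) hy).
  by rewrite subnSK.
- apply: (@psk_inj _ _ _ _ t).
  rewrite psk_alpha_S (lift_S_Delta P0 huw (hC _ _ huw) hy) subnn Delta_comp0.
  by rewrite (additive0 (@pskD _ _ _ _ t)).
Qed.

End Conditions.

Section Span.
Variables (L S : pzRingType) (M : bimod L S) (X : set M).
Lemma rspanN x : rspan X x -> rspan X (- x).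
Proof. by move=> h; rewrite -sub0r; apply: rspan_sub => //; apply: rspan_zero. Qed.
Lemma rspanD x y : rspan X x -> rspan X y -> rspan X (x + y).
Proof. by move=> h h'; rewrite -[y]opprK; apply: rspan_sub => //; apply: rspanN. Qed.
End Span.

(** * Necessity of the conditions *)

Section Deformation.
Variables (K S : pzRingType) (eta : {rmorphism K -> S}).
Variables (V : bimod K K) (t : twisting eta V).
Variables (n : nat) (R : subbimod (tpow V n)) (P : subbimod (tring_bimod (twV t))).
Local Notation T := (tring V).
Local Notation W := (tring (twV t)).
Local Notation Sr := (SKS eta).
Local Notation Sk := (SKK eta).
Local Notation RM := (sub_bimod R).
Local Notation TS := (tens (tring_bimod V) Sk).
Local Notation jt := (jt t).
Local Notation sc := (@sc _ _ _ _ t).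
Local Notation psk := (@psk _ _ _ _ t).
Local Notation Wtlt := (tlt (twV t)).
Local Notation Pset := ([set x | P x] : set W).
Hypothesis P_le : forall x, P x -> Wtlt n.+1 x.
Hypothesis P_top : [set dinj (tpow (twV t)) n (dproj (tpow (twV t)) n x)
               | x in [set x | P x]] = twisted_rel t R.

Lemma tw_ideal_low m w : tw_ideal t R w -> (m < n)%N -> tcomp m w = 0.
Proof.
move=> h lt; elim: h => {w} [_ [l [s [Ll ->]]]||w w' _ h _ h'].
- by rewrite tcomp_scr jt_tcomp (ideal_rel_low Ll lt)
    (additive0 (@jtD _ _ _ _ t)) mul0r.
- exact: tcomp0.
- by rewrite (additiveB (tcompD m)) h h' subrr.
Qed.
Lemma tw_ideal_degn w : tw_ideal t R w -> tw_rels t R (tcomp n w).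
Proof.
elim=> {w} [_ [l [s [Ll ->]]]||w w' _ h _ h'].
- rewrite tcomp_scr jt_tcomp; have [r ->] := ideal_rel_degn Ll.
  by apply: span_gen; exists r, s.
- by rewrite tcomp0; apply: smem0.
- by rewrite (additiveB (tcompD n)); apply: smemB.
Qed.

Section Forward.
Hypothesis lead : forall m (x : W), ideal Pset x -> Wtlt m.+1 x -> tw_ideal t R (tcomp m x).

(** A leading form of degree below n would lie in L S, which is zero there; so the degree bound
    descends to 0. *)
Lemma ideal_low (x : W) : ideal Pset x -> Wtlt n x -> x = 0.
Proof.
move=> Px; suff h m : (m <= n)%N -> Wtlt m x -> x = 0 by apply: h.
elim: m => [|m IH] le xm; first exact: tlt0.
apply: IH; first exact: ltnW.
apply: (tlt_comp0 xm); rewrite -(tgrP m (tcomp m x)).1; last exact: tgr_comp.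
exact: tw_ideal_low (lead Px xm) le.
Qed.
Lemma P_low p : P p -> Wtlt n p -> p = 0.
Proof. by move=> Pp; apply: ideal_low; apply: ideal_gen. Qed.

Lemma P_uniq (p p' : W) : P p -> P p' -> tcomp n p = tcomp n p' -> p = p'.
Proof.
move=> Pp Pp' e; apply/eqP; rewrite -subr_eq0; apply/eqP; apply: P_low.
  exact: (smemB Pp Pp').
apply: tlt_comp0; first exact: (smemB (P_le Pp) (P_le Pp')).
by rewrite (additiveB (tcompD n)) e subrr.
Qed.

Lemma P_lift_ex (r : RM) : exists p : W, P p /\ tcomp n p = jt (relt r).
Proof.
have : tw_rels t R (jt (relt r)) by apply: span_gen; exists r, 1; rewrite sc1 mulr1.
by move=> /(P_topP P_top) [p Pp e]; exists p.
Qed.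
Definition P_lift (r : RM) : W := sval (cid (P_lift_ex r)).
Lemma P_liftP r : P (P_lift r). Proof. exact: (svalP (cid (P_lift_ex r))).1. Qed.
Lemma P_lift_top r : tcomp n (P_lift r) = jt (relt r).
Proof. exact: (svalP (cid (P_lift_ex r))).2. Qed.

Definition alpha_fun (r : RM) : TS := phi (P_lift r).
Lemma psk_alpha_fun r : psk (alpha_fun r) = P_lift r.
Proof. exact: psi_phi. Qed.
(** The values are picked by [cid], but an element of P is determined by its component of degree n,
    and this forces linearity. *)
Lemma alpha_subproof : is_bihom alpha_fun.
Proof.
split=> [r r'|k r|r k]; apply: (@psk_inj _ _ _ _ t); apply: P_uniq;
  rewrite ?(pskD, psk_l, psk_r) ?psk_alpha_fun.
- exact: P_liftP.
- exact: (smemD (P_liftP r) (P_liftP r')).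
- by rewrite tcompD !P_lift_top relD jtD.
- exact: P_liftP.
- exact/P_scl/P_liftP.
- by rewrite tcomp_scl !P_lift_top rel_l jtM jt_const.
- exact: P_liftP.
- exact/P_scr/P_liftP.
- by rewrite tcomp_scr !P_lift_top rel_r jtM jt_const.
Qed.
Definition alpha_P : bihom RM TS := Bihom alpha_subproof.
Local Notation alpha := alpha_P.
Lemma av_alphaP r : P (av t alpha r).
Proof. by rewrite /av psk_alpha_fun; apply: P_liftP. Qed.

Lemma alpha_filtered : is_filtered alpha.
Proof.
move=> r; pose H := img_subgrp (bhB (tmap (sub_incl (tlt V n.+1)) (bid Sk))) (full_subgrp _).
suff : H (alpha r) by case=> y _ <-; exists y.
have -> : alpha r = \sum_(q < n.+1) TS_component eta V q (alpha r).
  apply: (@psk_inj _ _ _ _ t); rewrite [RHS](additive_sum (@pskD _ _ _ _ t)).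
  transitivity (\sum_(q < n.+1) tcomp q (P_lift r)).
    rewrite [LHS]psk_alpha_fun; apply: dsum_decomp => m hm.
    exact: (P_le (P_liftP r)).
  by apply: eq_bigr => q _; rewrite -psk_alpha_fun [RHS]psk_component.
apply: smem_sum => q _; elim/tpure_ind: (alpha r) => [x s|x y hx hy]; last first.
  by rewrite bhD; apply: smemD.
rewrite [TS_component _ _ _ _]tmapE.
have hx : tlt V n.+1 (tcomp q x) by apply: tgr_tlt (tgr_comp q x).
exists (@tpure _ _ _ (sub_bimod (tlt V n.+1)) Sk (Subcar (introT (asboolP _) hx)) s) => //.
by rewrite tmapE.
Qed.

Lemma alpha_normalized : normalized alpha.
Proof.
move=> r; apply: (@psk_inj _ _ _ _ t); rewrite psk_alpha subn0 psk_alpha_fun P_lift_top.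
by apply: esym; apply: (etrans (pskE _ _ _) (mulr1 _)).
Qed.

Lemma psi_ract (z : tens (tring_bimod V) Sr) s : psi t (ract z s) = (psi t z : W) * sc s.
Proof. by rewrite (bhr (psi t)) -tractM. Qed.

Lemma alpha_span : rspan (M := tens (tring_bimod V) Sr) (range alpha) = [set z | P (psi t z)].
Proof.
rewrite eqEsubset; split=> [z|z Pz].
  elim=> {z} [_ [r _ <-]||z z' _ h _ h'|z s _ h].
  - exact: av_alphaP.
  - suff : P (psi t 0) by [].
    rewrite (bh0 (psi t)); exact: smem0.
  - suff : P (psi t (z - z')) by [].
    rewrite (bhB (psi t)); exact: (smemB h h').
  - suff : P (psi t (ract z s)) by [].
    rewrite psi_ract; exact: P_scr.
have [y hy] : exists y : tens RM Sk, rel_S t y = tcomp n (psi t z).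
  by apply: rel_S_surj; apply/(P_topP P_top); exists (psi t z).
(* After psi both sides lie in P and have the same component of degree n. *)
have <- : b_S alpha y = z.
  apply: (@psk_inj _ _ _ _ t); apply: P_uniq => //.
    exact: (lift_S_P av_alphaP y).
  exact: (etrans (lift_S_top t alpha_normalized y) hy).
elim/tpure_ind: y {hy} => [r s|y y' h h']; last by rewrite bhD; apply: rspanD.
have -> : b_S alpha (@tpure _ _ _ RM Sk r s) =
    ract (alpha r : tens (tring_bimod V) Sr) s.
  apply: (@psk_inj _ _ _ _ t); rewrite psk_b_S; exact: esym (psi_ract _ _).
by apply/rspan_r/rspan_gen; exists r.
Qed.

(** A priori Delta(u, w) is only in <P>. Its component of degree n lies in R S, so it is shared with
    some [p] in P, and <P> has no nonzero element of degree below n. *)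
Lemma alpha_compatible : compatible P alpha.
Proof.
move=> u w huw.
have ID : ideal Pset (Delta t alpha u w).
  apply: smemB.
    elim/tpure_ind: u {huw} => [v r|a b ha hb]; last by rewrite bhD pskD; apply: smemD.
    by rewrite psk_V_tens; apply/ideal_l/ideal_gen/av_alphaP.
  elim/tpure_ind: w {huw} => [r v|a b ha hb]; last by rewrite bhD pskD; apply: smemD.
  by rewrite psk_tens_V; apply/ideal_r/ideal_gen/av_alphaP.
have Dn := Delta_tlt P_le alpha_normalized av_alphaP huw.
have := tw_ideal_degn (lead ID Dn); rewrite (tgrP n _).1; last exact: tgr_comp.
move=> /(P_topP P_top) [p Pp e].
suff e' : Delta t alpha u w = p by rewrite -[_ - _]/(Delta t alpha u w) e'.
apply/eqP; rewrite -subr_eq0; apply/eqP; apply: ideal_low.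
  by apply: smemB => //; apply: ideal_gen.
apply: tlt_comp0; first exact: (smemB Dn (P_le Pp)).
by rewrite (additiveB (tcompD n)) e subrr.
Qed.

End Forward.
End Deformation.


Theorem theorem5p19
    (K S : pzRingType) (eta : {rmorphism K -> S})
    (S_flat : flat (as_lmod (SKS eta)))
    (V : bimod K K) (t : twisting eta V)
    (n : nat) (n2 : (2 <= n)%N)
    (R : subbimod (tpow V n)) (R_inv : tw_invariant t R)
    (V_proj : projective (as_rmod V))
    (R_proj : projective (as_rmod (sub_bimod R)))
    (res : gr_proj_resolution (alg_gr R)
             (deg0_gr (as_rmod (ground R n2))))
    (Tor3_pure : Tor res (as_lmod (ground R n2)) 3 = Tor_gr res (as_lmod (ground R n2)) 3 n.+1)
    (P : subbimod (tring_bimod (twV t)))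
    (P_le : forall x, P x -> tlt (twV t) n.+1 x)
    (P_top : [set dinj (tpow (twV t)) n (dproj (tpow (twV t)) n x)
               | x in [set x | P x]] = twisted_rel t R) :
  is_PBW_deformation (twisted_rel t R) [set x | P x] <->
  exists alpha : bihom (sub_bimod R) (tens (tring_bimod V) (SKK eta)),
    [/\ is_filtered alpha,
        normalized alpha,
        rspan (M := tens (tring_bimod V) (SKS eta)) (range alpha)
          = [set z | P (psi t z)]
      & Tor res (as_lmod (ground R n2)) 3 = [set 0] \/
        [/\ J_0 t alpha,
            forall i, (0 < i < n)%N -> J_i t alpha i
          & J_n t alpha]].
Proof.
have relLL w : ideal (twisted_rel t R) w <-> tw_ideal t R w := twisted_idealP P_top w.
have lead_rel m x := @lead_twisted _ _ _ _ t n R P P_le P_top m x.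
rewrite (PBW_lead lead_rel); split=> [lead|[alpha [_ norm span_P cond]] m x Px xm].
  have lead' m (x : tring (twV t)) : ideal ([set x | P x] : set (tring (twV t))) x ->
      tlt (twV t) m.+1 x -> tw_ideal t R (tcomp m x).
    by move=> Px xm; apply/relLL/lead.
  exists (alpha_P P_le P_top lead'); split.
  - exact: alpha_filtered.
  - exact: alpha_normalized.
  - exact: alpha_span.
  - right; apply: (compatible_J n2 P_le P_top).
    + exact: alpha_normalized.
    + exact: av_alphaP.
    + exact: (P_low lead').
    + exact: alpha_compatible.
have inP z : rspan (M := tens (tring_bimod V) (SKS eta)) (range alpha) z <-> P (psi t z).
  by rewrite span_P.
have avP r : P (av t alpha r) by apply/inP/rspan_gen; exists r.
apply/relLL; apply: (lead_tw_ideal S_flat P_le P_top V_proj R_proj avP) Px xm.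
- exact: (av_lead P_le norm avP).
(* The equality alpha(R) S = P, carried over to W: elements of P are sums of terms av(r) s. *)
- move=> p; have [z <-] := psi_surj p => /inP.
  elim=> {z} [_ [r _ <-]||z z' _ h _ h'|z s _ h].
  + by apply: span_gen; exists r, 1; rewrite sc1 mulr1.
  + by rewrite (bh0 (psi t)); apply: span_zero.
  + by rewrite (bhB (psi t)); apply: span_sub.
  + rewrite psi_ract; move: h.
    apply: (@span_map _ _ (fun w : tring (twV t) => w * sc t s) (fun a b => mulrDl a b _)
      _ (span _)) => _ [r [s' ->]].
    by apply: span_gen; exists r, (s' * s); rewrite -mulrA scM.
- case: cond => [Tor0|[J0 Ji Jn]]; [left|right]; first exact: Tor0.
  by split=> //; apply: (J_compatible n2 P_le norm avP J0 Ji Jn).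
Qed.
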